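(* Let $g\in C^2(\mathbb{R}^d,\mathbb{R})$ be bounded by some $r>0$, i.e. $|g(x)|\le r$ for all $x\in\mathbb{R}^d$. Assume that there exist $K>0$ and $G>0$ such that 1. $\inf_{x\in\mathbb{R}^d}\lambda_{\min}(\mathrm{Hess}(g)(x))>-\infty$; 2. $|g(x)-g(y)|\le K\|x-y\|$ for all $x,y\in\mathbb{R}^d$; 3. $\|\nabla g(x)-\nabla g(y)\|\le G\|x-y\|$ for all $x,y\in\mathbb{R}^d$. For $\sigma>0$ define $$H^g_\sigma := \inf_{x\in\mathbb{R}^d}(1-F_\sigma(x))\,\lambda_{\min}(\mathrm{Hess}(g)(x)),\quad \alpha_\sigma=\frac{H^g_\sigma}{\sigma}+1,\quad L_\sigma=\frac{e^{(-\mu+r)/\sigma}}{\sigma^2}K^2+\frac{2G}{\sigma}+1,$$ where $\mu=\mu(\sigma)$. Fix $\sigma>0$ with $\sigma>\max\{-H^g_\sigma,0\}$, and let $\epsilon>0$ satisfy $\epsilon\le 2/(\alpha_\sigma+L_\sigma)$. Let $\pi_*$ be the probability distribution on $\mathbb{R}^d$ with density proportional to $e^{-V_\sigma}$, and let $\pi_k$ be the distribution of the $k$-th iterate $X_k$ of the unadjusted Langevin algorithm with potential $V_\sigma$, step size $\epsilon$ and initial distribution $\pi_0$. Then for all $k\ge0$, $$W_2(\pi_k,\pi_* )\le(1-\alpha_\sigma\epsilon)^k\,W_2(\pi_0,\pi_* )+1.82\,\frac{L_\sigma}{\alpha_\sigma}(\epsilon d)^{1/2}.$$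
   Context: $\|\cdot\|$ is the Euclidean norm on $\mathbb{R}^d$, $\mathrm{Hess}(f)$ is the Hessian of $f$, and $\lambda_{\min}(M)$ is the smallest eigenvalue of a symmetric matrix $M$. Let $\mu=\mu(\sigma)>0$ be a parameter depending on $\sigma>0$ such that $\lim_{\sigma\to0}\mu(\sigma)=0$ and $\lim_{\sigma\to0} e^{-\mu(\sigma)/\sigma}/\sigma = 0$. For $g:\mathbb{R}^d\to\mathbb{R}$ and $\sigma>0$ define $$F_\sigma(x)=\frac{1}{1+\exp\left(\frac{-\mu(\sigma)+g(x)}{\sigma}\right)},\qquad V_\sigma(x)=-\log F_\sigma(x)+\frac12\|x\|^2,\quad x\in\mathbb{R}^d.$$ The unadjusted Langevin algorithm with potential $V$, step size $\epsilon>0$ and initial distribution $\pi_0$ (a probability distribution on $\mathbb{R}^d$) is the Markov chain $X_0\sim\pi_0$, $X_{k+1}=X_k-\epsilon\nabla V(X_k)+\sqrt{2\epsilon}\,Z_k$ for $k\ge0$, where $Z_k\sim N(0,I)$ is independent of $X_k$. $W_2$ is the 2-Wasserstein distance: $W_2(\rho_1,\rho_2) = \left(\inf_{\xi}\int_{\mathbb{R}^d\times\mathbb{R}^d}\|x-y\|^2\,\xi(\mathrm{d}x,\mathrm{d}y)\right)^{1/2}$, the infimum being over all couplings $\xi$ on $\mathbb{R}^d\times\mathbb{R}^d$ with marginals $\rho_1$ and $\rho_2$. *)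

(* Defs.v *)
From HB Require Import structures.
From mathcomp Require Import all_boot all_order all_algebra.
From mathcomp Require Import all_classical all_reals all_analysis.
From mathcomp Require Import measurable_realfun.

Set Implicit Arguments.
Unset Strict Implicit.
Unset Printing Implicit Defensive.

Import Order.TTheory GRing.Theory Num.Theory.
Import numFieldNormedType.Exports.

Local Open Scope classical_set_scope.
Local Open Scope ring_scope.

Definition borel_rV_display : measure_display.
Proof. exact: default_measure_display. Qed.

(* R^n is 'rV[R]_n. The norm which the library puts on matrices is the sup norm;
   its topology is the usual one, so that "open", "continuous" and
   "differentiable" have their usual meaning, but the Euclidean norm has to be
   introduced separately (enorm). The sigma-algebra is the Borel one. *)
Section borel_rV.
Context {R : realType} (n : nat).

Let borel0 : <<s @open 'rV[R]_n >> set0.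
Proof. exact: sigma_algebra0. Qed.

Let borelC A : <<s @open 'rV[R]_n >> A -> <<s @open 'rV[R]_n >> (~` A).
Proof. exact: sigma_algebraC. Qed.

Let borel_bigcup (F : (set 'rV[R]_n)^nat) :
  (forall i, <<s @open 'rV[R]_n >> (F i)) ->
  <<s @open 'rV[R]_n >> (\bigcup_i F i).
Proof. exact: sigma_algebra_bigcup. Qed.

HB.instance Definition _ := @isMeasurable.Build borel_rV_display 'rV[R]_n
  <<s @open 'rV[R]_n >> borel0 borelC borel_bigcup.

End borel_rV.

Section borel_rV_theory.
Context {R : realType}.

Lemma open_measurable_rV n (A : set 'rV[R]_n) : open A -> measurable A.
Proof. exact: sub_sigma_algebra. Qed.

Lemma measurable_coord_rV n (i : 'I_n) :
  measurable_fun [set: 'rV[R]_n] (fun x : 'rV[R]_n => x 0 i).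
Proof.
apply: (measurability _ (RGenOpens.measurableE R)).
move=> _ [_ [a [b ->]] <-]; rewrite setTI; apply: open_measurable_rV.
by apply: open_comp => [x _|]; [exact: coord_continuous|exact: interval_open].
Qed.

Let qball n (c : 'rV[rat]_n * nat) : set 'rV[R]_n :=
  [set x | forall i, `|ratr (c.1 0 i) - x 0 i| < c.2.+1%:R^-1].

Lemma open_bigcup_qball n (A : set 'rV[R]_n) : open A ->
  A = \bigcup_(c in [set c | qball c `<=` A]) qball c.
Proof.
move=> oA; apply/seteqP; split=> [x Ax|x [c cA]]; last exact: cA.
have : nbhs x A by move: oA; rewrite openE; apply.
move=> /nbhs_ballP[e /= e0 eA].
pose k := Num.truncn (2 / e).
have ke : k.+1%:R^-1 + k.+1%:R^-1 <= e.
  have : 2 / e < k.+1%:R by exact: truncnS_gt.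
  rewrite ltr_pdivrMr// => ke.
  by rewrite -mulr2n -[leLHS]mulr_natl ler_pdivrMr// mulrC ltW// mulrC.
have /choice[q qP] (i : 'I_n) : exists q : rat, `|ratr q - x 0 i| < k.+1%:R^-1.
  have /rat_in_itvoo[q] : x 0 i - k.+1%:R^-1 < x 0 i + k.+1%:R^-1.
    by rewrite ltrD2l gtrN// invr_gt0.
  rewrite in_itv/= => /andP[q1 q2]; exists q.
  by rewrite ltr_norml ltrBlDl q2 andbT ltrBrDl.
exists (\row_i q i, k); last by move=> i; rewrite mxE.
move=> y yq; apply: eA; split => // i j; rewrite ord1 /ball/=.
rewrite (@lt_le_trans _ _ (k.+1%:R^-1 + k.+1%:R^-1))//.
rewrite -(subrK (ratr (q j)) (x 0 j)) -addrA (le_lt_trans (ler_normD _ _))//.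
by rewrite ltrD// ?[`|x _ _ - _|]distrC//; have := yq j; rewrite mxE.
Qed.

Lemma measurable_fun_rVP d (T : measurableType d) n (f : T -> 'rV[R]_n) :
  measurable_fun [set: T] f <->
  forall i, measurable_fun [set: T] (fun t => f t 0 i).
Proof.
split=> [mf i|mf].
  exact: (measurableT_comp (measurable_coord_rV i) mf).
apply: (measurability (@open 'rV[R]_n)) => //.
move=> _ [A oA <-]; rewrite setTI (open_bigcup_qball oA) preimage_bigcup.
rewrite bigcup_mkcond; apply: countable_bigcupT_measurable => [|c].
  exact: countableP.
case: ifPn => // _.
rewrite [X in measurable X](_ : _ = \bigcap_(i in [set: 'I_n])
    ((fun t => f t 0 i) @^-1` (fun x => `|ratr (c.1 0 i) - x| < c.2.+1%:R^-1))).
  apply: fin_bigcap_measurable => // i _; rewrite -[X in measurable X]setTI.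
  apply: mf => //; rewrite [X in measurable X](_ : _ =
    `]ratr (c.1 0 i) - c.2.+1%:R^-1, ratr (c.1 0 i) + c.2.+1%:R^-1[%classic)//.
  by apply/seteqP; split=> x /=;
    rewrite in_itv/= distrC ltr_norml ltrBrDl (ltrBlDl x).
by apply/seteqP; split=> [t tq i _|t tq i]; [exact: tq|exact: (tq i)].
Qed.

(* measurableTypeR R is R with the sigma-algebra for which lebesgue_measure and
   normal_prob are declared. *)
Definition cons_rV n (p : measurableTypeR R * 'rV[R]_n) : 'rV[R]_n.+1 :=
  row_mx (const_mx p.1 : 'rV[R]_1) p.2.

Lemma cons_rV0 n p : @cons_rV n p 0 0 = p.1.
Proof.
by rewrite mxE; case: splitP => // j _; rewrite mxE.
Qed.

Lemma cons_rVS n p i : @cons_rV n p 0 (lift ord0 i) = p.2 0 i.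
Proof.
rewrite mxE; case: splitP => j /=; last by move=> [/val_inj ->].
by rewrite /bump/=; case: j => -[].
Qed.

Lemma measurable_cons_rV n : measurable_fun setT (@cons_rV n).
Proof.
apply/measurable_fun_rVP => i; case: (unliftP ord0 i) => [j|] ->.
  under eq_fun do rewrite cons_rVS.
  exact: (measurableT_comp (measurable_coord_rV j) measurable_snd).
by under eq_fun do rewrite cons_rV0; exact: measurable_fst.
Qed.

End borel_rV_theory.

Section power_measure.
Context {R : realType} (m : {sigma_finite_measure set (measurableTypeR R) -> \bar R}).
Local Open Scope ereal_scope.

Section step.
Variables (n : nat) (mn : {sigma_finite_measure set 'rV[R]_n -> \bar R}).

Definition cons_measure : set 'rV[R]_n.+1 -> \bar R :=
  pushforward (m \x mn) (@cons_rV R n).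

Let mcons (A : set 'rV[R]_n.+1) : measurable A ->
  measurable (@cons_rV R n @^-1` A).
Proof.
by move=> mA; rewrite -[X in measurable X]setTI; exact: measurable_cons_rV.
Qed.

Let cons_measure0 : cons_measure set0 = 0.
Proof. by rewrite /cons_measure /pushforward preimage_set0 measure0. Qed.

Let cons_measure_ge0 A : 0 <= cons_measure A.
Proof. exact: (measure_ge0 (m \x mn)). Qed.

Let cons_measure_sigma_additive : semi_sigma_additive cons_measure.
Proof.
move=> F mF tF mUF; rewrite /cons_measure /pushforward preimage_bigcup.
apply: measure_semi_sigma_additive.
- by move=> i; exact: mcons.
- apply/trivIsetP => /= i j _ _ ij; rewrite -preimage_setI.
  by move/trivIsetP : tF => /(_ _ _ _ _ ij) ->//; rewrite preimage_set0.
- by rewrite -preimage_bigcup; exact: mcons.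
Qed.

HB.instance Definition _ := isMeasure.Build _ _ _ cons_measure
  cons_measure0 cons_measure_ge0 cons_measure_sigma_additive.

Let cons_measure_sigma_finite : sigma_finite setT cons_measure.
Proof.
have /sigma_finiteP[F [FT ndF mF]] := sigma_finiteT m.
have /sigma_finiteP[G [GT ndG mG]] := sigma_finiteT mn.
pose uncons (v : 'rV[R]_n.+1) := (v 0%R 0%R, \row_j v 0%R (lift ord0 j)).
have muncons : measurable_fun [set: 'rV[R]_n.+1] uncons.
  apply/measurable_fun_pair; first exact: measurable_coord_rV.
  apply/measurable_fun_rVP => i; under eq_fun do rewrite mxE.
  exact: measurable_coord_rV.
have consK : cancel (@cons_rV R n) uncons.
  move=> [x v]; rewrite /uncons cons_rV0; congr pair.
  by apply/rowP => j; rewrite mxE cons_rVS.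
exists (fun k => uncons @^-1` (F k `*` G k)).
  rewrite -preimage_bigcup; apply/seteqP; split=> // v _.
  have [i _ Fi] : (\bigcup_k F k) (uncons v).1 by rewrite -FT.
  have [j _ Gj] : (\bigcup_k G k) (uncons v).2 by rewrite -GT.
  exists (maxn i j) => //; split.
    by move: (_.1) Fi; exact/subsetPset/ndF/leq_maxl.
  by move: (_.2) Gj; exact/subsetPset/ndG/leq_maxr.
move=> k; have [mFk Fkoo] := mF k; have [mGk Gkoo] := mG k; split.
  by rewrite -[X in measurable X]setTI; apply: muncons => //; exact: measurableX.
rewrite /cons_measure /pushforward -comp_preimage.
rewrite (_ : uncons \o _ = id) ?preimage_id; last exact/funext.
by rewrite product_measure1E// lte_mul_pinfty// ge0_fin_numE.
Qed.

HB.instance Definition _ := @Measure_isSigmaFinite.Build _ _ _ cons_measure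
  cons_measure_sigma_finite.

End step.

(* The n-fold product of m with itself. *)
Fixpoint power_measure (n : nat) :
    {sigma_finite_measure set 'rV[R]_n -> \bar R} :=
  if n is k.+1 then cons_measure (power_measure k) else dirac (0%R : 'rV[R]_0).

Lemma power_measure_box n (A : 'I_n -> set (measurableTypeR R)) :
  (forall i, measurable (A i)) ->
  power_measure n [set x | forall i, A i (x 0%R i)] = \prod_(i < n) m (A i).
Proof.
elim: n A => [|n IHn] A mA /=.
  by rewrite big_ord0 diracE mem_set// => -[].
rewrite big_ord_recl -IHn// /cons_measure /pushforward.
rewrite -product_measure1E//; last first.
  rewrite [X in measurable X](_ : _ = \bigcap_(i in [set: 'I_n])
      ((fun x : 'rV[R]_n => x 0%R i) @^-1` A (lift ord0 i))).
    apply: fin_bigcap_measurable => // i _; rewrite -[X in measurable X]setTI.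
    exact: (measurable_coord_rV i measurableT (mA (lift ord0 i))).
  by apply/seteqP; split=> [t tq i _|t tq i]; [exact: tq|exact: (tq i)].
congr ((m \x power_measure n) _); apply/seteqP; split=> [[x v] /= xvA|].
  split=> [|i] /=; first by have := xvA ord0; rewrite cons_rV0.
  by have := xvA (lift ord0 i); rewrite cons_rVS.
move=> [x v] /= [Ax Av] i; case: (unliftP ord0 i) => [j|] ->.
  by rewrite cons_rVS; exact: Av.
by rewrite cons_rV0.
Qed.

End power_measure.

Definition lebesgue_rV {R : realType} (n : nat) :
    {sigma_finite_measure set 'rV[R]_n -> \bar R} :=
  power_measure (@lebesgue_measure R) n.

(* N(0, I_n), as the law of n independent N(0, 1) coordinates. *)
Definition std_normal {R : realType} (n : nat) :
    {sigma_finite_measure set 'rV[R]_n -> \bar R} :=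
  power_measure (@normal_prob R 0 1) n.

Section calculus.
Context {R : realType} {n : nat}.
Implicit Types (f : 'rV[R]_n -> R) (x : 'rV[R]_n).

Definition enorm x : R := Num.sqrt (\sum_i x 0 i ^+ 2).

Definition partial (i : 'I_n) f x : R := 'D_(delta_mx 0 i) f x.

Definition gradient f x : 'rV[R]_n := \row_i partial i f x.

Definition hessian f x : 'M[R]_n := \matrix_(i, j) partial i (partial j f) x.

Definition C1 f : Prop :=
  (forall x, differentiable f x) /\ (forall i, continuous (partial i f)).

Definition C2 f : Prop := C1 f /\ forall i, C1 (partial i f).

(* The set of real eigenvalues of M is finite, and it is nonempty when M is
   symmetric and n > 0, so that the infimum is then a minimum. *)
Definition lambda_min (M : 'M[R]_n) : R := inf [set a | eigenvalue M a].

End calculus.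

Section wasserstein.
Context {R : realType} {n : nat}.
Implicit Types rho : probability 'rV[R]_n R.
Local Open Scope ereal_scope.

Definition coupling rho1 rho2
    (xi : probability ('rV[R]_n * 'rV[R]_n)%type R) : Prop :=
  (forall A : set 'rV[R]_n, measurable A -> xi (A `*` setT) = rho1 A) /\
  (forall A : set 'rV[R]_n, measurable A -> xi (setT `*` A) = rho2 A).

(* The value is +oo when no coupling has a finite transport cost. *)
Definition W2 rho1 rho2 : \bar R :=
  poweR (ereal_inf [set \int[xi]_z ((enorm (z.1 - z.2)%R) ^+ 2)%:E
                   | xi in coupling rho1 rho2]) 2^-1.

(* Since rho has mass 1, c is necessarily 1 / \int h. *)
Definition density_proportional_to (h : 'rV[R]_n -> R) rho : Prop :=
  exists c : R, forall A : set 'rV[R]_n, measurable A ->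
    rho A = \int[lebesgue_rV n]_(x in A) (c * h x)%:E.

End wasserstein.

Section langevin.
Context {R : realType} {n : nat} {d : measure_display} {Omega : measurableType d}.
Context (P : probability Omega R).

Definition has_law (X : {RV P >-> 'rV[R]_n}) (rho : set 'rV[R]_n -> \bar R) :
    Prop :=
  forall A : set 'rV[R]_n, measurable A -> distribution P X A = rho A.

Definition independent (X Y : {RV P >-> 'rV[R]_n}) : Prop :=
  forall A B : set 'rV[R]_n, measurable A -> measurable B ->
    P (X @^-1` A `&` Y @^-1` B) = (P (X @^-1` A) * P (Y @^-1` B))%E.

Definition unadjusted_langevin (V : 'rV[R]_n -> R) (eps : R)
    (pi0 : probability 'rV[R]_n R) (X Z : nat -> {RV P >-> 'rV[R]_n}) : Prop :=
  [/\ has_law (X 0%N) pi0,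
      forall k w, X k.+1 w =
        X k w - eps *: gradient V (X k w) + Num.sqrt (2 * eps) *: Z k w,
      forall k, has_law (Z k) (std_normal n)
    & forall k, independent (Z k) (X k)].

End langevin.

Section potential.
Context {R : realType} {n : nat} (mu : R -> R) (g : 'rV[R]_n -> R).
Implicit Types (s : R) (x : 'rV[R]_n).

Definition F_ s x : R := (1 + expR ((- mu s + g x) / s))^-1.

Definition V_ s x : R := - ln (F_ s x) + 2^-1 * enorm x ^+ 2.

Definition H_ s : R :=
  inf [set (1 - F_ s x) * lambda_min (hessian g x) | x in [set: 'rV[R]_n]].

Definition alpha_ s : R := H_ s / s + 1.

Definition L_ (r K G s : R) : R :=
  expR ((- mu s + r) / s) / s ^+ 2 * K ^+ 2 + 2 * G / s + 1.

End potential.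

(* Main.v *)
(* A coupling of the law of [X k] with [pi_star] is propagated through one step of
   the algorithm. The first component makes the Langevin step driven by a Gaussian
   increment, while the second one runs [N] preconditioned Crank-Nicolson moves,
   that is, Metropolis-adjusted Ornstein-Uhlenbeck proposals
   [sqrt (1 - s^2) y + s z] with [N s^2 = 2 eps], driven by [N] Gaussian vectors
   whose sum is that same increment. These moves preserve [pi_star] exactly, by the
   rotation invariance of the Gaussian measure, and for [N] large they follow the
   Langevin diffusion, so that no stochastic calculus is needed. The gradient step
   is a [1 - alpha eps]-contraction by strong convexity, and the two components
   drift apart in L2 by at most [1.82 L eps sqrt (eps d)]: the chain moves by about
   [sqrt (2 j (eps / N) d)] in [j] moves and the gradient is [L]-Lipschitz, which
   gives the constant [2 sqrt 2 / 3] up to linearizing the square root and the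
   contribution of [gradient V], whose second moment under [pi_star] is at most
   [L d] by stationarity. The geometric series sums the errors to
   [1.82 (L / alpha) sqrt (eps d)]. *)
Require Import Defs.
From HB Require Import structures.
From mathcomp Require Import all_boot all_order all_algebra.
From mathcomp Require Import all_classical all_reals all_analysis.
From mathcomp Require Import measurable_realfun ring lra.

Set Implicit Arguments.
Unset Strict Implicit.
Unset Printing Implicit Defensive.

Import Order.TTheory GRing.Theory Num.Theory.
Import numFieldNormedType.Exports.

Local Open Scope classical_set_scope.
Local Open Scope ring_scope.

(** * Euclidean geometry *)

(** The proposals know only the Gaussian factor of the target; the drift [- gU] comes from the
    rejections alone. A move is rejected with probability close to [s <gU y, z>_+], and then the
    increment [s z] is lost. Since the Gaussian mean of [<u, z>_+ z] is [u / 2], the mean loss is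
    [s^2 gU y / 2 = h gU y], one Langevin drift over the time [h = s^2 / 2]. Because [gU] is bounded
    by [K / sigma], everything beyond this first order is at most [h s] times a fixed polynomial in
    the norms of [y] and [z], and over [N] moves these remainders add up to a multiple of [eps s].
    Hence no limit chain is formed: one finite [N] already pushes them below the slack between the
    main part of the estimate and 1.82. Bias and variance have to be followed separately: the mean
    of a one-move error adds up linearly, its variance only under a square root, and treating both
    alike would lose a factor [sqrt N]. This is why the one-move bounds have the shape
    [(|A| + b)^2 + v]. *)

Section euclidean.
Context {R : realType} {n : nat}.
Implicit Types (x y z : 'rV[R]_n) (a : R).

Definition dotv x y : R := \sum_i x 0 i * y 0 i.

Lemma dotvC x y : dotv x y = dotv y x.
Proof. by apply: eq_bigr => i _; rewrite mulrC. Qed.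

Lemma dotvDl x y z : dotv (x + y) z = dotv x z + dotv y z.
Proof. by rewrite -big_split; apply: eq_bigr => i _; rewrite mxE mulrDl. Qed.

Lemma dotvZl a x y : dotv (a *: x) y = a * dotv x y.
Proof. by rewrite mulr_sumr; apply: eq_bigr => i _; rewrite mxE mulrA. Qed.

Lemma dotvNl x y : dotv (- x) y = - dotv x y.
Proof. by rewrite -scaleN1r dotvZl mulN1r. Qed.

Lemma dotvBl x y z : dotv (x - y) z = dotv x z - dotv y z.
Proof. by rewrite dotvDl dotvNl. Qed.

Lemma dotvDr x y z : dotv x (y + z) = dotv x y + dotv x z.
Proof. by rewrite dotvC dotvDl !(dotvC x). Qed.

Lemma dotvZr a x y : dotv x (a *: y) = a * dotv x y.
Proof. by rewrite dotvC dotvZl dotvC. Qed.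

Lemma dotvNr x y : dotv x (- y) = - dotv x y.
Proof. by rewrite dotvC dotvNl dotvC. Qed.

Lemma dotvBr x y z : dotv x (y - z) = dotv x y - dotv x z.
Proof. by rewrite dotvDr dotvNr. Qed.

Lemma dot0v x : dotv 0 x = 0.
Proof. by rewrite -(scale0r 0) dotvZl mul0r. Qed.

Lemma dotv0 x : dotv x 0 = 0.
Proof. by rewrite dotvC dot0v. Qed.

Definition dotvE := (dotvDl, dotvDr, dotvNl, dotvNr, dotvZl, dotvZr).

Lemma dotvv_ge0 x : 0 <= dotv x x.
Proof. by apply: sumr_ge0 => i _; rewrite -expr2 sqr_ge0. Qed.

Lemma enorm_ge0 x : 0 <= enorm x. Proof. exact: sqrtr_ge0. Qed.

Lemma enorm_sqr x : enorm x ^+ 2 = dotv x x.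
Proof.
rewrite /enorm sqr_sqrtr; last by apply: sumr_ge0 => i _; rewrite sqr_ge0.
by apply: eq_bigr => i _; rewrite expr2.
Qed.

Lemma dotvv_eq0 x : dotv x x = 0 -> x = 0.
Proof.
move=> /eqP; rewrite psumr_eq0; last by move=> i _; rewrite -expr2 sqr_ge0.
move=> /allP x0; apply/rowP => i; rewrite mxE.
by have := x0 i (mem_index_enum _); rewrite -expr2 sqrf_eq0 => /eqP.
Qed.

Lemma dotv_delta x i : dotv x (delta_mx 0 i) = x 0 i.
Proof.
rewrite /dotv (bigD1 i)//= mxE !eqxx mulr1 big1 ?addr0// => j ji.
by rewrite mxE (negbTE ji) andbF mulr0.
Qed.

Lemma enorm0 : enorm (0 : 'rV[R]_n) = 0.
Proof. by apply/eqP; rewrite -sqrf_eq0 enorm_sqr dot0v. Qed.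

Lemma enormZ a x : enorm (a *: x) = `|a| * enorm x.
Proof.
apply/eqP; rewrite -(eqrXn2 (n := 2)) ?mulr_ge0 ?enorm_ge0//.
by rewrite enorm_sqr !dotvE exprMn enorm_sqr real_normK ?num_real// mulrA expr2.
Qed.

Lemma enormN x : enorm (- x) = enorm x.
Proof. by rewrite -scaleN1r enormZ normrN1 mul1r. Qed.

Lemma enormBC x y : enorm (x - y) = enorm (y - x).
Proof. by rewrite -enormN opprB. Qed.

Lemma dotv_sqr_le x y : dotv x y ^+ 2 <= dotv x x * dotv y y.
Proof.
have [y0|yn0] := eqVneq (dotv y y) 0.
  by rewrite (dotvv_eq0 y0) !dotv0 expr0n mulr0.
have y_gt0 : 0 < dotv y y by rewrite lt_neqAle eq_sym yn0 dotvv_ge0.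
(* With [p], [q], [r] for [<x, y>], [<x, x>], [<y, y>], the square of [r x - p y] is
   [r (q r - p^2)]. *)
have := dotvv_ge0 (dotv y y *: x - dotv x y *: y); rewrite !dotvE (dotvC y x).
set p := dotv x y; set q := dotv x x; set r := dotv y y in y_gt0 *.
rewrite (_ : _ + _ = r * (q * r - p ^+ 2)); last by ring.
by rewrite pmulr_rge0// subr_ge0.
Qed.

Lemma dotv_le x y : dotv x y <= enorm x * enorm y.
Proof.
apply: (le_trans (ler_norm _)); rewrite -[leLHS]sqrtr_sqr.
rewrite -[leRHS]ger0_norm ?mulr_ge0 ?enorm_ge0// -sqrtr_sqr.
by rewrite ler_wsqrtr// exprMn !enorm_sqr dotv_sqr_le.
Qed.

Lemma normr_dotv_le x y : `|dotv x y| <= enorm x * enorm y.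
Proof. by rewrite ler_norml lerNl -dotvNl -{1}(enormN x) !dotv_le. Qed.

Lemma enormD_sqr x y :
  enorm (x + y) ^+ 2 = enorm x ^+ 2 + 2 * dotv x y + enorm y ^+ 2.
Proof. by rewrite !enorm_sqr !dotvE (dotvC y x); ring. Qed.

Lemma enormB_sqr x y :
  enorm (x - y) ^+ 2 = enorm x ^+ 2 - 2 * dotv x y + enorm y ^+ 2.
Proof. by rewrite enormD_sqr dotvNr enormN; ring. Qed.

Lemma ler_enormD x y : enorm (x + y) <= enorm x + enorm y.
Proof.
rewrite -(@ler_pXn2r _ 2) ?nnegrE ?addr_ge0 ?enorm_ge0//.
by rewrite enormD_sqr sqrrD; have := dotv_le x y; lra.
Qed.

Lemma ler_enormB x y : enorm (x - y) <= enorm x + enorm y.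
Proof. by rewrite -(enormN y) ler_enormD. Qed.

Lemma enormD_sqr_le x y :
  enorm (x + y) ^+ 2 <= 2 * enorm x ^+ 2 + 2 * enorm y ^+ 2.
Proof.
have := sqr_ge0 (enorm (x - y)); rewrite enormD_sqr enormB_sqr; lra.
Qed.

(** Serves to prove vector identities: after [dotvE] they become identities between reals, which
    [ring] or [field] closes. *)
Lemma dotv_ext x y : (forall z, dotv x z = dotv y z) -> x = y.
Proof. by move=> xy; apply/rowP => i; rewrite -!dotv_delta. Qed.

End euclidean.

(** * Differential calculus along lines *)

Section pointwise_derivatives.
Context {R : realType}.
Implicit Types (f g : R -> R) (x a b c : R).

Lemma derive_addf f g x a b : is_derive x 1 f a -> is_derive x 1 g b ->
  is_derive x 1 (fun t => f t + g t) (a + b).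
Proof. exact: is_deriveD. Qed.

Lemma derive_subf f g x a b : is_derive x 1 f a -> is_derive x 1 g b ->
  is_derive x 1 (fun t => f t - g t) (a - b).
Proof. exact: is_deriveB. Qed.

Lemma derive_mulf f g x a b : is_derive x 1 f a -> is_derive x 1 g b ->
  is_derive x 1 (fun t => f t * g t) (f x * b + g x * a).
Proof. exact: is_deriveM. Qed.

Lemma derive_scalef c f x a : is_derive x 1 f a ->
  is_derive x 1 (fun t => c * f t) (c * a).
Proof. exact: is_deriveZ. Qed.

Lemma derive_sqrf f x a : is_derive x 1 f a ->
  is_derive x 1 (fun t => f t ^+ 2) (2 * f x * a).
Proof.
move=> fa; rewrite (_ : 2 * f x * a = f x * a + f x * a); last by ring.
exact: derive_mulf.
Qed.

Lemma derive_compf f g x a b : is_derive (g x) 1 f a -> is_derive x 1 g b ->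
  is_derive x 1 (fun t => f (g t)) (a * b).
Proof. exact: is_derive1_comp. Qed.

End pointwise_derivatives.

Section one_variable.
Context {R : realType}.
Implicit Types (f df : R -> R) (m a b : R).

Lemma MVT_derive f df a b : a < b -> (forall t : R, is_derive t 1 f (df t)) ->
  exists2 c, a < c < b & f b - f a = df c * (b - a).
Proof.
move=> ab fdf; have [|c cab ->] := @MVT _ f df a b ab (fun x _ => fdf x).
  apply: continuous_subspaceT => x.
  by apply: differentiable_continuous; exact/derivable1_diffP/ex_derive.
by exists c => //; move: cab; rewrite in_itv.
Qed.

(** The difference [h] between [f] and the candidate quadratic minorant has a nonnegative derivative
    on [(0, 1)], so the mean value theorem suffices, with no integral remainder. The second-order
    Taylor bounds below are instances along a segment. *)
Lemma quadratic_lower_bound f df m : (forall t : R, is_derive t 1 f (df t)) ->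
  (forall t, 0 <= t -> m * t <= df t - df 0) -> f 0 + df 0 + m / 2 <= f 1.
Proof.
move=> fdf dfm; pose h t := f t - df 0 * t - m / 2 * t ^+ 2.
pose dh t := df t - df 0 - m * t.
have hdh (t : R) : is_derive t 1 h (dh t).
  rewrite (_ : dh t = df t - df 0 * 1 - m / 2 * (2 * t * 1)).
    pose dt := is_derive_id t (1 : R).
    exact: derive_subf (derive_subf (fdf t) (derive_scalef _ dt))
      (derive_scalef _ (derive_sqrf dt)).
  by rewrite /dh; field.
have [c /andP[c0 _]] := MVT_derive ltr01 hdh.
have := dfm c (ltW c0); rewrite /h /dh => + hc; lra.
Qed.

Lemma quadratic_upper_bound f df m : (forall t : R, is_derive t 1 f (df t)) ->
  (forall t, 0 <= t -> df t - df 0 <= m * t) -> f 1 <= f 0 + df 0 + m / 2.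
Proof.
move=> fdf dfm.
have := @quadratic_lower_bound _ _ (- m) (fun t => is_deriveN (fdf t)).
rewrite /= !fctE mulNr => H.
suff: - f 0 - df 0 - m / 2 <= - f 1 by lra.
by apply: H => t /dfm; lra.
Qed.

End one_variable.

Section gradient_theory.
Context {R : realType} {n : nat}.
Implicit Types (f : 'rV[R]_n -> R) (x v : 'rV[R]_n).

Lemma derive_dotv f x v : differentiable f x ->
  'D_v f x = dotv (gradient f x) v.
Proof.
move=> df; rewrite deriveE// [in LHS](row_sum_delta v) linear_sum.
by apply: eq_bigr => i _; rewrite linearZ/= -deriveE// mxE mulrC.
Qed.

Lemma is_derive_line f x v (t : R) : (forall y, differentiable f y) ->
  is_derive t 1 (fun t => f (x + t *: v)) (dotv (gradient f (x + t *: v)) v).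
Proof.
move=> df; have dfv := @diff_derivable _ _ _ f _ v (df (x + t *: v)).
have E : (fun h : R => h^-1 *: (((fun t => f (x + t *: v)) \o shift t) (h *: 1)
    - f (x + t *: v))) =
  (fun h => h^-1 *: ((f \o shift (x + t *: v)) (h *: v) - f (x + t *: v))).
  apply/funext => h /=; congr (_ *: (f _ - _)).
  by rewrite addrCA scalerDl (_ : h *: (1 : R) = h)//; exact: mulr1.
split; first by rewrite /derivable E.
by rewrite /derive E -derive_dotv.
Qed.

Lemma dotv_gradient_delta f x i : dotv (gradient f x) (delta_mx 0 i) = partial i f x.
Proof. by rewrite dotv_delta mxE. Qed.

Lemma gradientP f x (u : 'rV[R]_n) :
  (forall v, 'D_v f x = dotv u v) -> gradient f x = u.
Proof. by move=> H; apply/rowP => i; rewrite mxE /partial H dotv_delta. Qed.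

Let second_difference f x i j s := f (x + s *: delta_mx 0 i + s *: delta_mx 0 j)
  - f (x + s *: delta_mx 0 i) - f (x + s *: delta_mx 0 j) + f x.

Let second_differenceC f x i j s :
  second_difference f x i j s = second_difference f x j i s.
Proof. by rewrite /second_difference (addrAC x (s *: delta_mx 0 i)); lra. Qed.

(** Mean value theorem twice: along [i] for the increment of [f] in direction [j], then along [j]
    for [partial i f]. *)
Let second_difference_partial f x i j s : C2 f -> 0 < s ->
  exists c c', [/\ 0 < c < s, 0 < c' < s & second_difference f x i j s =
    s ^+ 2 * partial j (partial i f) (x + c *: delta_mx 0 i + c' *: delta_mx 0 j)].
Proof.
move=> [[df _] ddf] s0; have [dif _] := ddf i.
set a : 'rV[R]_n := delta_mx 0 i; set b : 'rV[R]_n := delta_mx 0 j.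
have d1 (t : R) : is_derive t 1
    (fun t => f ((x + s *: b) + t *: a) - f (x + t *: a))
    (partial i f ((x + s *: b) + t *: a) - partial i f (x + t *: a)).
  by rewrite -!dotv_gradient_delta; apply: is_deriveB; exact: is_derive_line.
have [c c01] := MVT_derive s0 d1; rewrite !scale0r !addr0 subr0 => E1.
have d2 (t : R) : is_derive t 1 (fun t => partial i f ((x + c *: a) + t *: b))
    (partial j (partial i f) ((x + c *: a) + t *: b)).
  by rewrite -dotv_gradient_delta; exact: is_derive_line.
have [c' c01'] := MVT_derive s0 d2; rewrite !scale0r !addr0 subr0 => E2.
exists c, c'; split=> //.
rewrite /second_difference -/a -/b.
transitivity ((partial i f (x + c *: a + s *: b) - partial i f (x + c *: a)) * s).
  by rewrite -!(addrAC x (s *: b)) -E1; ring.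
by rewrite E2; ring.
Qed.

(** Schwarz's theorem. The second difference is symmetric in [i] and [j], so the two mixed partials
    take a common value at two points of the same small ball around [x]; were they to differ by [dl]
    at [x], continuity with precision [dl / 2] on each side would be contradicted. *)
Lemma partialC f x i j : C2 f ->
  partial j (partial i f) x = partial i (partial j f) x.
Proof.
move=> f2; apply: contrapT => /eqP; rewrite -subr_eq0 -normr_gt0.
set F := partial j (partial i f); set G := partial i (partial j f) => d0.
set dl := `|_| in d0.
have [_ /(_ i)[_ /(_ j x)/cvgrPdist_lt/(_ (dl / 2))]] := f2.
have [_ /(_ j)[_ /(_ i x)/cvgrPdist_lt/(_ (dl / 2))]] := f2.
rewrite divr_gt0// => /(_ isT)/nbhs_ballP[e1 /= e10 He1].
move=> /(_ isT)/nbhs_ballP[e2 /= e20 He2].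
pose e := Num.min e1 e2; have e0 : 0 < e by rewrite lt_min e10.
have s0 : 0 < e / 2 by rewrite divr_gt0.
have nb c c' k l : 0 < c < e / 2 -> 0 < c' < e / 2 ->
    ball x e (x + c *: delta_mx 0 k + c' *: delta_mx 0 l).
  move=> /andP[c0 ce] /andP[c0' ce']; split=> // p q; rewrite ord1 /ball/= !mxE.
  rewrite !eqxx/= -addrA opprD addrA subrr sub0r normrN.
  apply: (le_lt_trans (ler_normD _ _)); rewrite !normrM !normr_nat.
  rewrite !gtr0_norm// (splitr e) ltr_leD//.
    by case: (q == k); rewrite ?mulr1// mulr0.
  by case: (q == l); rewrite ?mulr1 ?mulr0// ltW.
have [c [c' [c0 c0' E1]]] := second_difference_partial x i j f2 s0.
have [b [b' [b0 b0' E2]]] := second_difference_partial x j i f2 s0.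
have := etrans (etrans (esym E1) (second_differenceC f x i j _)) E2.
move=> /(mulfI (lt0r_neq0 (exprn_gt0 2 s0))) E.
have ee1 : e <= e1 by rewrite ge_min lexx.
have ee2 : e <= e2 by rewrite ge_min lexx orbT.
have H1 := He2 _ (le_ball ee2 (nb _ _ i j c0 c0')).
have H2 := He1 _ (le_ball ee1 (nb _ _ j i b0 b0')).
rewrite -/F in H1 E; rewrite -/G in H2 E; rewrite E in H1.
move: H1 H2; set q := G (_ + _) => H1 H2.
have T := ler_distD q (F x) (G x).
have : dl < dl.
  apply: (le_lt_trans T); rewrite [ltRHS]splitr; apply: ltrD; first exact: H1.
  by rewrite distrC; exact: H2.
by rewrite ltxx.
Qed.

End gradient_theory.

(** * The smallest eigenvalue as a minimal Rayleigh quotient *)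

Section smallest_eigenvalue.
Context {R : realType} {n : nat}.
Implicit Types (M : 'M[R]_n) (v w : 'rV[R]_n).

Lemma continuous_sum_fct (T : topologicalType) m (F : 'I_m -> T -> R) :
  (forall i, continuous (F i)) -> continuous (fun x => \sum_i F i x).
Proof.
move=> cF x; apply: cvg_big => [|i _]; last exact: cF.
by move=> z; apply: cvgD; [exact: cvg_fst|exact: cvg_snd].
Qed.

Lemma continuous_quadratic_form M : continuous (fun v => dotv v (v *m M)).
Proof.
apply: continuous_sum_fct => i x; apply: continuousM; first exact: coord_continuous.
rewrite (_ : (fun v => _) = fun v : 'rV[R]_n => \sum_j v 0 j * M j i); last first.
  by apply/funext => v; rewrite mxE.
apply: continuous_sum_fct => j y; apply: continuousM; first exact: coord_continuous.
exact: cst_continuous.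
Qed.

Lemma compact_sphere : compact [set v : 'rV[R]_n | dotv v v = 1].
Proof.
apply: bounded_closed_compact.
  exists 1; split; rewrite ?num_real// => a a1 v /= v1.
  apply: le_trans (ltW a1); rewrite [`|v|]mx_normrE bigmax_le// => -[i j] _ /=.
  rewrite -(@ler_pXn2r _ 2)// ?nnegrE// real_normK ?num_real// expr1n -v1 ord1.
  rewrite /dotv (bigD1 j)//= -expr2 lerDl sumr_ge0// => k _.
  by rewrite -expr2 sqr_ge0.
rewrite (_ : mkset _ = (fun v => dotv v (v *m 1%:M)) @^-1` [set 1]).
  apply: closed_comp; last exact: closed_eq.
  by move=> x _; exact: continuous_quadratic_form.
by apply/seteqP; split=> v /=; rewrite mulmx1.
Qed.

Lemma dotv_mulmx M v w : M^T = M -> dotv v (w *m M) = dotv w (v *m M).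
Proof.
move=> Msym; have E x y : dotv x (y *m M) = (x *m (y *m M)^T) 0 0.
  by rewrite !mxE; apply: eq_bigr => i _; rewrite [in RHS]mxE.
rewrite !E (_ : w *m (v *m M)^T = (v *m M *m w^T)^T); last by rewrite [RHS]trmx_mul trmxK.
by rewrite [RHS]mxE trmx_mul Msym mulmxA.
Qed.

(** A minimizer [u] of the quadratic form on the compact unit sphere is an eigenvector: moving [u]
    along the residual [e = u M - m u] would otherwise lower the Rayleigh quotient. This produces an
    eigenvalue without the spectral theorem. *)
Lemma lambda_min_le M w : (0 < n)%N -> M^T = M ->
  lambda_min M * enorm w ^+ 2 <= dotv w (w *m M).
Proof.
move=> n0 Msym; rewrite enorm_sqr.
have S0 : [set v : 'rV[R]_n | dotv v v = 1] !=set0.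
  exists (delta_mx 0 (Ordinal n0)) => /=.
  by rewrite dotv_delta mxE !eqxx.
have [|u] := compact_EVT_min S0 compact_sphere (f := fun v => dotv v (v *m M)).
  exact/continuous_subspaceT/continuous_quadratic_form.
rewrite inE/= => u1 umin; set m := dotv u _ in umin.
have Qm v : m * dotv v v <= dotv v (v *m M).
  have [v0|v0] := eqVneq (dotv v v) 0.
    by rewrite (dotvv_eq0 v0) !dot0v mulr0.
  have v_gt0 : 0 < dotv v v by rewrite lt_neqAle eq_sym v0 dotvv_ge0.
  have := umin ((Num.sqrt (dotv v v))^-1 *: v).
  rewrite inE/= -scalemxAl !dotvE !mulrA -expr2 exprVn sqr_sqrtr ?dotvv_ge0//.
  rewrite mulVf// => /(_ erefl).
  by rewrite mulrC ler_pdivlMr.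
suff um : u *m M = m *: u.
  (* A real [inf] is known to lie below the members of a set only when that set is bounded below;
     the minimum [m] of the form is such a bound. *)
  have lb : lbound [set a | eigenvalue M a] m.
    move=> a /= /eigenvalueP[v va v0].
    have := Qm v; rewrite va dotvZr ler_pM2r// lt_neqAle dotvv_ge0 andbT eq_sym.
    by apply: contra v0 => /eqP/dotvv_eq0 ->.
  apply: le_trans (Qm w); rewrite ler_wpM2r ?dotvv_ge0// ge_inf//.
    by exists m.
  apply/eigenvalueP; exists u => //; apply/eqP => u0.
  by move/eqP: u1; rewrite u0 dot0v eq_sym oner_eq0.
apply/eqP; rewrite -subr_eq0; set e := _ - _.
have ee : dotv e e = dotv e (u *m M) - m * dotv e u.
  by rewrite {2}/e dotvBr dotvZr.
have mE : dotv u (u *m M) = m by [].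
clearbody e m.
have Q t : 0 <= 2 * t * dotv e e + t ^+ 2 * (dotv e (e *m M) - m * dotv e e).
  have := Qm (u + t *: e); rewrite mulmxDl -scalemxAl !dotvE (dotv_mulmx u e Msym).
  rewrite u1 mE (dotvC u e) => H.
  rewrite {1}ee; move: H; lra.
suff /eqP : dotv e e = 0 by move=> /eqP/dotvv_eq0 ->.
apply/eqP; rewrite eq_le dotvv_ge0 andbT leNgt; apply/negP => e0.
set c := dotv e (e *m M) - _ in Q.
have c0 : 0 <= c by rewrite subr_ge0 Qm.
(* With [x] the squared norm of [e], the quadratic [2 t x + t^2 c] is negative at
   [t = - x / (c + 1)]; the added 1 covers [c = 0]. *)
have := Q (- (dotv e e / (c + 1))).
have c1 : 0 < c + 1 by rewrite ltr_wpDl.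
set x := dotv e e in e0 *; rewrite sqrrN.
rewrite (_ : _ + _ = - ((x ^+ 2 / (c + 1) ^+ 2) * (c + 2))); last by field; rewrite gt_eqF.
rewrite oppr_ge0 leNgt => /negP; apply.
by rewrite mulr_gt0 ?divr_gt0 ?exprn_gt0// ltr_wpDl.
Qed.

End smallest_eigenvalue.

(** * Estimates on the potential *)

Section lines.
Context {R : realType} {n : nat}.
Implicit Types (f : 'rV[R]_n -> R) (x u v : 'rV[R]_n).

(** Gradients are read off from derivatives along lines, so that the calculus on the potential
    reduces to one variable. *)
Lemma gradient_line f x u :
  (forall v, is_derive (0 : R) 1 (fun t => f (x + t *: v)) (dotv u v)) ->
  gradient f x = u.
Proof.
move=> fu; apply: gradientP => v; rewrite -(@derive_val _ _ _ _ _ _ _ (fu v)).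
rewrite /derive; congr (lim (_ @[h --> 0^'])); apply/funext => h /=.
congr (_ *: (f _ - f _)); last by rewrite scale0r addr0.
by rewrite addr0 addrC (_ : h *: (1 : R) = h)//; exact: mulr1.
Qed.

Lemma derive_gradient_line f x v (t : R) : C2 f ->
  is_derive t 1 (fun t => dotv (gradient f (x + t *: v)) v)
    (dotv v (v *m hessian f (x + t *: v))).
Proof.
move=> [_ f2]; pose F i t := v 0 i * partial i f (x + t *: v).
have dF i : is_derive t 1 (F i)
    (v 0 i * dotv (gradient (partial i f) (x + t *: v)) v).
  by apply: derive_scalef; apply: is_derive_line; exact: (f2 i).1.
have := is_derive_sum dF; rewrite (_ : \sum_(i < n) F i =
    fun t => dotv (gradient f (x + t *: v)) v); last first.
  by apply/funext => s; rewrite fct_sumE; apply: eq_bigr => i _; rewrite mxE mulrC.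
congr is_derive; apply: eq_bigr => i _; congr (_ * _).
by rewrite mxE; apply: eq_bigr => j _; rewrite !mxE mulrC.
Qed.

Lemma derive_half_sqr_line x v (t : R) :
  is_derive t 1 (fun t => 2^-1 * enorm (x + t *: v) ^+ 2) (dotv (x + t *: v) v).
Proof.
rewrite (_ : (fun t => _) = fun t => 2^-1 * dotv x x
    + (dotv x v * t + 2^-1 * dotv v v * t ^+ 2)); last first.
  by apply/funext => a; rewrite enorm_sqr !dotvE (dotvC v x); field.
pose dt := is_derive_id t (1 : R).
rewrite (_ : dotv (x + t *: v) v = 0 + (dotv x v * 1 + 2^-1 * dotv v v * (2 * t * 1))).
  exact: derive_addf (is_derive_cst _ _ _)
    (derive_addf (derive_scalef _ dt) (derive_scalef _ (derive_sqrf dt))).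
by rewrite !dotvE; field.
Qed.

End lines.

Section potential_estimates.
Context {R : realType} {d : nat} (mu : R -> R) (g : 'rV[R]_d -> R) (r K G s : R).
Hypotheses (d_gt0 : (0 < d)%N) (g_C2 : C2 g) (g_bounded : forall x, `|g x| <= r)
  (K_gt0 : 0 < K) (G_gt0 : 0 < G)
  (hess_lb : (-oo < ereal_inf
    [set (lambda_min (hessian g x))%:E | x in [set: 'rV[R]_d]])%E)
  (g_lip : forall x y, `|g x - g y| <= K * enorm (x - y))
  (grad_lip : forall x y,
    enorm (gradient g x - gradient g y) <= G * enorm (x - y))
  (s_gt0 : 0 < s).
Implicit Types (x y v : 'rV[R]_d).

(** The gradient of [U = - ln F], the non-quadratic part of the potential: along lines the logistic
    profile satisfies [F' = - F (1 - F) g' / s], and the factor [F] cancels in the logarithmic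
    derivative. *)
Definition gradU x : 'rV[R]_d := ((1 - F_ mu g s x) / s) *: gradient g x.

Let F x := F_ mu g s x.
Let E x := expR ((- mu s + g x) / s).

Let E1_gt0 x : 0 < 1 + E x. Proof. by rewrite ltr_wpDl ?expR_gt0. Qed.

Let E1_neq0 x : 1 + E x != 0. Proof. exact/lt0r_neq0. Qed.

Let s_neq0 : s != 0. Proof. exact/lt0r_neq0. Qed.

Let F_gt0 x : 0 < F x. Proof. by rewrite invr_gt0. Qed.

Let F_le1 x : F x <= 1. Proof. by rewrite invf_le1// lerDl expR_ge0. Qed.

(** Source of the exponential in [L_]: [1 - F] is [E] times [F], and [E] is in turn controlled
    through [g <= r]. *)
Let subF_le x : 1 - F x <= E x.
Proof.
rewrite (_ : 1 - F x = E x * F x); last by rewrite /F /F_ -/(E x); field.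
by rewrite ler_piMr ?expR_ge0.
Qed.

Let E_le x : E x <= expR ((- mu s + r) / s).
Proof.
rewrite ler_expR ler_pM2r ?invr_gt0// lerD2l.
exact: le_trans (ler_norm _) (g_bounded x).
Qed.

Let dg y : differentiable g y. Proof. exact: g_C2.1.1. Qed.

Lemma derive_F_line x v (t : R) : is_derive t 1 (fun t => F_ mu g s (x + t *: v))
  (- (F (x + t *: v) * (1 - F (x + t *: v)) / s * dotv (gradient g (x + t *: v)) v)).
Proof.
set p := x + t *: v.
have dp : is_derive t 1 (fun t => s^-1 * (- mu s + g (x + t *: v)))
    (s^-1 * (0 + dotv (gradient g p) v)).
  exact: derive_scalef _ (derive_addf (is_derive_cst _ _ _) (is_derive_line x v t dg)).
have := derive_addf (is_derive_cst (1 : R) t 1) (derive_compf (is_derive_expR _) dp).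
rewrite (_ : (fun t => _ + _) = fun t => 1 + E (x + t *: v)); last first.
  by apply/funext => a; rewrite /E mulrC.
rewrite (mulrC s^-1 (_ + g _)) -/(E p) => dE.
have := @is_deriveV _ (fun t => 1 + E (x + t *: v)) _ _ _ (E1_neq0 p) dE.
congr is_derive.
rewrite /F /F_ -/(E p) /GRing.scale/=; field.
by rewrite s_neq0 E1_neq0.
Qed.

Lemma derive_U_line x v (t : R) : is_derive t 1 (fun t => - ln (F_ mu g s (x + t *: v)))
  (dotv (gradU (x + t *: v)) v).
Proof.
set p := x + t *: v.
have := @derive_compf _ (@ln R) (fun t => F_ mu g s (x + t *: v)) _ _ _
  (is_derive1_ln (F_gt0 p)) (derive_F_line x v t).
move/is_deriveN; congr is_derive.
by rewrite -/p /gradU dotvZl -/(F p); field; rewrite s_neq0 gt_eqF.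
Qed.

Lemma derive_gradU_line x v (t : R) :
  is_derive t 1 (fun t => dotv (gradU (x + t *: v)) v)
  (F (x + t *: v) * (1 - F (x + t *: v)) * (dotv (gradient g (x + t *: v)) v / s) ^+ 2
   + (1 - F (x + t *: v)) * dotv v (v *m hessian g (x + t *: v)) / s).
Proof.
set p := x + t *: v.
pose D t := (1 - F_ mu g s (x + t *: v)) * dotv (gradient g (x + t *: v)) v.
rewrite (_ : (fun t => _) = fun t => s^-1 * D t); last first.
  by apply/funext => a; rewrite /D /gradU dotvZl; ring.
have := derive_scalef s^-1 (derive_mulf (derive_subf (is_derive_cst (1 : R) t 1)
  (derive_F_line x v t)) (derive_gradient_line x v t g_C2)).
congr is_derive; rewrite /cst/= -/p -/(F p) sub0r; field.
exact: s_neq0.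
Qed.

Lemma derive_V_line x v (t : R) : is_derive t 1 (fun t => V_ mu g s (x + t *: v))
  (dotv (gradU (x + t *: v) + (x + t *: v)) v).
Proof. by rewrite dotvDl; exact: derive_addf (derive_U_line _ _ _) (derive_half_sqr_line _ _ _). Qed.

Lemma gradient_V x : gradient (V_ mu g s) x = gradU x + x.
Proof.
apply: gradient_line => v.
by have := derive_V_line x v 0; rewrite scale0r addr0.
Qed.

Let hessian_sym x : (hessian g x)^T = hessian g x.
Proof. by apply/matrixP => i j; rewrite !mxE partialC. Qed.

(** [hess_lb] enters here: it makes the set defining [H_] bounded below, without which its real
    infimum would say nothing about its members. *)
Let H_le x : H_ mu g s <= (1 - F x) * lambda_min (hessian g x).
Proof.
apply: ge_inf; last by exists x.
have [c cl] : exists c, forall y, c <= lambda_min (hessian g y).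
  have lb y : (ereal_inf [set (lambda_min (hessian g x))%:E | x in [set: 'rV[R]_d]]
      <= (lambda_min (hessian g y))%:E)%E by apply: ereal_inf_lbound; exists y.
  move: hess_lb lb; case: ereal_inf => // [c _ cl|_ /(_ 0)//].
  by exists c => y; rewrite -lee_fin.
(* A factor in [[0, 1]] can move a value towards 0 from either side, hence the minimum with 0. *)
exists (Num.min c 0) => _ [y _ <-].
have F1 : 0 <= 1 - F_ mu g s y by rewrite subr_ge0 F_le1.
have F0 : 1 - F_ mu g s y <= 1 by rewrite gerBl ltW// F_gt0.
have [l0|l0] := leP 0 (lambda_min (hessian g y)).
  by rewrite (le_trans (_ : _ <= 0)) ?ge_min ?lexx ?orbT// mulr_ge0.
rewrite (le_trans (_ : _ <= c)) ?ge_min ?lexx//; apply: (le_trans (cl y)).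
by rewrite -[leLHS]mul1r ler_wnM2r// ltW.
Qed.

(** Along a line the second derivative of the potential is [F (1 - F) (<grad g, v> / s)^2 + (1 - F)
    <v, Hess g v> / s + |v|^2]. The first term is dropped as nonnegative and [H_] bounds the second
    from below, which leaves [alpha_ |v|^2]. *)
Lemma V_strongly_convex x v :
  V_ mu g s x + dotv (gradU x + x) v + alpha_ mu g s / 2 * enorm v ^+ 2
  <= V_ mu g s (x + v).
Proof.
have := quadratic_lower_bound (m := alpha_ mu g s * enorm v ^+ 2) (derive_V_line x v).
rewrite scale0r addr0 scale1r mulrAC; apply=> t; rewrite le_eqVlt => /predU1P[<-|t0].
  by rewrite mulr0 scale0r addr0 subrr.
have dd (a : R) : is_derive a 1 (fun t => dotv (gradU (x + t *: v) + (x + t *: v)) v)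
  (F (x + a *: v) * (1 - F (x + a *: v)) * (dotv (gradient g (x + a *: v)) v / s) ^+ 2
   + (1 - F (x + a *: v)) * dotv v (v *m hessian g (x + a *: v)) / s + dotv v v).
  rewrite (_ : (fun t => _) = fun t => dotv (gradU (x + t *: v)) v
      + (dotv x v + dotv v v * t)); last first.
    by apply/funext => b; rewrite !dotvE; ring.
  have := derive_addf (derive_gradU_line x v a) (derive_addf (is_derive_cst (dotv x v) a 1)
    (derive_scalef (dotv v v) (is_derive_id a (1 : R)))).
  by rewrite add0r mulr1.
have [c _] := MVT_derive t0 dd; rewrite scale0r addr0 subr0 => ->.
rewrite ler_pM2r// /alpha_ mulrDl mul1r -enorm_sqr lerD2r.
set p := x + c *: v.
have := lambda_min_le v d_gt0 (hessian_sym p); set l := lambda_min _ => lv.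
have F1 : 0 <= 1 - F p by rewrite subr_ge0.
apply: (le_trans (_ : _ <= (1 - F p) * dotv v (v *m hessian g p) / s)); last first.
  by rewrite lerDr mulr_ge0 ?sqr_ge0// mulr_ge0// ltW.
rewrite mulrAC ler_pM2r ?invr_gt0//; apply: le_trans (ler_wpM2l F1 lv).
rewrite [leRHS]mulrA; apply: ler_wpM2r; [exact: sqr_ge0|exact: H_le].
Qed.

Let gradient_taylor x v : g x + dotv (gradient g x) v - G / 2 * enorm v ^+ 2 <= g (x + v).
Proof.
have := @quadratic_lower_bound _ _ _ (- (G * enorm v ^+ 2))
  (fun t => is_derive_line x v t dg).
rewrite scale0r addr0 scale1r mulNr mulrAC; apply=> t t0.
rewrite -dotvBl mulNr lerNl -dotvNl opprB; apply: le_trans (dotv_le _ _) _.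
apply: le_trans (ler_wpM2r (enorm_ge0 _) (grad_lip _ _)) _.
by rewrite opprD addNKr enormN enormZ ger0_norm// expr2; lra.
Qed.

(** Moving by [t w] along [w = gradient g x] raises [g] by at least [t |w|^2 - G t^2 |w|^2 / 2] and
    at most [K t |w|]; dividing by [t |w|] leaves [|w| <= K + G t |w| / 2], with [t] arbitrarily
    small. *)
Lemma enorm_gradient_le x : enorm (gradient g x) <= K.
Proof.
set w := gradient g x; have [->|w0] := eqVneq (enorm w) 0; first exact: ltW.
have w_gt0 : 0 < enorm w by rewrite lt_neqAle eq_sym w0 enorm_ge0.
apply/ler_addgt0Pr => e e0.
(* This [t] makes the second-order term equal to [e / 2]. *)
have [t t0 tE] : exists2 t, 0 < t & t * (G * enorm w) = e.
  have Gw : 0 < G * enorm w by exact: mulr_gt0.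
  by exists (e / (G * enorm w)); [exact: divr_gt0|rewrite divfK ?gt_eqF].
have := gradient_taylor x (t *: w); rewrite -/w dotvZr -enorm_sqr => T.
have := g_lip (x + t *: w) x; rewrite addrAC subrr add0r => /(le_trans (ler_norm _)).
move: T; rewrite enormZ gtr0_norm// => T1 T2.
have : t * enorm w * enorm w <= t * enorm w * (K + t * (G * enorm w) / 2).
  rewrite (_ : _ * (K + _) = K * (t * enorm w) + G / 2 * (t * enorm w) ^+ 2); last by ring.
  by rewrite -mulrA -expr2; move: T1 T2; lra.
rewrite ler_pM2l ?mulr_gt0// tE => /le_trans; apply.
by rewrite lerD2l ler_pdivrMr//; lra.
Qed.

Lemma enorm_gradU_le x : enorm (gradU x) <= K / s.
Proof.
have F1 : 0 <= 1 - F x by rewrite subr_ge0.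
rewrite enormZ ger0_norm; last by rewrite divr_ge0// ltW.
rewrite mulrAC -/(F x); apply: ler_wpM2r; first by rewrite invr_ge0 ltW.
rewrite -[leRHS]mul1r; apply: ler_pM => //; first exact: enorm_ge0.
  by rewrite gerBl ltW.
exact: enorm_gradient_le.
Qed.

(** Lipschitz constant of [gradU]: the first summand comes from the variation of the weight [1 - F],
    the second from that of [gradient g] under a weight at most 1. Hence [LU + 1], valid for the
    gradient of the potential, is smaller than [L_] by [G / s]. *)
Definition LU := expR ((- mu s + r) / s) / s ^+ 2 * K ^+ 2 + G / s.

Let F_lip x v : `|F (x + v) - F x| <= expR ((- mu s + r) / s) * K / s * enorm v.
Proof.
have [c _] := MVT_derive ltr01 (derive_F_line x v).
rewrite scale1r scale0r addr0 subr0 mulr1 => ->.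
rewrite normrN normrM; set p := x + c *: v.
have F1 : 0 <= 1 - F p by rewrite subr_ge0.
rewrite [X in X * _]ger0_norm; last by rewrite divr_ge0 ?mulr_ge0// ltW.
apply: (le_trans (ler_wpM2l _ (normr_dotv_le _ _))).
  by rewrite divr_ge0 ?mulr_ge0// ltW.
rewrite mulrA ler_wpM2r ?enorm_ge0// mulrAC ler_pM2r ?invr_gt0//.
rewrite ler_pM ?enorm_ge0 ?enorm_gradient_le ?mulr_ge0 ?(ltW (F_gt0 _))//.
rewrite -[leRHS]mul1r ler_pM// ?(ltW (F_gt0 _))//.
exact: le_trans (subF_le p) (E_le p).
Qed.

Lemma gradU_lip x y : enorm (gradU x - gradU y) <= LU * enorm (x - y).
Proof.
have F1 z : 0 <= 1 - F z by rewrite subr_ge0.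
rewrite (_ : gradU x - gradU y = ((F y - F x) / s) *: gradient g x
    + ((1 - F y) / s) *: (gradient g x - gradient g y)); last first.
  rewrite /gradU scalerBr addrA -scalerDl -mulrDl.
  by rewrite (_ : F y - F x + (1 - F y) = 1 - F x); last by ring.
apply: (le_trans (ler_enormD _ _)); rewrite /LU [leRHS]mulrDl; apply: lerD; rewrite enormZ.
  rewrite normrM (ger0_norm (_ : 0 <= s^-1)) ?invr_ge0 ?(ltW s_gt0)//.
  have Fxy := F_lip x (y - x); rewrite (addrC x) subrK enormBC in Fxy.
  apply: (le_trans (ler_pM _ _ (ler_wpM2r _ Fxy) (enorm_gradient_le x))).
  - by rewrite mulr_ge0// invr_ge0 ltW.
  - exact: enorm_ge0.
  - by rewrite invr_ge0 ltW.
  - rewrite le_eqVlt; apply/orP; left; apply/eqP; field; exact: s_neq0.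
rewrite ger0_norm; last by rewrite divr_ge0// ltW.
rewrite mulrAC (mulrAC G); apply: ler_wpM2r; first by rewrite invr_ge0 ltW.
rewrite -[leRHS]mul1r; apply: ler_pM => //; first exact: enorm_ge0.
by rewrite gerBl ltW.
Qed.

Let U x := - ln (F_ mu g s x).

Lemma U_ge0 x : 0 <= U x.
Proof. by rewrite oppr_ge0 ln_le0. Qed.

Lemma LU_ge0 : 0 <= LU.
Proof. by rewrite addr_ge0 ?mulr_ge0 ?invr_ge0 ?expR_ge0 ?exprn_ge0// ltW. Qed.

Lemma U_taylor x v : `|U (x + v) - U x - dotv (gradU x) v| <= LU / 2 * enorm v ^+ 2.
Proof.
have Hl (t : R) : 0 <= t -> `|dotv (gradU (x + t *: v)) v - dotv (gradU x) v|
    <= LU * enorm v ^+ 2 * t.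
  move=> t0; rewrite -dotvBl; apply: le_trans (normr_dotv_le _ _) _.
  apply: le_trans (ler_wpM2r (enorm_ge0 _) (gradU_lip _ _)) _.
  by rewrite addrAC subrr add0r enormZ ger0_norm// expr2; lra.
have := @quadratic_lower_bound _ _ _ (- (LU * enorm v ^+ 2)) (derive_U_line x v).
have := @quadratic_upper_bound _ _ _ (LU * enorm v ^+ 2) (derive_U_line x v).
rewrite !scale0r !addr0 !scale1r -/(U x) -/(U (x + v)) => up low.
rewrite ler_norml; apply/andP; split.
  suff: U x + dotv (gradU x) v + - (LU * enorm v ^+ 2) / 2 <= U (x + v) by lra.
  by apply: low => t /Hl; rewrite ler_norml => /andP[+ _]; lra.
suff: U (x + v) <= U x + dotv (gradU x) v + (LU * enorm v ^+ 2) / 2 by lra.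
by apply: up => t /Hl; rewrite ler_norml => /andP[_ +]; lra.
Qed.

Lemma U_lip x v : `|U (x + v) - U x| <= K / s * enorm v.
Proof.
have [c _] := MVT_derive ltr01 (derive_U_line x v).
rewrite scale1r scale0r addr0 subr0 mulr1 /U => ->.
apply: le_trans (normr_dotv_le _ _) _.
by rewrite ler_wpM2r ?enorm_ge0 ?enorm_gradU_le.
Qed.

Lemma V_descent x v : V_ mu g s (x + v) <= V_ mu g s x + dotv (gradU x + x) v
  + (LU + 1) / 2 * enorm v ^+ 2.
Proof.
have := U_taylor x v; rewrite ler_norml => /andP[_].
rewrite /V_ enormD_sqr /U dotvDl => H.
apply: (le_trans (_ : _ <= - ln (F_ mu g s x) + dotv (gradU x) v + LU / 2 * enorm v ^+ 2
  + 2^-1 * (enorm x ^+ 2 + 2 * dotv x v + enorm v ^+ 2))); lra.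
Qed.

End potential_estimates.

(** * Contraction of the gradient step *)

Section gradient_step.
Context {R : realType} {n : nat} (f : 'rV[R]_n -> R) (p : 'rV[R]_n -> 'rV[R]_n).
Variables (a L e : R).
Hypotheses
  (f_lower : forall x v, f x + dotv (p x) v + a / 2 * enorm v ^+ 2 <= f (x + v))
  (f_upper : forall x v, f (x + v) <= f x + dotv (p x) v + L / 2 * enorm v ^+ 2)
  (a_gt0 : 0 < a) (aL : a < L) (e_gt0 : 0 < e) (e_le : e <= 2 / (a + L)).
Implicit Types (x y v : 'rV[R]_n).

(* Cocoercivity of the gradient of the convex function [f - a / 2 |.|^2]. *)
Let q x := p x - a *: x.

Let phi x := f x - a / 2 * dotv x x.

Let phi_lower x v : phi x + dotv (q x) v <= phi (x + v).
Proof.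
by have := f_lower x v; rewrite /phi /q enorm_sqr !dotvE (dotvC v x); lra.
Qed.

Let phi_upper x v : phi (x + v) <= phi x + dotv (q x) v + (L - a) / 2 * dotv v v.
Proof.
by have := f_upper x v; rewrite /phi /q enorm_sqr !dotvE (dotvC v x); lra.
Qed.

(** The lower model drawn from [x] and the upper model drawn from [y] are compared at
    [y - m (q y - q x)], the point that minimizes the upper model minus the linear form [<q x, .>].
    Adding the inequality with [x] and [y] exchanged gives cocoercivity. *)
Let half_cocoercive x y m : (L - a) * m = 1 ->
  phi x + dotv (q x) (y - x) + m / 2 * dotv (q y - q x) (q y - q x) <= phi y.
Proof.
move=> mM; have := phi_lower x (y - x - m *: (q y - q x)).
have := phi_upper y (- (m *: (q y - q x))).
rewrite (_ : x + _ = y - m *: (q y - q x)); last by rewrite addrA addrCA subrr addr0.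
move: (phi (y - _)) (phi x) (phi y) => b b1 b2; move: (q x) (q y) => u v.
rewrite !dotvE !(dotvC v u).
set qxx := dotv u u; set qyy := dotv v v; set qxy := dotv u v.
rewrite (_ : (L - a) / 2 * _ = m / 2 * (qyy - 2 * qxy + qxx)); last first.
  transitivity ((L - a) * m * (m / 2 * (qyy - 2 * qxy + qxx))); first by field.
  by rewrite mM mul1r.
lra.
Qed.

(** Splitting [p = a id + q] turns the difference of the two steps into [(1 - a e) D - e w] with
    [D = x - y] and [w = q x - q y]. Expanding the square and using [|w|^2 <= (L - a) <w, D>] leaves
    [- e (2 - e (a + L)) <w, D>] besides [(1 - a e)^2 |D|^2]; this is where the threshold
    [2 / (a + L)] comes from. *)
Lemma gradient_step_contraction x y :
  enorm (x - e *: p x - (y - e *: p y)) <= (1 - a * e) * enorm (x - y).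
Proof.
have M0 : 0 < L - a by rewrite subr_gt0.
have mM : (L - a) * (L - a)^-1 = 1 by rewrite mulfV ?gt_eqF.
have m0 : 0 < (L - a)^-1 by rewrite invr_gt0.
have := half_cocoercive x y mM; have := half_cocoercive y x mM.
set m := (L - a)^-1 in mM m0 *.
have eaL : e * (a + L) <= 2.
  by move: e_le; rewrite ler_pdivlMr// addr_gt0// (lt_trans a_gt0).
have ae : 0 < 1 - a * e.
  rewrite subr_gt0; have : e * (2 * a) < 2.
    by apply: lt_le_trans eaL; rewrite ltr_pM2l//; lra.
  lra.
set w := q x - q y.
rewrite (_ : q y - q x = - w); last by rewrite /w [RHS]opprB.
rewrite (_ : y - x = - (x - y)); last by rewrite opprB.
rewrite dotvNl !dotvNr opprK => H1 H2.
have wl z : dotv w z = dotv (q x) z - dotv (q y) z by rewrite dotvBl.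
have Hw : m * dotv w w <= dotv w (x - y) by rewrite [leRHS]wl; lra.
have Hw' : dotv w w <= (L - a) * dotv w (x - y).
  by rewrite -[leLHS]mul1r -mM -mulrA ler_wpM2l// ltW.
rewrite (_ : _ - (y - _) = (1 - a * e) *: (x - y) - e *: w); last first.
  apply: dotv_ext => z; rewrite /w /q !dotvE; ring.
have ae0 := ltW ae; rewrite -(@ler_pXn2r _ 2) ?nnegrE ?mulr_ge0 ?enorm_ge0//.
rewrite exprMn !enorm_sqr.
have wD : 0 <= dotv w (x - y).
  by apply: le_trans Hw; rewrite mulr_ge0 ?dotvv_ge0// ltW.
move: (x - y) w Hw' wD {wl Hw H1 H2} => D w Hw wD.
rewrite !dotvE (dotvC D w).
have : e ^+ 2 * dotv w w <= e ^+ 2 * ((L - a) * dotv w D) by rewrite ler_wpM2l ?sqr_ge0.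
have : 0 <= e * (2 - e * (a + L)) * dotv w D.
  by rewrite !mulr_ge0// ?subr_ge0// ltW.
lra.
Qed.

End gradient_step.

(** * Measurability of the vector operations and of the potential *)

Section measurability.
Context {R : realType} {n : nat}.

Lemma continuous_measurable_rV (f : 'rV[R]_n -> R) :
  continuous f -> measurable_fun setT f.
Proof.
move=> cf; apply: (measurability _ (RGenOpens.measurableE R)).
move=> _ [_ [a [b ->]] <-]; rewrite setTI; apply: open_measurable_rV.
by apply: open_comp => [x _|]; [exact: cf|exact: interval_open].
Qed.

Context {d} {T : measurableType d}.
Implicit Types (f h : T -> 'rV[R]_n) (a : T -> R).

Lemma measurable_addrV f h : measurable_fun setT f -> measurable_fun setT h ->
  measurable_fun setT (fun x => f x + h x).
Proof.
move=> /measurable_fun_rVP mf /measurable_fun_rVP mh; apply/measurable_fun_rVP => i.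
by under eq_fun do rewrite mxE; exact: measurable_funD.
Qed.

Lemma measurable_scalerV a f : measurable_fun setT a -> measurable_fun setT f ->
  measurable_fun setT (fun x => a x *: f x).
Proof.
move=> ma /measurable_fun_rVP mf; apply/measurable_fun_rVP => i.
by under eq_fun do rewrite mxE; exact: measurable_funM.
Qed.

Lemma measurable_opprV f : measurable_fun setT f -> measurable_fun setT (fun x => - f x).
Proof.
move=> /measurable_fun_rVP mf; apply/measurable_fun_rVP => i.
by under eq_fun do rewrite mxE; exact: measurableT_comp.
Qed.

Lemma measurable_dotv f h : measurable_fun setT f -> measurable_fun setT h ->
  measurable_fun setT (fun x => dotv (f x) (h x)).
Proof.
move=> /measurable_fun_rVP mf /measurable_fun_rVP mh.
by apply: measurable_sum => i; exact: measurable_funM.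
Qed.

Lemma measurable_enorm f : measurable_fun setT f ->
  measurable_fun setT (fun x => enorm (f x)).
Proof.
move=> mf; apply: (measurableT_comp (continuous_measurable_fun (@sqrt_continuous R))).
under eq_fun do under eq_bigr do rewrite expr2.
exact: measurable_dotv.
Qed.

End measurability.

Section potential_measurability.
Context {R : realType} {d : nat} (mu : R -> R) (g : 'rV[R]_d -> R) (s : R).
Hypothesis g_C2 : C2 g.

Let mg : measurable_fun setT g.
Proof.
apply: continuous_measurable_rV => x.
by apply: differentiable_continuous; exact: g_C2.1.1.
Qed.

Lemma measurable_F : measurable_fun setT (F_ mu g s).
Proof.
(* The inverse is written as an exponential of a logarithm, both of which compose measurably; the
   denominator is positive. *)
rewrite (_ : F_ mu g s = fun x => expR (- ln (1 + expR ((- mu s + g x) / s)))).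
2: by apply/funext => x; rewrite expRN lnK// posrE ltr_wpDl ?expR_gt0.
apply: (measurableT_comp (@measurable_expR R)); apply: measurableT_comp => //.
apply: (measurableT_comp (@measurable_ln R)); apply: measurable_funD => //.
apply: (measurableT_comp (@measurable_expR R)); apply: measurable_funM => //.
exact: measurable_funD.
Qed.

Lemma measurable_U : measurable_fun setT (fun x => - ln (F_ mu g s x)).
Proof.
apply: measurableT_comp => //; apply: (measurableT_comp (@measurable_ln R)).
exact: measurable_F.
Qed.

Lemma measurable_gradU : measurable_fun setT (gradU mu g s).
Proof.
apply: measurable_scalerV.
  by apply: measurable_funM => //; apply: measurable_funB => //; exact: measurable_F.
apply/measurable_fun_rVP => i; under eq_fun do rewrite mxE.
by apply: continuous_measurable_rV => x; exact: g_C2.1.2.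
Qed.

End potential_measurability.

(** * Gaussian measures *)

Section integral_scaling.
Context {d} {T : measurableType d} {R : realType} (mu : {measure set T -> \bar R}).
Local Open Scope ereal_scope.

Lemma ge0_integralZT (k : R) (f : T -> \bar R) : (0 <= k)%R ->
  measurable_fun setT f -> (forall x, 0 <= f x) ->
  \int[mu]_x (k%:E * f x) = k%:E * \int[mu]_x f x.
Proof. by move=> k0 mf f0; rewrite ge0_integralZl. Qed.

Lemma ge0_integralDT (f h : T -> \bar R) : measurable_fun setT f ->
  (forall x, 0 <= f x) -> measurable_fun setT h -> (forall x, 0 <= h x) ->
  \int[mu]_x (f x + h x) = \int[mu]_x f x + \int[mu]_x h x.
Proof. by move=> mf f0 mh h0; rewrite ge0_integralD. Qed.

Lemma ge0_le_integralT (f h : T -> \bar R) : measurable_fun setT f ->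
  (forall x, 0 <= f x) -> measurable_fun setT h -> (forall x, f x <= h x) ->
  \int[mu]_x f x <= \int[mu]_x h x.
Proof.
by move=> mf f0 mh fh; exact: ge0_le_integral.
Qed.

Implicit Types (a b : T -> R).

Lemma ge0_integralDR a b : measurable_fun setT a -> (forall x, 0 <= a x)%R ->
  measurable_fun setT b -> (forall x, 0 <= b x)%R ->
  \int[mu]_x (a x + b x)%:E = \int[mu]_x (a x)%:E + \int[mu]_x (b x)%:E.
Proof.
move=> ma a0 mb b0; apply: (ge0_integralDT (f := EFin \o a) (h := EFin \o b)).
- exact/measurable_EFinP.
- by move=> x; rewrite lee_fin.
- exact/measurable_EFinP.
- by move=> x; rewrite lee_fin.
Qed.

Lemma ge0_integralZR (k : R) a : (0 <= k)%R -> measurable_fun setT a ->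
  (forall x, 0 <= a x)%R ->
  \int[mu]_x (k * a x)%:E = k%:E * \int[mu]_x (a x)%:E.
Proof.
move=> k0 ma a0; apply: (ge0_integralZT (f := EFin \o a)) => //.
exact/measurable_EFinP.
Qed.

Lemma ge0_le_integralR a b : measurable_fun setT a -> (forall x, 0 <= a x)%R ->
  measurable_fun setT b -> (forall x, a x <= b x)%R ->
  \int[mu]_x (a x)%:E <= \int[mu]_x (b x)%:E.
Proof.
move=> ma a0 mb ab; apply: ge0_le_integralT.
- exact/measurable_EFinP.
- by move=> x; rewrite lee_fin.
- exact/measurable_EFinP.
- by move=> x; rewrite lee_fin.
Qed.

End integral_scaling.

Section density.
Context {d} {T : measurableType d} {R : realType}.
Local Open Scope ereal_scope.
Import HBNNSimple.

(** On a level set of a simple function the identity is the hypothesis on [nu]; scalars and finite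
    sums follow, and monotone convergence passes to [f] on both sides. *)
Lemma ge0_integral_density (mu nu : {measure set T -> \bar R}) (h : T -> R)
    (f : T -> \bar R) :
  measurable_fun setT h -> (forall x, (0 <= h x)%R) ->
  (forall A, measurable A -> nu A = \int[mu]_(x in A) (h x)%:E) ->
  measurable_fun setT f -> (forall x, 0 <= f x) ->
  \int[nu]_x f x = \int[mu]_x (f x * (h x)%:E).
Proof.
move=> mh h0 nuE mf f0; pose g := nnsfun_approx measurableT mf.
have mEh : measurable_fun setT (EFin \o h) by exact/measurable_EFinP.
have gf x : f x = limn (EFin \o g ^~ x).
  by apply/esym/cvg_lim => //; exact: cvg_nnsfun_approx.
have mg n : measurable_fun setT (EFin \o g n) by exact/measurable_EFinP.
have ndg x : {homo (fun n => (EFin \o g n) x) : a b / (a <= b)%N >-> a <= b}.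
  by move=> a b ab; rewrite lee_fin; exact/lefP/nd_nnsfun_approx.
have mi r n : measurable_fun setT (fun x => (\1_(g n @^-1` [set r]) x)%:E : \bar R).
  by apply/measurable_EFinP; exact: measurable_indic.
have mri r n : measurable_fun setT (fun x => (r * \1_(g n @^-1` [set r]) x)%:E : \bar R).
  exact/measurable_EFinP/measurable_funM.
have ge0 n r x : 0 <= (r * \1_(g n @^-1` [set r]) x)%:E.
  exact: nnfun_muleindic_ge0.
have simple n : \int[nu]_x (EFin \o g n) x = \int[mu]_x ((EFin \o g n) x * (h x)%:E).
  under [LHS]eq_integral do rewrite /= fimfunE -fsumEFin//.
  under [RHS]eq_integral => x _.
    rewrite /= fimfunE -fsumEFin// (ge0_mule_fsuml _ _ (fun r => ge0 n r x)).
    over.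
  rewrite !ge0_integral_fsum//.
  - apply: eq_fsbigr => r; rewrite inE => -[y _ <-].
    under [LHS]eq_integral do rewrite EFinM.
    rewrite ge0_integralZl//; [|exact: mi|by rewrite lee_fin].
    under [RHS]eq_integral do rewrite EFinM -muleA.
    rewrite ge0_integralZl//; last 3 first.
    + by apply: emeasurable_funM => //; exact: mi.
    + by move=> x _; rewrite mule_ge0 ?lee_fin.
    + by rewrite lee_fin.
    rewrite integral_indic// setIT nuE// integral_mkcond; congr (_ * _).
    by apply: eq_integral => x _; rewrite muleC epatch_indic.
  - by move=> r; apply: emeasurable_funM => //; exact: mri.
  - by move=> r x _; rewrite mule_ge0 ?lee_fin//; exact: ge0.
  - by move=> r; exact: mri.
  - by move=> r x _; exact: ge0.
transitivity (limn (fun n => \int[nu]_x (EFin \o g n) x)).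
  rewrite -monotone_convergence//; first by apply: eq_integral => x _; rewrite gf.
  - by move=> n x _; rewrite lee_fin.
rewrite (funext simple : (fun n => _) = _) -monotone_convergence//.
- apply: eq_integral => x _; apply/cvg_lim => //; apply: cvgeZr => //.
  exact: cvg_nnsfun_approx.
- by move=> n; exact: emeasurable_funM.
- by move=> n x _; rewrite mule_ge0// lee_fin.
- by move=> x _ a b ab; rewrite lee_wpmul2r ?lee_fin// -lee_fin ndg.
Qed.

End density.

Section image_measure.
Context {d d'} {T : measurableType d} {T' : measurableType d'} {R : realType}.
Local Open Scope ereal_scope.

Definition image_measure (m : {measure set T -> \bar R}) (f : T -> T')
    (mf : measurable_fun setT f) : {measure set T' -> \bar R} :=
  measure_function_pushforward__canonical__measure_function_Measure m mf.

Lemma ge0_integral_image_measure m f (mf : measurable_fun setT f) (h : T' -> \bar R) :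
  measurable_fun setT h -> (forall x, 0 <= h x) ->
  \int[image_measure m mf]_x h x = \int[m]_x h (f x).
Proof. by move=> mh h0; rewrite ge0_integral_pushforward// preimage_setT. Qed.

End image_measure.

Section affine_substitution.
Context {R : realType}.
Local Open Scope ereal_scope.
Notation leb := (@lebesgue_measure R).

Let affine (a b : R) (x : measurableTypeR R) : measurableTypeR R := (a * x + b)%R.

Let measurable_affine a b : measurable_fun setT (affine a b).
Proof. by apply: measurable_funD => //; exact: measurable_funM. Qed.

Let lebesgue_measure_affine (a b : R) (A : set (measurableTypeR R)) (a0 : (0 < a)%R) :
  measurable A ->
  leb A = mscale (NngNum (ltW a0)) (image_measure leb (measurable_affine a b)) A.
Proof.
move=> mA; apply: lebesgue_measure_unique => //= _ [[u v]] _ <-.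
rewrite /mscale/= /pushforward.
rewrite (_ : affine a b @^-1` _ = `](u - b) / a, (v - b) / a]%classic)%R; last first.
  apply/seteqP; split=> x /=; rewrite !in_itv/= /affine.
    by rewrite ltr_pdivrMr// ler_pdivlMr// ltrBlDr lerBrDr mulrC.
  by rewrite ltr_pdivrMr// ler_pdivlMr// ltrBlDr lerBrDr mulrC.
rewrite !lebesgue_measure_itv/= !lte_fin ltr_pM2r ?invr_gt0// ltrD2r.
case: ifPn => _; last by rewrite mule0.
by rewrite -!EFinD -EFinM; congr EFin; field; rewrite gt_eqF.
Qed.

Let ge0_integral_affine_pos (f : R -> \bar R) (a b : R) : (0 < a)%R ->
  measurable_fun setT f -> (forall x, 0 <= f x) ->
  a%:E * \int[leb]_x f (a * x + b)%R = \int[leb]_x f x.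
Proof.
move=> a0 mf f0.
rewrite [RHS](eq_measure_integral
  (mscale (NngNum (ltW a0)) (image_measure leb (measurable_affine a b)))); last first.
  by move=> A mA _; exact: lebesgue_measure_affine.
rewrite ge0_integral_mscale//=; congr (_ * _); apply/esym.
exact: (ge0_integral_image_measure leb (measurable_affine a b)).
Qed.

(** Positive slopes follow from the uniqueness of Lebesgue measure on half-open intervals, negative
    ones by composing with the reflection [x |-> - x]. *)
Lemma ge0_integral_affine (f : R -> \bar R) (a b : R) : a != 0%R ->
  measurable_fun setT f -> (forall x, 0 <= f x) ->
  `|a|%:E * \int[leb]_x f (a * x + b)%R = \int[leb]_x f x.
Proof.
move=> an0 mf f0; have [a0|a0|/eqP] := ltgtP a 0%R; last by rewrite (negbTE an0).
- have mN h : measurable_fun [set: R] h -> measurable_fun [set: R] (fun x : R => h (- x)%R : \bar R).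
    by move=> mh; exact: measurableT_comp.
  have intN h : measurable_fun setT h -> (forall x, 0 <= h x) ->
      \int[leb]_x h (- x)%R = \int[leb]_x h x.
    move=> mh h0; have mopp : measurable_fun setT (-%R : measurableTypeR R -> measurableTypeR R) by [].
    rewrite -(ge0_integral_image_measure _ mopp)//.
    by apply: eq_measure_integral => A mA _; exact: lebesgue_measureN.
  rewrite -(intN f)// -(ge0_integral_affine_pos (- b)%R (_ : 0 < - a)%R (mN f mf))//.
    rewrite ltr0_norm//; congr (_ * _); apply: eq_integral => x _.
    by rewrite opprD opprK mulNr opprK.
  by rewrite oppr_gt0.
- by rewrite gtr0_norm//; exact: ge0_integral_affine_pos.
Qed.

End affine_substitution.

(** * Rotation invariance of the Gaussian measure *)

Section normal_law.
Context {R : realType}.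
Local Open Scope ereal_scope.
Notation leb := (@lebesgue_measure R).
Notation N := (@normal_prob R 0%R 1%R).
Notation RR := (measurableTypeR R).

Definition gauss_density (x : R) : R := (normal_peak 1 * expR (- x ^+ 2 / 2))%R.

Lemma gauss_density_ge0 x : (0 <= gauss_density x)%R.
Proof. by rewrite mulr_ge0 ?normal_peak_ge0 ?expR_ge0. Qed.

Lemma measurable_gauss_density : measurable_fun setT gauss_density.
Proof.
apply: measurable_funM => //; apply: measurableT_comp => //.
by apply: measurable_funM => //; apply: measurableT_comp => //; exact: measurable_funX.
Qed.

Lemma normal_pdf01E (x : R) : normal_pdf 0%R 1%R x = gauss_density x.
Proof.
rewrite normal_pdfE ?oner_neq0//; congr (_ * expR _)%R.
by rewrite subr0 expr1n.
Qed.

Lemma ge0_integral_normal (f : RR -> \bar R) :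
  measurable_fun setT f -> (forall x, 0 <= f x) ->
  \int[N]_x f x = \int[leb]_x (f x * (gauss_density x)%:E).
Proof.
move=> mf f0; apply: ge0_integral_density => //.
- exact: measurable_gauss_density.
- exact: gauss_density_ge0.
- by move=> A mA; apply: eq_integral => x _; rewrite normal_pdf01E.
Qed.

Lemma gauss_density_rotation (c s p q : R) : (c ^+ 2 + s ^+ 2 = 1)%R ->
  (gauss_density (s * p - c * q) * gauss_density (s * q + c * p)
   = gauss_density p * gauss_density q)%R.
Proof.
move=> cs; rewrite /gauss_density mulrACA [RHS]mulrACA -!expRD; congr (_ * expR _)%R.
rewrite -!mulrDl -!opprD; congr (- _ * _)%R.
by rewrite -[RHS]mulr1 -cs; ring.
Qed.

(** The map [(x, z) |-> (c x + s z, s x - c z)] is an orthogonal reflection. Only one-dimensional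
    substitutions are used: [p = c x + s z] replaces [z], the integrals are exchanged, and
    [q = (x - c p) / s] replaces [x]. The Jacobians [1 / |s|] and [|s|] cancel, and the product of
    the densities depends only on [x^2 + z^2 = p^2 + q^2]. *)
Lemma normal_rotation (c s : R) (f : RR * RR -> \bar R) :
  (c ^+ 2 + s ^+ 2 = 1)%R -> s != 0%R ->
  measurable_fun setT f -> (forall x, 0 <= f x) ->
  \int[N]_x \int[N]_z f (c * x + s * z, s * x - c * z)%R = \int[N]_x \int[N]_z f (x, z).
Proof.
move=> cs s0 mf f0.
have mphi := measurable_gauss_density.
have phi0 := gauss_density_ge0.
(* Integrand in the variables [w = (x, p)], where [z = (p - c x) / s] and [q = (x - c p) / s]. *)
pose H (w : RR * RR) := f (w.2, (w.1 - c * w.2) / s)%R *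
  (gauss_density ((w.2 - c * w.1) / s) * gauss_density w.1)%:E.
have mH : measurable_fun setT H.
  apply: emeasurable_funM.
    apply: measurableT_comp => //; apply/measurable_fun_pair => //.
    apply: measurable_funM => //; apply: measurable_funB => //.
    exact: measurable_funM.
  apply/measurable_EFinP; apply: measurable_funM; apply: measurableT_comp => //.
  apply: measurable_funM => //; apply: measurable_funB => //.
  exact: measurable_funM.
have H0 w : 0 <= H w by apply: mule_ge0 => //; rewrite lee_fin; apply: mulr_ge0; exact: phi0.
have mG : measurable_fun setT (fun w : RR * RR => f (c * w.1 + s * w.2, s * w.1 - c * w.2)%R).
  apply: measurableT_comp => //; apply/measurable_fun_pair.
    by apply: measurable_funD; exact: measurable_funM.
  by apply: measurable_funB; exact: measurable_funM.
have ns0 : (0 < `|s|)%R by rewrite normr_gt0.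
have E1 x : `|s|%:E * \int[leb]_z (f (c * x + s * z, s * x - c * z)%R *
    (gauss_density z * gauss_density x)%:E) = \int[leb]_p H (x, p).
  have mHx : measurable_fun setT (fun p => H (x, p)) by exact: measurableT_comp.
  rewrite -[RHS](ge0_integral_affine (c * x)%R s0 mHx (fun p => H0 _)); congr (_ * _).
  apply: eq_integral => z _; rewrite /H/=; congr (f (_, _) * (gauss_density _ * _)%:E).
  - by rewrite addrC.
  - apply: (mulIf s0); rewrite divfK//; transitivity ((c ^+ 2 + s ^+ 2) * x - c ^+ 2 * x - c * s * z)%R.
      by ring.
    by rewrite cs; ring.
  - by rewrite addrK mulrC mulKf.
have E2 p : \int[leb]_x H (x, p) = `|s|%:E * \int[leb]_q (f (p, q) *
    (gauss_density p * gauss_density q)%:E).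
  pose J q := f (p, q) * (gauss_density (s * p - c * q) * gauss_density (s * q + c * p))%:E.
  have mJ : measurable_fun [set: RR] J.
    apply: emeasurable_funM; first exact: measurableT_comp.
    apply/measurable_EFinP; apply: measurable_funM; apply: measurableT_comp => //.
      by apply: measurable_funB => //; exact: measurable_funM.
    by apply: measurable_funD => //; exact: measurable_funM.
  have J0 q : 0 <= J q by apply: mule_ge0 => //; rewrite lee_fin; apply: mulr_ge0; exact: phi0.
  transitivity (`|s|%:E * \int[leb]_q J q); last first.
    by congr (_ * _); apply: eq_integral => q _; rewrite /J gauss_density_rotation.
  have si0 : (s^-1 != 0)%R by rewrite invr_eq0.
  rewrite -[in RHS](ge0_integral_affine (- (c * p) / s)%R si0 mJ J0).
  rewrite muleA -EFinM normfV mulfV ?gt_eqF// mul1e.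
  apply: eq_integral => x _; rewrite /H /J/=; congr (f (_, _) * (gauss_density _ * gauss_density _)%:E).
  - by field.
  - apply: (mulIf s0); rewrite divfK//; transitivity ((c ^+ 2 + s ^+ 2) * p - c * x)%R.
      by rewrite cs mul1r.
    by field.
  - by field.
have Nx (g : RR * RR -> \bar R) : measurable_fun setT g -> (forall w, 0 <= g w) ->
    \int[N]_x \int[N]_z g (x, z) =
    \int[leb]_x \int[leb]_z (g (x, z) * (gauss_density z * gauss_density x)%:E).
  move=> mg g0; rewrite ge0_integral_normal//; last 2 first.
  - exact: measurable_fun_fubini_tonelli_F.
  - by move=> x; exact: integral_ge0.
  apply: eq_integral => x _.
  have mgx : measurable_fun setT (fun z => g (x, z)) by exact: measurableT_comp.
  rewrite ge0_integral_normal// -ge0_integralZr//.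
  - by apply: eq_integral => z _; rewrite -muleA -EFinM.
  - by apply: emeasurable_funM => //; exact/measurable_EFinP.
  - by move=> z _; rewrite mule_ge0// lee_fin.
  - by rewrite lee_fin.
have := Nx _ mG (fun w => f0 _); rewrite /= => ->.
rewrite (Nx _ mf f0) -[RHS]mul1e -(mulVf (lt0r_neq0 ns0)) EFinM -muleA.
have mHs : measurable_fun setT (fun x : RR => \int[leb]_p H (x, p)).
  exact: measurable_fun_fubini_tonelli_F.
transitivity (\int[leb]_x (`|s|^-1%:E * \int[leb]_p H (x, p))).
  by apply: eq_integral => x _; rewrite -E1 muleA -EFinM mulVf ?gt_eqF// mul1e.
rewrite ge0_integralZl//; last by move=> x _; exact: integral_ge0.
congr (_ * _).
have mfp : measurable_fun setT
    (fun w : RR * RR => f w * (gauss_density w.1 * gauss_density w.2)%:E).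
  apply: emeasurable_funM => //; apply/measurable_EFinP.
  by apply: measurable_funM; apply: measurableT_comp.
have fp0 w : 0 <= f w * (gauss_density w.1 * gauss_density w.2)%:E.
  by apply: mule_ge0 => //; rewrite lee_fin; apply: mulr_ge0; exact: phi0.
transitivity (\int[leb]_p \int[leb]_x H (x, p)).
  exact: (fubini_tonelli H mH H0).
transitivity (\int[leb]_p (`|s|%:E * \int[leb]_q (f (p, q) *
    (gauss_density p * gauss_density q)%:E))).
  by apply: eq_integral => p _; exact: E2.
pose G p := \int[leb]_q (f (p, q) * (gauss_density p * gauss_density q)%:E).
have mG' : measurable_fun [set: RR] G.
  exact: (measurable_fun_fubini_tonelli_F _ mfp).
have G0 p : 0 <= G p by apply: integral_ge0 => q _; exact: fp0 (p, q).
have GE p : p \in [set: RR] ->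
    G p = \int[leb]_q (f (p, q) * (gauss_density q * gauss_density p)%:E).
  by move=> _; apply: eq_integral => q _; rewrite (mulrC (gauss_density q)).
by rewrite -(eq_integral _ _ GE); exact: (ge0_integralZT _ (ltW ns0) mG' G0).
Qed.

End normal_law.

Section power_measure_integral.
Context {R : realType} (m : {sigma_finite_measure set (measurableTypeR R) -> \bar R}).
Local Open Scope ereal_scope.

Lemma ge0_integral_cons n (f : 'rV[R]_n.+1 -> \bar R) :
  measurable_fun setT f -> (forall x, 0 <= f x) ->
  \int[power_measure m n.+1]_x f x =
  \int[m]_x \int[power_measure m n]_v f (cons_rV (x, v)).
Proof.
move=> mf f0.
transitivity (\int[image_measure (m \x power_measure m n) (@measurable_cons_rV R n)]_x f x).
  exact: eq_measure_integral.
rewrite ge0_integral_image_measure// fubini_tonelli1//.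
by apply: measurableT_comp => //; exact: measurable_cons_rV.
Qed.

Lemma ge0_integral_power0 (f : 'rV[R]_0 -> \bar R) :
  measurable_fun setT f -> \int[power_measure m 0]_x f x = f 0%R.
Proof.
move=> mf; transitivity (\int[dirac (0%R : 'rV[R]_0)]_x f x); first exact: eq_measure_integral.
by rewrite integral_dirac// diracE in_setT mul1e.
Qed.

End power_measure_integral.

Section gaussian.
Context {R : realType}.
Local Open Scope ereal_scope.
Notation N := (@normal_prob R 0%R 1%R).
Notation RR := (measurableTypeR R).

(** A separate name for [std_normal], whose declared structure is that of a sigma-finite measure, so
    that a probability structure can be attached to it. *)
Definition gaussian n : set 'rV[R]_n -> \bar R := std_normal n.

HB.instance Definition _ n := Measure.on (@gaussian n).

Let gaussian_setT n : gaussian [set: 'rV[R]_n] = 1.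
Proof.
have := @power_measure_box R N n (fun=> setT) (fun=> measurableT).
rewrite (_ : [set x | _] = setT); last by apply/seteqP; split=> x.
by move=> E; rewrite [LHS]E; apply: big1 => i _; exact: (probability_setT (N : probability RR R)).
Qed.

HB.instance Definition _ n := @Measure_isProbability.Build _ _ R (@gaussian n)
  (@gaussian_setT n).

Lemma measurable_cons_rVP d (T : measurableType d) n (a : T -> R) (f : T -> 'rV[R]_n) :
  measurable_fun setT a -> measurable_fun setT f ->
  measurable_fun setT (fun x => cons_rV (a x : RR, f x)).
Proof.
move=> ma mf; apply: (measurableT_comp (@measurable_cons_rV R n)).
exact/measurable_fun_pair.
Qed.

Lemma cons_rVD n (a b : R) (v w : 'rV[R]_n) :
  cons_rV ((a + b)%R : RR, (v + w)%R) = (cons_rV (a : RR, v) + cons_rV (b : RR, w))%R.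
Proof.
apply/rowP => i; rewrite [RHS]mxE; case: (unliftP ord0 i) => [j|] ->.
  by rewrite !cons_rVS mxE.
by rewrite !cons_rV0.
Qed.

Lemma cons_rVZ n (c a : R) (v : 'rV[R]_n) :
  cons_rV ((c * a)%R : RR, (c *: v)%R) = (c *: cons_rV (a : RR, v))%R.
Proof.
apply/rowP => i; rewrite [RHS]mxE; case: (unliftP ord0 i) => [j|] ->.
  by rewrite !cons_rVS mxE.
by rewrite !cons_rV0.
Qed.

Lemma cons_rVB n (a b : R) (v w : 'rV[R]_n) :
  cons_rV ((a - b)%R : RR, (v - w)%R) = (cons_rV (a : RR, v) - cons_rV (b : RR, w))%R.
Proof.
have E : cons_rV ((- b)%R : RR, (- w)%R) = (- cons_rV (b : RR, w))%R.
  by have := cons_rVZ (-1) b w; rewrite mulN1r !scaleN1r.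
by rewrite cons_rVD E.
Qed.

Lemma dotv_cons n (a b : R) (v w : 'rV[R]_n) :
  dotv (cons_rV (a : RR, v)) (cons_rV (b : RR, w)) = (a * b + dotv v w)%R.
Proof.
rewrite /dotv big_ord_recl !cons_rV0; congr (_ + _)%R.
by apply: eq_bigr => i _; rewrite !cons_rVS.
Qed.

Lemma ge0_integral_gaussian_cons n (f : 'rV[R]_n.+1 -> \bar R) :
  measurable_fun setT f -> (forall x, 0 <= f x) ->
  \int[gaussian (n := n.+1)]_x f x =
  \int[N]_x \int[gaussian (n := n)]_v f (cons_rV (x : RR, v)).
Proof. exact: ge0_integral_cons. Qed.

Lemma measurable_fun_comp2 d d1 d2 d3 (T : measurableType d) (T1 : measurableType d1)
    (T2 : measurableType d2) (T3 : measurableType d3) (F : T1 -> T2 -> T3)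
    (u : T -> T1) (v : T -> T2) :
  measurable_fun setT (fun w : T1 * T2 => F w.1 w.2) ->
  measurable_fun setT u -> measurable_fun setT v ->
  measurable_fun setT (fun t => F (u t) (v t)).
Proof.
move=> mF mu mv; apply: (measurableT_comp mF (g := fun t => (u t, v t))).
exact/measurable_fun_pair.
Qed.

Lemma measurable_integral_prod d1 d2 (T1 : measurableType d1) (T2 : measurableType d2)
    (P : probability T2 R) (f : T1 -> T2 -> \bar R) :
  measurable_fun setT (fun w : T1 * T2 => f w.1 w.2) -> (forall x y, 0 <= f x y) ->
  measurable_fun setT (fun x => \int[P]_y f x y).
Proof.
move=> mf f0; exact: (measurable_fun_fubini_tonelli_F (fun w => f w.1 w.2)).
Qed.

(** Induction on the dimension: both vectors are split into head and tail and the two heads are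
    integrated outermost; [normal_rotation] handles them and the induction hypothesis the tails. It
    serves detailed balance, the symmetry of the measure and the merging of successive noises. *)
Lemma gaussian_rotation n (c s : R) (f : 'rV[R]_n -> 'rV[R]_n -> \bar R) :
  (c ^+ 2 + s ^+ 2 = 1)%R -> s != 0%R ->
  measurable_fun setT (fun w : 'rV[R]_n * 'rV[R]_n => f w.1 w.2) ->
  (forall x z, 0 <= f x z) ->
  \int[gaussian (n := n)]_x \int[gaussian (n := n)]_z
    f (c *: x + s *: z)%R (s *: x - c *: z)%R =
  \int[gaussian (n := n)]_x \int[gaussian (n := n)]_z f x z.
Proof.
move=> cs s0; elim: n f => [|n IHn] f mf f0.
  apply: eq_integral => x _; apply: eq_integral => z _.
  by congr (f _ _); apply/rowP => -[].
have mc4 (F : 'rV[R]_n.+1 -> 'rV[R]_n.+1 -> \bar R) :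
    measurable_fun setT (fun w : 'rV[R]_n.+1 * 'rV[R]_n.+1 => F w.1 w.2) ->
    (forall x z, 0 <= F x z) ->
  \int[gaussian (n := n.+1)]_x \int[gaussian (n := n.+1)]_z F x z =
  \int[N]_a \int[N]_b \int[gaussian (n := n)]_v \int[gaussian (n := n)]_w
     F (cons_rV (a : RR, v)) (cons_rV (b : RR, w)).
  move=> mF F0.
  have mFc d (T : measurableType d) (a b : T -> R) (v w : T -> 'rV[R]_n) :
    measurable_fun setT a -> measurable_fun setT b -> measurable_fun setT v ->
    measurable_fun setT w ->
    measurable_fun setT (fun t => F (cons_rV (a t : RR, v t)) (cons_rV (b t : RR, w t))).
    move=> ma mb mv mw.
    by apply: measurable_fun_comp2 => //; exact: measurable_cons_rVP.
  rewrite ge0_integral_gaussian_cons; last 2 first.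
  - exact: measurable_integral_prod.
  - by move=> x; exact: integral_ge0.
  apply: eq_integral => a _.
  transitivity (\int[gaussian (n := n)]_v \int[N]_b \int[gaussian (n := n)]_w
    F (cons_rV (a : RR, v)) (cons_rV (b : RR, w))).
    apply: eq_integral => v _; rewrite ge0_integral_gaussian_cons//.
    exact: measurable_fun_comp2.
  pose h (t : 'rV[R]_n * RR) :=
    \int[gaussian (n := n)]_w F (cons_rV (a : RR, t.1)) (cons_rV (t.2, w)).
  apply: (fubini_tonelli h) => [|t]; last exact: integral_ge0.
  apply: measurable_integral_prod => //.
  apply: mFc => //; first exact: (measurableT_comp measurable_snd measurable_fst).
  exact: (measurableT_comp measurable_fst measurable_fst).
have mR : measurable_fun setT (fun w : 'rV[R]_n.+1 * 'rV[R]_n.+1 =>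
    f (c *: w.1 + s *: w.2)%R (s *: w.1 - c *: w.2)%R).
  apply: measurable_fun_comp2 => //; apply: measurable_addrV;
    try apply: measurable_opprV; exact: measurable_scalerV.
pose h (t : RR * RR) := \int[gaussian (n := n)]_v \int[gaussian (n := n)]_w
   f (cons_rV (t.1 : RR, v)) (cons_rV (t.2 : RR, w)).
have mh : measurable_fun setT h.
  apply: measurable_integral_prod; last by move=> *; exact: integral_ge0.
  apply: measurable_integral_prod; last by move=> *; exact: f0.
  apply: measurable_fun_comp2 => //; apply: measurable_cons_rVP => //.
  - exact: (measurableT_comp measurable_fst (measurableT_comp measurable_fst measurable_fst)).
  - exact: (measurableT_comp measurable_snd measurable_fst).
  - exact: (measurableT_comp measurable_snd (measurableT_comp measurable_fst measurable_fst)).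
have h0 t : 0 <= h t by apply: integral_ge0 => v _; exact: integral_ge0.
rewrite (mc4 _ mR (fun x z => f0 _ _)) [RHS](mc4 _ mf f0).
rewrite -[RHS](normal_rotation cs s0 mh h0) /h /=.
apply: eq_integral => a _; apply: eq_integral => b _.
rewrite -(IHn (fun v w => f (cons_rV ((c * a + s * b)%R : RR, v))
  (cons_rV ((s * a - c * b)%R : RR, w)))).
- apply: eq_integral => v _; apply: eq_integral => w _.
  by rewrite cons_rVD cons_rVB !cons_rVZ.
- by apply: measurable_fun_comp2 => //; apply: measurable_cons_rVP.
- by move=> *; exact: f0.
Qed.


End gaussian.

Section gaussian_density.
Context {R : realType}.
Local Open Scope ereal_scope.
Notation leb := (@lebesgue_measure R).
Notation N := (@normal_prob R 0%R 1%R).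
Notation RR := (measurableTypeR R).

Definition gaussian_density n (x : 'rV[R]_n) : R :=
  (normal_peak 1 ^+ n * expR (- enorm x ^+ 2 / 2))%R.

Lemma gaussian_density_ge0 n x : (0 <= @gaussian_density n x)%R.
Proof. by rewrite mulr_ge0 ?exprn_ge0 ?normal_peak_ge0 ?expR_ge0. Qed.

Lemma measurable_gaussian_density n : measurable_fun setT (@gaussian_density n).
Proof.
apply: measurable_funM => //; apply: measurableT_comp => //.
apply: measurable_funM => //; apply: measurableT_comp => //.
by apply: measurable_funX; exact: measurable_enorm.
Qed.

Lemma gaussian_density_cons n (a : R) (v : 'rV[R]_n) :
  gaussian_density (cons_rV (a : RR, v)) = (gauss_density a * gaussian_density v)%R.
Proof.
rewrite /gaussian_density /gauss_density mulrACA -exprS -expRD; congr (_ * expR _)%R.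
by rewrite !enorm_sqr dotv_cons -expr2 opprD mulrDl.
Qed.

Lemma ge0_integral_gaussian_density n (f : 'rV[R]_n -> \bar R) :
  measurable_fun setT f -> (forall x, 0 <= f x) ->
  \int[gaussian (n := n)]_x f x =
  \int[lebesgue_rV n]_x (f x * (gaussian_density x)%:E).
Proof.
elim: n f => [|n IHn] f mf f0.
  have mfd : measurable_fun setT (fun x => f x * (gaussian_density x)%:E).
    by apply: emeasurable_funM => //; apply/measurable_EFinP; exact: measurable_gaussian_density.
  transitivity (f 0%R); first exact: (ge0_integral_power0 N mf).
  rewrite [RHS](ge0_integral_power0 leb mfd) /gaussian_density.
  by rewrite enorm0 expr0n/= oppr0 mul0r expR0 mulr1 expr0 mule1.
have mfc (x : R) : measurable_fun setT (fun v : 'rV[R]_n => f (cons_rV (x : RR, v))).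
  by apply: measurableT_comp => //; exact: measurable_cons_rVP.
have mF : measurable_fun setT (fun w : RR * 'rV[R]_n =>
    f (cons_rV w) * (gaussian_density w.2)%:E).
  apply: emeasurable_funM.
    by apply: measurableT_comp => //; exact: measurable_cons_rV.
  apply/measurable_EFinP; apply: measurableT_comp => //.
  exact: measurable_gaussian_density.
have d0 (v : 'rV[R]_n) := gaussian_density_ge0 v.
rewrite ge0_integral_gaussian_cons//.
transitivity (\int[N]_x \int[lebesgue_rV n]_v
    (f (cons_rV (x : RR, v)) * (gaussian_density v)%:E)).
  by apply: eq_integral => x _; exact: IHn.
rewrite ge0_integral_normal; last 2 first.
- apply: (measurable_fun_fubini_tonelli_F _ mF) => w.
  by rewrite mule_ge0 ?lee_fin.
- by move=> x; apply: integral_ge0 => v _; rewrite mule_ge0 ?lee_fin.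
have mfd : measurable_fun setT (fun x : 'rV[R]_n.+1 => f x * (gaussian_density x)%:E).
  by apply: emeasurable_funM => //; apply/measurable_EFinP; exact: measurable_gaussian_density.
have fd0 (x : 'rV[R]_n.+1) : 0 <= f x * (gaussian_density x)%:E.
  by apply: mule_ge0 => //; rewrite lee_fin; exact: gaussian_density_ge0.
rewrite [RHS](ge0_integral_cons leb mfd fd0).
apply: eq_integral => x _.
pose k v := f (cons_rV (x : RR, v)) * (gaussian_density v)%:E.
have mk : measurable_fun [set: 'rV[R]_n] k.
  by apply: emeasurable_funM => //; apply/measurable_EFinP; exact: measurable_gaussian_density.
have k0 v : 0 <= k v by rewrite mule_ge0 ?lee_fin.
rewrite muleC -(ge0_integralZT _ (gauss_density_ge0 x) mk k0).
apply: eq_integral => v _; rewrite /k gaussian_density_cons.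
by rewrite (EFinM (gauss_density x)) muleCA.
Qed.

End gaussian_density.

(** * Gaussian moments *)

Section gaussian_moments.
Context {R : realType}.
Local Open Scope ereal_scope.
Notation leb := (@lebesgue_measure R).
Notation N := (@normal_prob R 0%R 1%R).
Notation RR := (measurableTypeR R).

(** The integrand is the ratio of the density at [q x] to that at [x], so the substitution [q x]
    gives [1 / q]. Values [q < 1] give exponential moments, and values near 1 the variance. *)
Lemma integral_normal_expR (q : R) : (0 < q)%R ->
  \int[N]_x (expR (- (q ^+ 2 - 1) / 2 * x ^+ 2))%:E = (q^-1)%:E.
Proof.
move=> q0; have q_neq0 := lt0r_neq0 q0.
have mx : measurable_fun [set: RR] (fun x => expR (- (q ^+ 2 - 1) / 2 * x ^+ 2)).
  by apply: measurableT_comp => //; apply: measurable_funM => //; exact: measurable_funX.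
rewrite ge0_integral_normal; [|exact/measurable_EFinP|by move=> x; rewrite lee_fin expR_ge0].
pose G (x : RR) := (gauss_density x)%:E.
have mG : measurable_fun [set: RR] G by apply/measurable_EFinP; exact: measurable_gauss_density.
have G0 x : 0 <= G x by rewrite lee_fin gauss_density_ge0.
have := ge0_integral_affine 0%R q_neq0 mG G0.
have -> : \int[leb]_x G x = 1.
  rewrite -(integral_normal_pdf 0%R 1%R).
  by apply: eq_integral => x _; rewrite normal_pdf01E.
have E x : x \in [set: RR] -> G (q * x + 0)%R =
    (expR (- (q ^+ 2 - 1) / 2 * x ^+ 2))%:E * (gauss_density x)%:E.
  move=> _; rewrite /G -EFinM; congr EFin.
  by rewrite /gauss_density mulrCA -expRD; congr (_ * expR _)%R; field.
rewrite (eq_integral _ _ E); move: (integral _ _ _) => I; rewrite gtr0_norm// => qI.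
by rewrite -[LHS]mul1e -(mulVf q_neq0) EFinM -muleA qI mule1.
Qed.

(** Instead of differentiating [1 / q] at [q = 1], the inequality [exp t >= 1 + t] is integrated:
    each [q] bounds the variance [v], in opposite directions for [q < 1] and [q > 1], and the
    product form states both at once. *)
Let sqr_normal_bounds : exists2 v : R, \int[N]_x (x ^+ 2)%:E = v%:E &
  forall q, (0 < q -> 0 <= (1 - q) * (2 - v * (q * (q + 1))))%R.
Proof.
have mx2 : measurable_fun [set: RR] (fun x => (x ^+ 2)%:E : \bar R).
  by apply/measurable_EFinP; exact: measurable_funX.
have x20 (x : RR) : 0 <= (x ^+ 2)%:E :> \bar R by rewrite lee_fin sqr_ge0.
have me (q : R) : measurable_fun [set: RR] (fun x => (expR (- (q ^+ 2 - 1) / 2 * x ^+ 2))%:E : \bar R).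
  apply/measurable_EFinP; apply: measurableT_comp => //.
  by apply: measurable_funM => //; exact: measurable_funX.
have int1 : \int[N]_x 1%:E = 1 by rewrite integral_cst// mul1e; exact: (probability_setT (N : probability RR R)).
have lt1 (q : R) : (0 < q < 1)%R ->
    1 + ((1 - q ^+ 2) / 2)%:E * \int[N]_x (x ^+ 2)%:E <= (q^-1)%:E.
  move=> /andP[q0 q1].
  have c0 : (0 <= (1 - q ^+ 2) / 2)%R.
    by rewrite divr_ge0// subr_ge0 expr_le1 ?ltW.
  rewrite -integral_normal_expR// -ge0_integralZT//.
  have mcx : measurable_fun [set: RR] (fun x => ((1 - q ^+ 2) / 2)%:E * (x ^+ 2)%:E).
    exact: emeasurable_funM.
  have cx0 (x : RR) : 0 <= ((1 - q ^+ 2) / 2)%:E * (x ^+ 2)%:E.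
    by rewrite mule_ge0 ?lee_fin ?sqr_ge0.
  rewrite -{1}int1 -ge0_integralDT//.
  apply: ge0_le_integralT => //; first exact: emeasurable_funD.
    by move=> x; exact: adde_ge0.
  move=> x; rewrite -EFinM -EFinD lee_fin opprB; exact: expR_ge1Dx.
have : \int[N]_x (x ^+ 2)%:E \is a fin_num.
  rewrite ge0_fin_numE ?integral_ge0//.
  have := lt1 2^-1%R; rewrite invr_gt0 ltr0n invf_lt1 ?ltr1n// => /(_ isT).
  case: (integral _ _ _) => // [r _|]; rewrite ?ltry//.
  by rewrite gt0_muley ?lte_fin//; lra.
move=> /fineK E; exists (fine (\int[N]_x (x ^+ 2)%:E)%E) => //.
move: lt1; rewrite -E; set v := fine _ => lt1 q q0.
have [q1|q1|->] := ltgtP q 1%R; last by rewrite subrr mul0r.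
- have := lt1 q; rewrite q0 q1 -EFinM -EFinD lee_fin => /(_ isT).
  rewrite -[leRHS]mul1r ler_pdivlMr// => H.
  have : (0 <= (1 - q) * (2 - v * (q * (q + 1))) / 2)%R by lra.
  by rewrite pmulr_lge0// invr_gt0.
- have c0 : (0 <= (q ^+ 2 - 1) / 2)%R by rewrite divr_ge0// subr_ge0 expr_ge1 ?ltW.
  have H : 1 <= (q^-1)%:E + ((q ^+ 2 - 1) / 2)%:E * v%:E.
    rewrite E -integral_normal_expR// -ge0_integralZT//.
    have mcx : measurable_fun [set: RR] (fun x => ((q ^+ 2 - 1) / 2)%:E * (x ^+ 2)%:E).
      exact: emeasurable_funM.
    have cx0 (x : RR) : 0 <= ((q ^+ 2 - 1) / 2)%:E * (x ^+ 2)%:E.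
      by rewrite mule_ge0 ?lee_fin ?sqr_ge0.
    rewrite -{1}int1 -ge0_integralDT//.
    apply: ge0_le_integralT => //; first exact: emeasurable_funD.
    move=> x; rewrite -EFinM -EFinD lee_fin -lerBlDr.
    by apply: le_trans (expR_ge1Dx _); rewrite mulNr mulNr.
  move: H; rewrite -EFinM -EFinD lee_fin -(ler_pM2r q0) mul1r mulrDl mulVf ?gt_eqF// => H.
  rewrite mulr_le0//; first by rewrite subr_le0 ltW.
  have : (0 < (q - 1) / 2)%R by rewrite divr_gt0// subr_gt0.
  by move=> q10; rewrite -(pmulr_rle0 _ q10)/=; lra.
Qed.

Lemma normal_sqr : \int[N]_x (x ^+ 2)%:E = 1.
Proof.
have [v -> vq] := sqr_normal_bounds; congr EFin.
(* [q = 2] gives [v >= 1 / 3], hence the positivity of [v]. *)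
have v2 := vq 2%R (ltr0Sn R 1).
have v0 : (0 < v)%R by lra.
have [v_lt1|v_gt1|//] := ltgtP v 1%R.
(* With [q = 1 + t] the bound reads [v (2 + 3 t + t^2) >= 2]; it fails at [t = (1 - v) / 4], where
   [2 - 2 v = 8 t] exceeds [v (3 t + t^2)]. *)
- have e0 : (0 < 1 + (1 - v) / 4)%R by lra.
  have := vq _ e0; rewrite opprD addNKr mulNr oppr_ge0.
  by rewrite pmulr_rle0; [nra|lra].
(* With [q = 1 - e] the bound reads [v (2 - 3 e + e^2) <= 2]; this [e] makes [3 v e = v - 1], so
   that the left side is at least [v + 1 > 2]. *)
- pose e := ((v - 1) / (3 * v))%R.
  have ve : (3 * v * e = v - 1)%R by rewrite /e mulrC divfK// gt_eqF// mulr_gt0.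
  have e_gt0 : (0 < e)%R by rewrite divr_gt0 ?subr_gt0 ?mulr_gt0.
  have e_lt1 : (0 < 1 - e)%R by rewrite subr_gt0 ltr_pdivrMr ?mulr_gt0//; lra.
  have := vq _ e_lt1; rewrite opprB addrCA subrr addr0.
  by rewrite pmulr_rge0//; nra.
Qed.

Lemma normal_symmetric (f : RR -> \bar R) : measurable_fun setT f ->
  (forall x, 0 <= f x) -> \int[N]_x f (- x)%R = \int[N]_x f x.
Proof.
move=> mf f0; rewrite ge0_integral_normal//; last exact: measurableT_comp.
pose h (x : RR) := f x * (gauss_density x)%:E.
have mh : measurable_fun [set: RR] h.
  by apply: emeasurable_funM => //; apply/measurable_EFinP; exact: measurable_gauss_density.
have h0 x : 0 <= h x by rewrite mule_ge0 ?lee_fin ?gauss_density_ge0.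
rewrite ge0_integral_normal//.
have n1 : (- 1 != 0 :> R)%R by rewrite oppr_eq0 oner_eq0.
have := ge0_integral_affine 0%R n1 mh h0; rewrite normrN1 mul1e => <-.
apply: eq_integral => x _; rewrite /h mulN1r addr0; congr (_ * _%:E).
by rewrite /gauss_density sqrrN.
Qed.

(** Head and tail contribute [b x + |a'| y] with [x], [y] independent standard normals, and the
    rotation with cosine [b / |a|] and sine [|a'| / |a|] turns this into [|a| x]. When the tail is 0
    the sine vanishes; then [|a| = |b|] and symmetry absorbs the sign. *)
Lemma gaussian_dotv n (a : 'rV[R]_n) (f : RR -> \bar R) : measurable_fun setT f ->
  (forall x, 0 <= f x) ->
  \int[gaussian (n := n)]_z f (dotv a z) = \int[N]_x f (enorm a * x)%R.
Proof.
elim: n a f => [|n IHn] a f mf f0.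
  have a0 : a = 0%R by apply/rowP => -[].
  rewrite a0 enorm0; transitivity (f 0%R).
    transitivity (\int[gaussian (n := 0)]_z f 0%R).
      by apply: eq_integral => z _; rewrite dot0v.
    rewrite integral_cst//.
    by rewrite [X in _ * X](probability_setT (gaussian (n := 0) : probability _ R)) mule1.
  transitivity (\int[N]_x f 0%R); last by apply: eq_integral => x _; rewrite mul0r.
  rewrite integral_cst//.
  by rewrite [X in _ * X](probability_setT (N : probability RR R)) mule1.
have [b [a' ->]] : exists (b : R) (a' : 'rV[R]_n), a = cons_rV (b : RR, a').
  exists (a 0%R 0%R), (\row_i a 0%R (lift ord0 i)); apply/rowP => i.
  case: (unliftP ord0 i) => [j|] ->; first by rewrite cons_rVS mxE.
  by rewrite cons_rV0.
have mdot (c : 'rV[R]_n.+1) : measurable_fun setT (fun z => f (dotv c z)).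
  by apply: measurableT_comp => //; exact: measurable_dotv.
rewrite ge0_integral_gaussian_cons//.
transitivity (\int[N]_x \int[N]_y f (b * x + enorm a' * y)%R).
  apply: eq_integral => x _.
  transitivity (\int[gaussian (n := n)]_v f (b * x + dotv a' v)%R).
    by apply: eq_integral => v _; rewrite dotv_cons.
  rewrite (IHn a' (fun t => f (b * x + t)%R))//.
  by apply: measurableT_comp => //; exact: measurable_funD.
have rhoE : (enorm (cons_rV (b : RR, a')) ^+ 2 = b ^+ 2 + enorm a' ^+ 2)%R.
  by rewrite !enorm_sqr dotv_cons expr2.
move: rhoE (enorm_ge0 (cons_rV (b : RR, a'))) (enorm_ge0 a').
move: (enorm _) (enorm a') => rho t rhoE rho0 t0.
have [t_0|tn0] := eqVneq t 0%R.
  rewrite t_0 expr0n addr0 in rhoE.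
  transitivity (\int[N]_x f (b * x)%R).
    apply: eq_integral => x _; rewrite t_0; under eq_integral do rewrite mul0r addr0.
    by rewrite integral_cst// [X in _ * X](probability_setT (N : probability RR R)) mule1.
  have [b0|b0] := leP 0%R b.
    by have /eqP := rhoE; rewrite eqrXn2// => /eqP ->.
  have -> : rho = (- b)%R.
    move/eqP: rhoE; rewrite eqf_sqr => /orP[/eqP rb|/eqP//].
    by move: rho0; rewrite rb leNgt b0.
  have mfb : measurable_fun [set: RR] (fun x => f (b * x)%R).
    by apply: measurableT_comp => //; exact: measurable_funM.
  rewrite -(normal_symmetric mfb)//.
  by apply: eq_integral => x _; rewrite mulrN mulNr.
have rho_gt0 : (0 < rho)%R.
  rewrite lt_neqAle rho0 andbT eq_sym; apply/eqP => r0.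
  move/eqP: rhoE; rewrite r0 expr0n/= eq_sym paddr_eq0 ?sqr_ge0//.
  by rewrite !sqrf_eq0 (negbTE tn0) andbF.
have rn0 := lt0r_neq0 rho_gt0.
pose h (w : RR * RR) := f (rho * w.1)%R.
have mh : measurable_fun setT h.
  by apply: measurableT_comp => //; apply: measurable_funM => //; exact: measurable_fst.
have cs : ((b / rho) ^+ 2 + (t / rho) ^+ 2 = 1)%R.
  by rewrite !expr_div_n -mulrDl -rhoE divff// expf_neq0.
have tr0 : (t / rho != 0)%R by rewrite mulf_neq0// invr_neq0.
transitivity (\int[N]_x \int[N]_y h (b / rho * x + t / rho * y, t / rho * x - b / rho * y)%R).
  apply: eq_integral => x _; apply: eq_integral => y _; rewrite /h/=.
  by congr f; field.
rewrite (normal_rotation cs tr0 mh (fun w => f0 _)) /h /=.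
apply: eq_integral => x _.
by rewrite integral_cst// [X in _ * X](probability_setT (N : probability RR R)) mule1.
Qed.

End gaussian_moments.

Section gaussian_bounds.
Context {R : realType}.
Local Open Scope ereal_scope.
Notation N := (@normal_prob R 0%R 1%R).
Notation RR := (measurableTypeR R).
Notation gam n := (gaussian (R := R) (n := n)).

Lemma integral_probability_cst d (T : measurableType d) (P : probability T R) (c : \bar R) :
  \int[P]_x c = c.
Proof. by rewrite integral_cst// [X in _ * X](probability_setT P) mule1. Qed.

(** The rotation with [c = 0] and [s = - 1] has [- z] as its first component. *)
Lemma gaussian_symmetric n (f : 'rV[R]_n -> \bar R) : measurable_fun setT f ->
  (forall x, 0 <= f x) -> \int[gam n]_z f (- z)%R = \int[gam n]_z f z.
Proof.
move=> mf f0; have cs : ((0 : R) ^+ 2 + (-1) ^+ 2 = 1)%R by rewrite expr0n sqrrN expr1n add0r.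
have n1 : (-1 != 0 :> R)%R by rewrite oppr_eq0 oner_eq0.
have m1 : measurable_fun setT (fun w : 'rV[R]_n * 'rV[R]_n => f w.1).
  exact: measurableT_comp.
have := gaussian_rotation (f := fun x _ => f x) cs n1 m1 (fun x _ => f0 x).
under eq_integral do under eq_integral do rewrite scale0r add0r scaleN1r.
under [in X in _ = X]eq_integral do rewrite (integral_probability_cst (gam n)).
by rewrite (integral_probability_cst (gam n)).
Qed.

Lemma gaussian_dotv_sqr n (a : 'rV[R]_n) :
  \int[gam n]_z (dotv a z ^+ 2)%:E = (enorm a ^+ 2)%:E.
Proof.
have mx2 : measurable_fun [set: RR] (fun x => (x ^+ 2)%:E : \bar R).
  by apply/measurable_EFinP; exact: measurable_funX.
have x20 (x : RR) : 0 <= (x ^+ 2)%:E :> \bar R by rewrite lee_fin sqr_ge0.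
rewrite (gaussian_dotv a mx2 x20).
under eq_integral do rewrite exprMn EFinM.
by rewrite ge0_integralZT ?sqr_ge0// normal_sqr mule1.
Qed.

Lemma measurable_enormX n k : measurable_fun setT (fun z : 'rV[R]_n => (enorm z ^+ k)%R).
Proof. by apply: measurable_funX; exact: measurable_enorm. Qed.

Lemma gaussian_enorm_sqr n : \int[gam n]_z (enorm z ^+ 2)%:E = n%:R%:E.
Proof.
transitivity (\int[gam n]_z \sum_(i < n) (dotv (delta_mx 0 i) z ^+ 2)%:E).
  apply: eq_integral => z _; rewrite sumEFin enorm_sqr; congr EFin.
  by apply: eq_bigr => i _; rewrite dotvC dotv_delta expr2.
rewrite ge0_integral_sum//.
- under eq_bigr do rewrite gaussian_dotv_sqr enorm_sqr dotv_delta mxE !eqxx.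
  by rewrite sumEFin big_const cardT size_enum_ord iter_addr_0.
- move=> i; apply/measurable_EFinP; apply: measurable_funX.
  exact: measurable_dotv.
- by move=> i z _; rewrite lee_fin sqr_ge0.
Qed.

(** One weight for all remainders: powers of [|z|] up to the third occur in them, and [1 + |z|^4]
    dominates each up to a constant. *)
Definition W n (z : 'rV[R]_n) : R := (1 + enorm z ^+ 4)%R.

(** Crude bound for the mean of [W]; its size is harmless because it reaches the final estimate only
    through terms that vanish with the step [s]. *)
Definition m4 n : R := (1 + 32 * 2 ^+ n)%R.

Lemma measurable_W n : measurable_fun setT (@W n).
Proof. by apply: measurable_funD => //; exact: measurable_enormX. Qed.

Lemma W_ge1 n (z : 'rV[R]_n) : (1 <= W z)%R.
Proof. by rewrite lerDl exprn_ge0 ?enorm_ge0. Qed.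

(** [3 / 8 = (1 - q^2) / 2] for [q = 1 / 2], so each coordinate contributes the factor
    [1 / q = 2]. *)
Let integral_expR_sqr n : \int[gam n]_z (expR (3 / 8 * enorm z ^+ 2))%:E = (2 ^+ n)%:E.
Proof.
have me k : measurable_fun setT (fun z : 'rV[R]_k => (expR (3 / 8 * enorm z ^+ 2))%:E : \bar R).
  apply/measurable_EFinP; apply: measurableT_comp => //.
  by apply: measurable_funM => //; exact: measurable_enormX.
elim: n => [|n IHn].
  transitivity (\int[gam 0]_z 1%:E); last by rewrite (integral_probability_cst (gam 0)) expr0.
  apply: eq_integral => z _; rewrite (_ : z = 0%R); last by apply/rowP => -[].
  by rewrite enorm0 expr0n mulr0 expR0.
rewrite ge0_integral_gaussian_cons//.
transitivity (\int[N]_x ((2 ^+ n)%:E * (expR (- (2^-1 ^+ 2 - 1) / 2 * x ^+ 2))%:E)).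
  apply: eq_integral => x _.
  transitivity (\int[gam n]_v ((expR (- (2^-1 ^+ 2 - 1) / 2 * x ^+ 2))%:E *
      (expR (3 / 8 * enorm v ^+ 2))%:E)).
    apply: eq_integral => v _; rewrite -EFinM -expRD; congr (expR _)%:E.
    by rewrite !enorm_sqr dotv_cons; field.
  by rewrite (ge0_integralZT _ (expR_ge0 _) (me n)) ?IHn 1?muleC// => v; rewrite lee_fin expR_ge0.
rewrite ge0_integralZT ?exprn_ge0//.
- by rewrite integral_normal_expR ?invr_gt0// invrK -EFinM exprSr.
- apply/measurable_EFinP; apply: measurableT_comp => //.
  by apply: measurable_funM => //; exact: measurable_funX.
Qed.

Lemma integral_W n : \int[gam n]_z (W z)%:E <= (m4 n)%:E.
Proof.
have me : measurable_fun setT (fun z : 'rV[R]_n => (expR (3 / 8 * enorm z ^+ 2))%:E : \bar R).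
  apply/measurable_EFinP; apply: measurableT_comp => //.
  by apply: measurable_funM => //; exact: measurable_enormX.
have e0 (z : 'rV[R]_n) : 0 <= (expR (3 / 8 * enorm z ^+ 2))%:E by rewrite lee_fin expR_ge0.
have mZ : measurable_fun setT (fun z : 'rV[R]_n => 32%:E * (expR (3 / 8 * enorm z ^+ 2))%:E).
  exact: emeasurable_funM.
have Z0 (z : 'rV[R]_n) : 0 <= 32%:E * (expR (3 / 8 * enorm z ^+ 2))%:E.
  by rewrite mule_ge0 ?lee_fin.
rewrite /m4 EFinD EFinM -integral_expR_sqr -ge0_integralZT//.
rewrite -{1}(integral_probability_cst (gam n) 1%:E) -ge0_integralDT//.
apply: ge0_le_integralT.
- by apply/measurable_EFinP; exact: measurable_W.
- by move=> z; rewrite lee_fin (le_trans ler01)// W_ge1.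
- exact: emeasurable_funD.
- move=> z; rewrite -EFinM -EFinD lee_fin lerD2l.
  set y := (enorm z ^+ 2)%R; have y0 : (0 <= y)%R by rewrite exprn_ge0 ?enorm_ge0.
  (* [exp (3 y / 8)] is the square of [exp (3 y / 16) >= 1 + 3 y / 16], and [32 (3 / 16)^2 >= 1];
     this is the origin of 32. *)
  rewrite (_ : 3 / 8 * y = 3 / 16 * y + 3 / 16 * y)%R; last by field.
  have := expR_ge1Dx (3 / 16 * y)%R; rewrite expRD.
  rewrite (_ : enorm z ^+ 4 = y ^+ 2)%R; last by rewrite /y -exprM.
  by move: (expR _) => t ty; nra.
Qed.

(* The odd terms of the bound cancel in F(z) + F(-z), which turns
   <u, z>_+ <A, z> into <u, z> <A, z>, whose integral is <u, A>. *)
Lemma gaussian_integral_bound n (F : 'rV[R]_n -> R) (u A b : 'rV[R]_n) (a0 be e ka : R) :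
  measurable_fun setT F -> (forall z, 0 <= F z)%R ->
  (0 <= be)%R -> (0 <= e)%R -> (0 <= ka)%R ->
  (forall z, F z <= a0 - be * (Num.max 0 (dotv u z) * dotv A z) + dotv b z
     + e * enorm z ^+ 2 + ka * W z)%R ->
  \int[gam n]_z (F z)%:E <=
    (a0 - be / 2 * dotv u A + e * n%:R + ka * m4 n)%:E.
Proof.
move=> mF F0 be0 e0 ka0 Fle.
have mFN : measurable_fun setT (fun z : 'rV[R]_n => F (- z)%R).
  by apply: measurableT_comp => //; exact: measurable_opprV.
(* Only nonnegative functions are integrated: the product [<u, z> <A, z>] is polarized, the square
   of [<u + A, z>] goes to the side of [F], and [2 |a0|] added to both sides makes the constants
   nonnegative. *)
pose S z := (F z + F (- z)%R + be / 4 * dotv (u + A)%R z ^+ 2 + (2 * `|a0| - 2 * a0))%R.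
pose T z := (2 * `|a0| + be / 4 * dotv (u - A)%R z ^+ 2 + 2 * e * enorm z ^+ 2
  + 2 * ka * W z)%R.
have ST z : (S z <= T z)%R.
  have := Fle z; have := Fle (- z)%R.
  rewrite /S /T /W !enormN !dotvNr !dotvBl !dotvDl; have [uz|/ltW uz] : (0 <= dotv u z \/ dotv u z < 0)%R by case: leP => _; [left|right].
    rewrite (@max_l _ _ 0%R (- dotv u z)%R) ?oppr_le0// (max_r uz); lra.
  rewrite (@max_r _ _ 0%R (- dotv u z)%R) ?oppr_ge0// (max_l uz); lra.
have c0 : (0 <= 2 * `|a0| - 2 * a0)%R.
  by rewrite -mulrBr mulr_ge0// subr_ge0 ler_norm.
have be4 : (0 <= be / 4)%R by rewrite divr_ge0.
have md v : measurable_fun setT (fun z : 'rV[R]_n => (dotv v z ^+ 2)%R).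
  by apply: measurable_funX; exact: measurable_dotv.
have d0 v (z : 'rV[R]_n) : (0 <= dotv v z ^+ 2)%R by exact: sqr_ge0.
have mbd v : measurable_fun setT (fun z : 'rV[R]_n => (be / 4 * dotv v z ^+ 2)%R).
  exact: measurable_funM.
have bd0 v (z : 'rV[R]_n) : (0 <= be / 4 * dotv v z ^+ 2)%R by rewrite mulr_ge0.
have men : measurable_fun setT (fun z : 'rV[R]_n => (enorm z ^+ 2)%R).
  exact: measurable_enormX.
have mW := @measurable_W n.
have en0 (z : 'rV[R]_n) : (0 <= enorm z ^+ 2)%R by exact: sqr_ge0.
have W0 (z : 'rV[R]_n) : (0 <= W z)%R by rewrite (le_trans ler01)// W_ge1.
have intF : \int[gam n]_z (F (- z)%R)%:E = \int[gam n]_z (F z)%:E.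
  by apply: (gaussian_symmetric (f := EFin \o F)) => //; exact/measurable_EFinP.
have mFF : measurable_fun setT (fun z : 'rV[R]_n => F z + F (- z))%R.
  exact: measurable_funD.
have FF0 z : (0 <= F z + F (- z))%R by rewrite addr_ge0.
have mFFd : measurable_fun setT
    (fun z : 'rV[R]_n => F z + F (- z) + be / 4 * dotv (u + A)%R z ^+ 2)%R.
  exact: measurable_funD.
have FFd0 z : (0 <= F z + F (- z) + be / 4 * dotv (u + A)%R z ^+ 2)%R.
  by rewrite addr_ge0.
have intS : \int[gam n]_z (S z)%:E = \int[gam n]_z (F z)%:E + \int[gam n]_z (F z)%:E
   + (be / 4 * enorm (u + A)%R ^+ 2)%:E + (2 * `|a0| - 2 * a0)%:E.
  rewrite (ge0_integralDR _ mFFd FFd0)// (integral_probability_cst (gam n)).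
  rewrite (ge0_integralDR _ mFF FF0)// (ge0_integralDR _ mF F0)// intF.
  by rewrite (ge0_integralZR _ be4)// gaussian_dotv_sqr.
have a00 : (0 <= 2 * `|a0|)%R by rewrite mulr_ge0.
have mT1 : measurable_fun setT
    (fun z : 'rV[R]_n => 2 * `|a0| + be / 4 * dotv (u - A)%R z ^+ 2)%R.
  exact: measurable_funD.
have T10 z : (0 <= 2 * `|a0| + be / 4 * dotv (u - A)%R z ^+ 2)%R by rewrite addr_ge0.
have e20 : (0 <= 2 * e)%R by rewrite mulr_ge0.
have k20 : (0 <= 2 * ka)%R by rewrite mulr_ge0.
have me2 : measurable_fun setT (fun z : 'rV[R]_n => 2 * e * enorm z ^+ 2)%R.
  exact: measurable_funM.
have e2n0 (z : 'rV[R]_n) : (0 <= 2 * e * enorm z ^+ 2)%R by rewrite mulr_ge0.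
have mk2 : measurable_fun setT (fun z : 'rV[R]_n => 2 * ka * W z)%R.
  exact: measurable_funM.
have k2W0 (z : 'rV[R]_n) : (0 <= 2 * ka * W z)%R by rewrite mulr_ge0.
have mT2 : measurable_fun setT (fun z : 'rV[R]_n =>
    2 * `|a0| + be / 4 * dotv (u - A)%R z ^+ 2 + 2 * e * enorm z ^+ 2)%R.
  exact: measurable_funD.
have T20 z : (0 <= 2 * `|a0| + be / 4 * dotv (u - A)%R z ^+ 2 + 2 * e * enorm z ^+ 2)%R.
  by rewrite addr_ge0.
have intT : \int[gam n]_z (T z)%:E <= (2 * `|a0| + be / 4 * enorm (u - A)%R ^+ 2
    + 2 * e * n%:R + 2 * ka * m4 n)%:E.
  rewrite (ge0_integralDR _ mT2 T20)// (ge0_integralDR _ mT1 T10)//.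
  rewrite (ge0_integralDR _ _ (fun=> a00))// (integral_probability_cst (gam n)).
  rewrite (ge0_integralZR _ be4)// gaussian_dotv_sqr.
  rewrite (ge0_integralZR _ e20)// gaussian_enorm_sqr (ge0_integralZR _ k20)//.
  by rewrite !EFinD !EFinM leeD2l// lee_wpmul2l ?lee_fin// integral_W.
have mS : measurable_fun setT S by exact: measurable_funD.
have mT : measurable_fun setT T by exact: measurable_funD.
have S0 z : (0 <= S z)%R by rewrite /S addr_ge0.
have := le_trans (ge0_le_integralR _ mS S0 mT ST) intT; rewrite intS.
have : 0 <= \int[gam n]_z (F z)%:E by apply: integral_ge0 => z _; rewrite lee_fin.
case: (integral _ _ _) => [x| |] //= _.
rewrite -!EFinD !lee_fin enormD_sqr enormB_sqr; lra.
Qed.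

End gaussian_bounds.

(** * One Metropolis-adjusted move *)

Section rejection_function.
Context {R : realType}.
Implicit Types t a b : R.

Definition rejection t : R := Num.max 0 (1 - expR (- t)).

Lemma rejection_ge0 t : 0 <= rejection t. Proof. by rewrite le_max lexx. Qed.

Lemma rejection_le1 t : rejection t <= 1.
Proof. by rewrite ge_max ler01 gerBl expR_ge0. Qed.

Lemma rejectionE_ge0 t : 0 <= t -> rejection t = 1 - expR (- t).
Proof. by move=> t0; rewrite /rejection max_r// subr_ge0 -[leRHS]expR0 ler_expR oppr_le0. Qed.

Lemma rejectionE_le0 t : t <= 0 -> rejection t = 0.
Proof. by move=> t0; rewrite /rejection max_l// subr_le0 -[leLHS]expR0 ler_expR oppr_ge0. Qed.

Lemma rejection_lip a b : `|rejection a - rejection b| <= `|a - b|.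
Proof.
wlog ba : a b / b <= a.
  move=> wlg; have [/wlg//|/ltW/wlg] := leP b a.
  by rewrite distrC (distrC b).
have mono : rejection b <= rejection a.
  by rewrite le_max2// lerB// ler_expR lerN2.
rewrite !ger0_norm ?subr_ge0//.
have [b0|/ltW b0] := leP 0 b.
  rewrite !rejectionE_ge0 ?(le_trans b0)//.
  rewrite (_ : - a = - b + (b - a)); last by ring.
  rewrite expRD; have := expR_ge1Dx (b - a).
  have : expR (- b) <= 1 by rewrite -[leRHS]expR0 ler_expR oppr_le0.
  have := expR_ge0 (- b); move: (expR (- b)) (expR (b - a)) => x y; nra.
rewrite (rejectionE_le0 b0) subr0.
have [a0|/ltW a0] := leP 0 a; last by rewrite rejectionE_le0// subr_ge0.
by rewrite rejectionE_ge0//; have := expR_ge1Dx (- a); lra.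
Qed.

Lemma rejection0 : rejection 0 = 0.
Proof. by rewrite rejectionE_le0. Qed.

Lemma rejection_le_norm t : rejection t <= `|t|.
Proof.
have := rejection_lip t 0; rewrite rejection0 !subr0.
by rewrite ger0_norm ?rejection_ge0.
Qed.

(** First-order expansion at 0; for [t >= 0] the bound [exp (- t) <= 1 / (1 + t) <= 1 - t + t^2]
    suffices. *)
Lemma rejection_max t : `|rejection t - Num.max 0 t| <= t ^+ 2.
Proof.
have [t0|t0] := orP (le_total 0 t); last first.
  by rewrite rejectionE_le0// (max_l t0) subrr normr0 sqr_ge0.
rewrite rejectionE_ge0// (max_r t0) distrC ger0_norm.
  suff : expR (- t) <= 1 - t + t ^+ 2 by lra.
  have t1 : 0 < 1 + t by rewrite ltr_wpDr.
  rewrite expRN; apply: (@le_trans _ _ (1 + t)^-1).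
    by rewrite lef_pV2 ?posrE ?expR_gt0// expR_ge1Dx.
  rewrite -div1r ler_pdivrMr//; nra.
by have := expR_ge1Dx (- t); lra.
Qed.

End rejection_function.

Section pcn_step.
Context {R : realType} {n : nat} (U : 'rV[R]_n -> R) (gU : 'rV[R]_n -> 'rV[R]_n).
Variables (B LU : R).
Hypotheses
  (U_taylor : forall x v, `|U (x + v) - U x - dotv (gU x) v| <= LU / 2 * enorm v ^+ 2)
  (U_lip : forall x v, `|U (x + v) - U x| <= B * enorm v)
  (gU_le : forall x, enorm (gU x) <= B) (B_ge0 : 0 <= B) (LU_ge0 : 0 <= LU)
  (mU : measurable_fun setT U) (mgU : measurable_fun setT gU).
Variables (h k s : R).
Hypotheses (h_gt0 : 0 < h) (s_gt0 : 0 < s) (s_le1 : s <= 1) (s_sqr : s ^+ 2 = 2 * h)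
  (k_ge0 : 0 <= k) (k_le : k <= 2 * h) (kh : `|h - k| <= 2 * h ^+ 2).
Implicit Types x y z A v : 'rV[R]_n.

(** [1 - k] stands for the cosine [sqrt (1 - s^2)]; this section uses it through [0 <= k <= 2 h] and
    [|h - k| <= 2 h^2], with [h = s^2 / 2] the duration of a move. *)
Definition proposal y z := (1 - k) *: y + s *: z.

(** Only [U] enters the Metropolis ratio: the proposal is already reversible for the Gaussian factor
    of the target. *)
Definition reject y z : R := rejection (U (proposal y z) - U y).

Let gV y := gU y + y.

(** Lets every term of order [h^2] be counted as one of order [h s]. *)
Let hs : h <= s.
Proof.
have : s ^+ 2 <= s by rewrite expr2; apply: ler_piMr => //; exact: ltW.
by rewrite s_sqr; move: h_gt0 s_gt0; lra.
Qed.

Let proposalE y z : proposal y z = y + (s *: z + - (k *: y)).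
Proof. by rewrite /proposal scalerBl scale1r addrA addrAC. Qed.

Let reject_le y z : reject y z <= B * (s * enorm z + 2 * h * enorm y).
Proof.
apply: le_trans (rejection_le_norm _) _; rewrite proposalE.
apply: le_trans (U_lip _ _) _; rewrite ler_wpM2l//.
apply: le_trans (ler_enormB _ _) _; rewrite !enormZ (gtr0_norm s_gt0) (ger0_norm k_ge0).
by rewrite lerD2l ler_wpM2r ?enorm_ge0.
Qed.

(** The leading term, of order [s], is what creates the drift; the error is of order [h], one power
    of [s] smaller. *)
Let reject_approx y z : `|reject y z - s * Num.max 0 (dotv (gU y) z)|
  <= 2 * h * B * enorm y + h * (LU + 2 * B ^+ 2) * enorm z ^+ 2.
Proof.
pose t := s * dotv (gU y) z.
have -> : s * Num.max 0 (dotv (gU y) z) = Num.max 0 t.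
  by rewrite maxr_pMr ?mulr0// ltW.
apply: (le_trans (ler_distD (rejection t) _ _)).
have H1 := rejection_max t.
have H2 : t ^+ 2 <= 2 * h * (B ^+ 2 * enorm z ^+ 2).
  rewrite exprMn s_sqr ler_wpM2l ?mulr_ge0 ?(ltW h_gt0)//.
  apply: le_trans (dotv_sqr_le _ _) _; rewrite -!enorm_sqr.
  by rewrite ler_wpM2r ?sqr_ge0// ler_sqr ?nnegrE ?enorm_ge0.
have H3 : `|reject y z - rejection t| <= 2 * h * B * enorm y + h * LU * enorm z ^+ 2.
  apply: le_trans (rejection_lip _ _) _.
  rewrite (_ : _ - t = (U (y + s *: z + - (k *: y)) - U (y + s *: z))
     + (U (y + s *: z) - U y - dotv (gU y) (s *: z))); last first.
    by rewrite proposalE addrA dotvZr /t; ring.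
  apply: le_trans (ler_normD _ _) _; apply: lerD.
    apply: le_trans (U_lip _ _) _; rewrite enormN enormZ ger0_norm//.
    rewrite (mulrC _ B) -!mulrA ler_wpM2l// mulrA ler_wpM2r ?enorm_ge0//.
  apply: le_trans (U_taylor _ _) _; rewrite enormZ exprMn real_normK ?num_real//.
  by rewrite s_sqr; lra.
by move: H1 H2 H3; lra.
Qed.

(** A common constant for the remainders of all three one-move bounds, chosen generously. *)
Definition Cstep : R := 20 + 20 * B + LU + 10 * B ^+ 2.

Let Y y : R := 1 + enorm y ^+ 2.

(** These monomials in [a = |y|] and [t = |z|] occur in the remainders; a bound by a product of a
    function of [a] and one of [t] lets the integral over [z] factor out. *)
Let monomials (a t : R) : 0 <= a -> 0 <= t ->
  [/\ 1 <= (1 + a ^+ 2) * (1 + t ^+ 4), a <= (1 + a ^+ 2) * (1 + t ^+ 4),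
      a ^+ 2 <= (1 + a ^+ 2) * (1 + t ^+ 4), t ^+ 3 <= (1 + a ^+ 2) * (1 + t ^+ 4) &
      a * t <= (1 + a ^+ 2) * (1 + t ^+ 4) /\ a * t ^+ 2 <= (1 + a ^+ 2) * (1 + t ^+ 4)].
Proof.
move=> a0 t0; set P := 1 + a ^+ 2; set Q := 1 + t ^+ 4.
have a20 : 0 <= a ^+ 2 by exact: sqr_ge0.
have t20 : 0 <= t ^+ 2 by exact: sqr_ge0.
have t4 : t ^+ 4 = t ^+ 2 ^+ 2 by rewrite -exprM.
have t40 : 0 <= t ^+ 4 by rewrite t4 sqr_ge0.
have P1 : 1 <= P by rewrite /P; lra.
have Q1 : 1 <= Q by rewrite /Q; lra.
have aP : a <= P by rewrite /P; have := sqr_ge0 (a - 1); rewrite sqrrB; lra.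
have a2P : a ^+ 2 <= P by rewrite /P; lra.
have t2Q : t ^+ 2 <= Q by rewrite /Q t4; have := sqr_ge0 (t ^+ 2 - 1); rewrite sqrrB; lra.
have tQ : t <= Q.
  have := sqr_ge0 (t - 1); rewrite sqrrB /Q t4.
  have := sqr_ge0 (t ^+ 2 - 1); rewrite sqrrB; lra.
have t3Q : t ^+ 3 <= Q.
  rewrite /Q (_ : t ^+ 4 = t * t ^+ 3); last exact: exprS.
  have [t1|/ltW t1] := leP t 1.
    by rewrite (le_trans (exprn_ile1 3 t0 t1))// lerDl mulr_ge0// exprn_ge0.
  by rewrite (le_trans (_ : _ <= t * t ^+ 3)) ?lerDr// ler_peMl// exprn_ge0.
have PQ (x y : R) : 0 <= x -> 0 <= y -> x <= P -> y <= Q -> x * y <= P * Q.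
  by move=> x0 y0 xP yQ; rewrite ler_pM.
split; [| | | |split].
- by rewrite -[leLHS]mulr1 PQ.
- by rewrite -[leLHS]mulr1 PQ.
- by rewrite -[leLHS]mulr1 PQ.
- by rewrite -[leLHS]mul1r PQ// exprn_ge0.
- exact: PQ.
- exact: PQ.
Qed.

(** Average over acceptance and rejection of the increments [h gV y - k y] and [h gV y - s z], that
    is, of the move minus the noise plus the expected drift. *)
Let drift y z := h *: gV y - k *: y + (reject y z * k) *: y - (s * reject y z) *: z.

(** The term [- s (reject y z) z] is close to [- 2 h <gU y, z>_+ z], whose Gaussian mean is
    [- h gU y]; [gaussian_integral_bound] makes it cancel [h gU y]. *)
Let drift_le y z A : dotv A (drift y z) <=
  h * dotv A (gU y) - 2 * h * (Num.max 0 (dotv (gU y) z) * dotv A z)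
  + h * s * Cstep * Y y * enorm A * W z.
Proof.
set r := reject y z; set mx := Num.max 0 _.
have Ay := normr_dotv_le A y; have Az := normr_dotv_le A z.
have r0 : 0 <= r := rejection_ge0 _.
have := reject_approx y z; rewrite -/r -/mx => rapp.
have rle := reject_le y z; rewrite -/r in rle.
have -> : dotv A (drift y z) = h * dotv A (gU y) - 2 * h * (mx * dotv A z)
    + ((h - k) * dotv A y + r * k * dotv A y - s * (r - s * mx) * dotv A z).
  rewrite /drift -/r /gV !dotvE -s_sqr; ring.
rewrite lerD2l.
have T1 : (h - k) * dotv A y <= 2 * h ^+ 2 * (enorm A * enorm y).
  by apply: (le_trans (ler_norm _)); rewrite normrM ler_pM.
have T2 : r * k * dotv A y <= B * (s * enorm z + 2 * h * enorm y) * (2 * h) * (enorm A * enorm y).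
  apply: (le_trans (ler_norm _)); rewrite normrM ler_pM//.
  by rewrite ger0_norm ?mulr_ge0// ler_pM.
have T3 : - (s * (r - s * mx) * dotv A z) <=
    s * (2 * h * B * enorm y + h * (LU + 2 * B ^+ 2) * enorm z ^+ 2) * (enorm A * enorm z).
  apply: (le_trans (ler_norm _)); rewrite normrN normrM ler_pM//.
  by rewrite normrM (gtr0_norm s_gt0) ler_wpM2l// ltW.
apply: le_trans (lerD (lerD T1 T2) T3) _.
have [] := monomials (enorm_ge0 y) (enorm_ge0 z).
have a0 := enorm_ge0 A; have y0 := enorm_ge0 y; have z0 := enorm_ge0 z.
rewrite /Y /W /Cstep; set X := (1 + enorm y ^+ 2) * (1 + enorm z ^+ 4).
have -> : h * s * (20 + 20 * B + LU + 10 * B ^+ 2) * (1 + enorm y ^+ 2) * enorm A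
    * (1 + enorm z ^+ 4) = h * enorm A * (s * ((20 + 20 * B + LU + 10 * B ^+ 2) * X)).
  by rewrite /X; ring.
move: (enorm A) (enorm y) (enorm z) X a0 y0 z0 => a b c X a0 b0 c0.
move=> X1 Xb Xb2 Xc3 [Xbc Xbc2].
have -> : 2 * h ^+ 2 * (a * b) + B * (s * c + 2 * h * b) * (2 * h) * (a * b) +
    s * (2 * h * B * b + h * (LU + 2 * B ^+ 2) * c ^+ 2) * (a * c)
  = h * a * (h * (2 * b + 4 * B * b ^+ 2) + s * (4 * B * (b * c) + (LU + 2 * B ^+ 2) * c ^+ 3)).
  by ring.
have ha : 0 <= h * a by rewrite mulr_ge0// ltW.
rewrite ler_wpM2l//.
have X0 : 0 <= X by exact: le_trans X1.
have B20 : 0 <= B ^+ 2 by exact: sqr_ge0.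
have BX := mulr_ge0 B_ge0 X0; have B2X := mulr_ge0 B20 X0.
have H1 : h * (2 * b + 4 * B * b ^+ 2) <= s * (2 * b + 4 * B * b ^+ 2).
  by rewrite ler_wpM2r// addr_ge0 ?mulr_ge0 ?sqr_ge0.
apply: le_trans (lerD H1 (lexx _)) _; rewrite -mulrDr ler_wpM2l ?(ltW s_gt0)//.
have H2 := ler_wpM2l B_ge0 Xb2; have H3 := ler_wpM2l B_ge0 Xbc.
have H4 := ler_wpM2l LU_ge0 Xc3; have H5 := ler_wpM2l B20 Xc3.
lra.
Qed.

Let gV_le y : enorm (gV y) <= B + enorm y.
Proof. by apply: le_trans (ler_enormD _ _) _; rewrite lerD2r. Qed.

Let p y := h *: gV y - k *: y.
Let q y := h *: gV y.

Let Y_ge1 y : 1 <= Y y. Proof. by rewrite lerDl sqr_ge0. Qed.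

Let gV_sqr_le y : enorm (gV y) ^+ 2 <= 2 * (B ^+ 2 + 1) * Y y.
Proof.
have : enorm (gV y) ^+ 2 <= (B + enorm y) ^+ 2.
  by rewrite ler_sqr ?nnegrE ?addr_ge0 ?enorm_ge0.
rewrite /Y; have := sqr_ge0 (B - enorm y); have := sqr_ge0 (B * enorm y).
rewrite sqrrB sqrrD exprMn; have := sqr_ge0 B; lra.
Qed.

Let q_sqr_le y : enorm (q y) ^+ 2 <= h * s * (2 * (B ^+ 2 + 1) * Y y).
Proof.
rewrite /q enormZ exprMn real_normK ?num_real//.
apply: ler_pM; [exact: sqr_ge0|exact: sqr_ge0| |exact: gV_sqr_le].
by rewrite expr2; apply: ler_wpM2l => //; exact: ltW.
Qed.

Let p_sqr_le y : enorm (p y) ^+ 2 <= h * s * ((4 * (B ^+ 2 + 1) + 8) * Y y).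
Proof.
rewrite /p -scaleNr; apply: le_trans (enormD_sqr_le _ _) _.
have := q_sqr_le y; rewrite /q => H1.
have H2 : enorm (- k *: y) ^+ 2 <= h * s * (4 * Y y).
  rewrite enormZ exprMn real_normK ?num_real// sqrrN.
  rewrite (_ : h * s * (4 * Y y) = (4 * (h * s)) * Y y); last by ring.
  apply: ler_pM; [exact: sqr_ge0|exact: sqr_ge0| |by rewrite /Y lerDr].
  rewrite (_ : 4 * (h * s) = (2 * h) * (2 * s)); last by ring.
  rewrite expr2; apply: ler_pM => //; apply: (le_trans k_le).
  by apply: ler_wpM2l.
by move: H1 H2; lra.
Qed.

Let mreject : measurable_fun setT (fun w : 'rV[R]_n * 'rV[R]_n => reject w.1 w.2).
Proof.
apply: measurable_maxr => //; apply: measurable_funB => //.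
apply: measurableT_comp => //; apply: measurableT_comp => //.
apply: measurable_funB; last exact: measurableT_comp.
apply: measurableT_comp => //.
by apply: measurable_addrV; exact: measurable_scalerV.
Qed.

Let mreject_y y : measurable_fun setT (reject y).
Proof. exact: (measurable_fun_comp2 mreject). Qed.

(** Size of the error of a single move from [y], with an additional factor [s] compared with the
    duration [h]. *)
Definition bstep y := h * s * (Cstep * m4 n) * (1 + enorm y ^+ 2).

Let Cstep_ge0 : 0 <= Cstep.
Proof. by rewrite /Cstep !addr_ge0 ?mulr_ge0 ?sqr_ge0. Qed.

Let kappa_ge0 y (t : R) : 0 <= t -> 0 <= h * s * Cstep * Y y * t.
Proof.
by move=> t0; rewrite !mulr_ge0 ?(ltW h_gt0) ?(ltW s_gt0) ?(le_trans ler01 (Y_ge1 y)).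
Qed.

Let r_ge0 y z : 0 <= reject y z. Proof. exact: rejection_ge0. Qed.
Let r_le1 y z : reject y z <= 1. Proof. exact: rejection_le1. Qed.

Let rz_le y z : reject y z * (s ^+ 2 * enorm z ^+ 2) <= h * s * (6 * B * (Y y * W z)).
Proof.
have [X1 Xb Xb2 Xc3 [Xbc Xbc2]] := monomials (enorm_ge0 y) (enorm_ge0 z).
have c0 := enorm_ge0 z; have b0 := enorm_ge0 y.
apply: le_trans (ler_wpM2r _ (reject_le y z)) _; first by rewrite mulr_ge0 ?sqr_ge0.
rewrite s_sqr /Y /W; move: (enorm y) (enorm z) b0 c0 X1 Xb Xb2 Xc3 Xbc Xbc2 => b c b0 c0.
set X := (1 + b ^+ 2) * _ => X1 Xb Xb2 Xc3 Xbc Xbc2.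
rewrite (_ : B * _ * _ = 2 * h * B * (s * c ^+ 3 + h * (2 * (b * c ^+ 2)))); last by ring.
rewrite (_ : h * s * _ = 2 * h * B * (s * X + s * (2 * X))); last by ring.
apply: ler_wpM2l; first by rewrite !mulr_ge0 ?(ltW h_gt0).
apply: lerD; first by apply: ler_wpM2l => //; exact: ltW.
apply: ler_pM => //; [exact: ltW| |exact: ler_wpM2l].
by rewrite !mulr_ge0// sqr_ge0.
Qed.

Let YW_ge y z : Y y <= Y y * W z.
Proof. by rewrite ler_peMr ?W_ge1// (le_trans ler01). Qed.

Let remainder1_le y z :
  (1 - reject y z) * enorm (p y) ^+ 2 + reject y z * enorm (q y - s *: z) ^+ 2
  <= h * s * Cstep * Y y * W z.
Proof.
have := r_ge0 y z; have := r_le1 y z; have := rz_le y z.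
have := p_sqr_le y; have := q_sqr_le y; have := enormD_sqr_le (q y) (- (s *: z)).
rewrite enormN enormZ exprMn real_normK ?num_real//.
have p0 := sqr_ge0 (enorm (p y)); have q0 := sqr_ge0 (enorm (q y)).
move: (reject y z) (enorm (p y) ^+ 2) p0 (enorm (q y) ^+ 2) q0 => r P P0 Q Q0.
move: (enorm (q y - _) ^+ 2) (s ^+ 2 * enorm z ^+ 2) => D S DS Qle Ple Sle r1 r0.
have H1 : (1 - r) * P <= P by rewrite ler_piMl// gerBl.
have H2 : r * D <= 2 * Q + 2 * (r * S).
  apply: (le_trans (ler_wpM2l r0 DS)); rewrite mulrDr lerD//; last by lra.
  by rewrite ler_piMl// mulr_ge0.
have hs0 : 0 <= h * s by rewrite mulr_ge0 ?(ltW h_gt0) ?(ltW s_gt0).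
have H3 := ler_wpM2l hs0 (YW_ge y z).
apply: (le_trans (lerD H1 H2)).
rewrite (_ : h * s * Cstep * Y y * W z = h * s * (Cstep * (Y y * W z))); last by ring.
apply: (@le_trans _ _ (h * s * ((8 * (B ^+ 2 + 1) + 8 + 12 * B) * (Y y * W z)))); last first.
  apply: ler_wpM2l => //; apply: ler_wpM2r; first exact: le_trans (le_trans ler01 (Y_ge1 y)) (YW_ge y z).
  by rewrite /Cstep; have := sqr_ge0 B; move: B_ge0 LU_ge0; lra.
have H4 : h * s * ((4 * (B ^+ 2 + 1) + 8 + 4 * (B ^+ 2 + 1)) * Y y) <=
   h * s * ((4 * (B ^+ 2 + 1) + 8 + 4 * (B ^+ 2 + 1)) * (Y y * W z)).
  apply: ler_wpM2l => //; apply: ler_wpM2l => //.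
  by rewrite !addr_ge0// mulr_ge0// addr_ge0// sqr_ge0.
by move: Ple Qle Sle H4; lra.
Qed.

Let main_le A y : enorm A ^+ 2 + h * s * Cstep * Y y * (2 * enorm A + 1) * m4 n
  <= (enorm A + bstep y) ^+ 2 + bstep y.
Proof.
rewrite sqrrD /bstep -/(Y y); have := sqr_ge0 (h * s * (Cstep * m4 n) * Y y); lra.
Qed.

(** The drift [h gU y] cancels against the rejections, so nothing of order [h] survives. Of the two
    occurrences of [bstep], the one inside the square accumulates linearly over the moves, the outer
    one under a square root. *)
Lemma increment_bound y A :
  (\int[gaussian (n := n)]_z ((1 - reject y z) * enorm (A + h *: (gU y + y) - k *: y) ^+ 2
     + reject y z * enorm (A + h *: (gU y + y) - s *: z) ^+ 2)%:E
   <= ((enorm A + bstep y) ^+ 2 + bstep y)%:E)%E.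
Proof.
apply: le_trans (gaussian_integral_bound (u := gU y) (A := A) (b := 0) (be := 4 * h)
  (e := 0) (a0 := enorm A ^+ 2 + 2 * h * dotv A (gU y))
  (ka := h * s * Cstep * Y y * (2 * enorm A + 1)) _ _ _ _ _ _) _.
- apply: measurable_funD; apply: measurable_funM => //.
  + exact: measurable_funB.
  + apply: measurable_funX; apply: measurable_enorm; apply: measurable_addrV => //.
    by apply: measurable_opprV; exact: measurable_scalerV.
- by move=> z; rewrite addr_ge0// mulr_ge0 ?sqr_ge0// subr_ge0.
- by rewrite mulr_ge0// ltW.
- by [].
- by rewrite kappa_ge0// addr_ge0// mulr_ge0 ?enorm_ge0.
- move=> z; have := remainder1_le y z; have := drift_le y z A.
  set r := reject y z; set mx := Num.max _ _.
  have -> : A + h *: (gU y + y) - k *: y = A + p y by rewrite /p addrA.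
  have -> : A + h *: (gU y + y) - s *: z = A + (q y - s *: z) by rewrite /q addrA.
  rewrite (enormD_sqr A (p y)) (enormD_sqr A (q y - s *: z)) dot0v => D1 D2.
  have DE : dotv A (drift y z) = (1 - r) * dotv A (p y) + r * dotv A (q y - s *: z).
    by rewrite /drift /p /q -/r !dotvE; ring.
  by rewrite DE in D1; move: D1 D2; lra.
- rewrite lee_fin mul0r addr0; apply: le_trans (main_le A y).
  by rewrite (dotvC A); lra.
Qed.

(** Here the noise is kept: it adds its variance [2 h n], while the mean displacement moves by
    [- h (gU y + y)]. The terms linear in [z], collected in [b], integrate to 0. *)
Lemma displacement_bound y v :
  (\int[gaussian (n := n)]_z ((1 - reject y z) * enorm (v - k *: y + s *: z) ^+ 2
     + reject y z * enorm v ^+ 2)%:E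
   <= ((enorm (v - h *: (gU y + y)) + bstep y) ^+ 2 + bstep y + 2 * h * n%:R)%:E)%E.
Proof.
set A := v - h *: (gU y + y).
apply: le_trans (gaussian_integral_bound (u := gU y) (A := A) (be := 4 * h)
  (b := (2 * s) *: A + (2 * s) *: p y)
  (e := 2 * h) (a0 := enorm A ^+ 2 + 2 * h * dotv A (gU y))
  (ka := h * s * Cstep * Y y * (2 * enorm A + 1)) _ _ _ _ _ _) _.
- apply: measurable_funD; apply: measurable_funM => //.
  + exact: measurable_funB.
  + apply: measurable_funX; apply: measurable_enorm; apply: measurable_addrV => //.
    exact: measurable_scalerV.
- by move=> z; rewrite addr_ge0// mulr_ge0 ?sqr_ge0// subr_ge0.
- by rewrite mulr_ge0// ltW.
- by rewrite mulr_ge0// ltW.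
- by rewrite kappa_ge0// addr_ge0// mulr_ge0 ?enorm_ge0.
- move=> z; have := drift_le y z A; have := r_ge0 y z; have := r_le1 y z.
  set r := reject y z; set mx := Num.max _ _ => r1 r0.
  have -> : v - k *: y + s *: z = A + (p y + s *: z).
    by rewrite /A /p; apply: dotv_ext => w; rewrite !dotvE; ring.
  have -> : enorm v ^+ 2 = enorm (A + q y) ^+ 2 by rewrite /A /q subrK.
  rewrite (enormD_sqr A (p y + _)) (enormD_sqr A (q y)) => D1.
  have DE : dotv A (drift y z) = (1 - r) * dotv A (p y) + r * dotv A (q y) - s * r * dotv A z.
    by rewrite /drift /p /q -/r !dotvE; ring.
  rewrite DE in D1; rewrite (dotvDr A (p y)) dotvZr.
  have D2 : (1 - r) * enorm (p y + s *: z) ^+ 2 + r * enorm (q y) ^+ 2 <=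
      2 * h * enorm z ^+ 2 + 2 * s * dotv (p y) z + h * s * Cstep * Y y * W z.
    have D3 : (1 - r) * enorm (p y + s *: z) ^+ 2 <= enorm (p y + s *: z) ^+ 2.
      by rewrite ler_piMl ?sqr_ge0// gerBl.
    have D4 : r * enorm (q y) ^+ 2 <= enorm (q y) ^+ 2 by rewrite ler_piMl ?sqr_ge0.
    apply: (le_trans (lerD D3 D4)).
    rewrite enormD_sqr enormZ exprMn real_normK ?num_real// s_sqr dotvZr.
    have hs0 : 0 <= h * s by rewrite mulr_ge0 ?(ltW h_gt0) ?(ltW s_gt0).
    have D5 : h * s * ((4 * (B ^+ 2 + 1) + 8 + 2 * (B ^+ 2 + 1)) * Y y) <=
        h * s * (Cstep * (Y y * W z)).
      apply: ler_wpM2l => //; apply: ler_pM => //.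
      - by rewrite !addr_ge0// mulr_ge0// addr_ge0// sqr_ge0.
      - exact: le_trans (Y_ge1 y).
      - by rewrite /Cstep; have := sqr_ge0 B; move: B_ge0 LU_ge0; lra.
    by have := p_sqr_le y; have := q_sqr_le y; move: D5; lra.
  rewrite (dotvDl (_ *: A) (_ *: p y)) (dotvZl _ A) (dotvZl _ (p y)).
  by move: D1 D2; lra.
- rewrite lee_fin; have := main_le A y; rewrite (dotvC A); lra.
Qed.

(** A discrete dissipation inequality. Integrated against the stationary law, the mean of [V]
    appears on both sides and cancels, which leaves a bound on the mean of [|gU y + y|^2]. *)
Lemma potential_bound y (V : 'rV[R]_n -> R) : measurable_fun setT V -> (forall x, 0 <= V x) ->
  (forall x v, V (x + v) <= V x + dotv (gU x + x) v + (LU + 1) / 2 * enorm v ^+ 2) ->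
  (\int[gaussian (n := n)]_z ((1 - reject y z) * V (proposal y z) + reject y z * V y)%:E
   <= (V y - h * enorm (gU y + y) ^+ 2 + (LU + 1) * h * n%:R
      + h * s * (2 * (LU + 1) + Cstep * m4 n * (B + 1)) * (1 + enorm y ^+ 2) ^+ 2)%:E)%E.
Proof.
move=> mV V0 V_le.
apply: le_trans (gaussian_integral_bound (u := gU y) (A := gV y) (be := 2 * h)
  (b := s *: gV y - ((LU + 1) * (s * k)) *: y)
  (e := (LU + 1) * h) (a0 := V y - h * enorm (gV y) ^+ 2 + h * dotv (gV y) (gU y)
     + (LU + 1) * (2 * (h * s) * Y y))
  (ka := h * s * Cstep * Y y * enorm (gV y)) _ _ _ _ _ _) _.
- apply: measurable_funD; apply: measurable_funM => //.
  + exact: measurable_funB.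
  + apply: measurableT_comp => //; apply: measurable_addrV => //.
    exact: measurable_scalerV.
- by move=> z; rewrite addr_ge0// mulr_ge0// subr_ge0.
- by rewrite mulr_ge0// ltW.
- by rewrite mulr_ge0 ?addr_ge0// ltW.
- by rewrite kappa_ge0// enorm_ge0.
- move=> z; have := drift_le y z (gV y); have := r_ge0 y z; have := r_le1 y z.
  set r := reject y z; set mx := Num.max _ _ => r1 r_0 D1.
  have DE : dotv (gV y) (drift y z) = h * enorm (gV y) ^+ 2
     + (1 - r) * dotv (gV y) (s *: z - k *: y) - s * dotv (gV y) z.
    by rewrite /drift -/r enorm_sqr !dotvE; ring.
  rewrite DE in D1; rewrite proposalE.
  have r0 : 0 <= 1 - r by rewrite subr_ge0.
  have L0 : 0 <= (LU + 1) / 2 by rewrite divr_ge0// addr_ge0.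
  have D2 := ler_wpM2l r0 (V_le y (s *: z - k *: y)); rewrite -/(gV y) in D2.
  have D3 : (1 - r) * ((LU + 1) / 2 * enorm (s *: z - k *: y) ^+ 2) <=
     (LU + 1) / 2 * (2 * h * enorm z ^+ 2 - 2 * (s * k) * dotv y z + 4 * (h * s) * Y y).
    apply: (@le_trans _ _ ((LU + 1) / 2 * enorm (s *: z - k *: y) ^+ 2)).
      by apply: ler_piMl; [exact: mulr_ge0 L0 (sqr_ge0 _)|rewrite gerBl].
    apply: ler_wpM2l => //.
    rewrite enormB_sqr !enormZ !exprMn !real_normK ?num_real// s_sqr !dotvE (dotvC z).
    have : k ^+ 2 * enorm y ^+ 2 <= 4 * (h * s) * Y y.
      apply: ler_pM; [exact: sqr_ge0|exact: sqr_ge0| |by rewrite /Y lerDr].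
      rewrite (_ : 4 * (h * s) = (2 * h) * (2 * s)); last by ring.
      rewrite expr2; apply: ler_pM => //; apply: (le_trans k_le).
      by apply: ler_wpM2l.
    lra.
  rewrite (dotvBl (_ *: gV y) (_ *: y)) (dotvZl _ (gV y)) (dotvZl _ y).
  by move: D1 D2 D3; lra.
- rewrite lee_fin -/(gV y) -/(Y y) (dotvC (gV y)).
  have hsC : 0 <= h * s * (Cstep * m4 n).
    rewrite !mulr_ge0 ?(ltW h_gt0) ?(ltW s_gt0)//.
    by rewrite addr_ge0// mulr_ge0// exprn_ge0.
  have Y0 : 0 <= Y y by exact: le_trans (Y_ge1 y).
  have H1 : enorm (gV y) <= (B + 1) * Y y.
    apply: le_trans (gV_le y) _; rewrite mulrDl mul1r lerD//.
      by rewrite ler_peMr.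
    by rewrite /Y; have := sqr_ge0 (enorm y - 1); rewrite sqrrB; have := sqr_ge0 (enorm y); lra.
  have H2 := ler_wpM2l (mulr_ge0 hsC Y0) H1.
  have H3 : h * s * (LU + 1) * Y y <= h * s * (LU + 1) * Y y ^+ 2.
    apply: ler_wpM2l; last by rewrite expr2 ler_peMl.
    by rewrite !mulr_ge0 ?(ltW h_gt0) ?(ltW s_gt0)// addr_ge0.
  by move: H2 H3; lra.
Qed.

End pcn_step.

(** * Invariance of the target *)

Section pcn_invariance.
Context {R : realType} {n : nat} (U : 'rV[R]_n -> R) (pi : probability 'rV[R]_n R) (C : R).
Local Open Scope ereal_scope.
Notation V := ('rV[R]_n).
Notation gam := (gaussian (R := R) (n := n)).
Hypotheses (mU : measurable_fun setT U) (C_ge0 : (0 <= C)%R)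
  (piE : forall f : V -> \bar R, measurable_fun setT f -> (forall x, 0 <= f x) ->
     \int[pi]_x f x = \int[gam]_x (f x * (C * expR (- U x))%:E)).
Variables (k s : R).
Hypotheses (ks : ((1 - k) ^+ 2 + s ^+ 2 = 1)%R) (s_neq0 : s != 0%R).

Lemma measurable_proposal d (T : measurableType d) (y z : T -> V) :
  measurable_fun setT y -> measurable_fun setT z ->
  measurable_fun setT (fun t => proposal k s (y t) (z t)).
Proof. by move=> my mz; apply: measurable_addrV; exact: measurable_scalerV. Qed.

Lemma measurable_reject d (T : measurableType d) (y z : T -> V) :
  measurable_fun setT y -> measurable_fun setT z ->
  measurable_fun setT (fun t => reject U k s (y t) (z t)).
Proof.
move=> my mz; apply: measurable_maxr => //; apply: measurable_funB => //.
apply: measurableT_comp => //; apply: measurableT_comp => //.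
apply: measurable_funB; apply: measurableT_comp => //.
exact: measurable_proposal.
Qed.

(* Detailed balance: (1 - reject y z) exp (- U y) = min (exp (- U y)) (exp (- U y'))
   with y' the proposal, and (y, z) |-> (y', s y - c z) is an involution which
   preserves the Gaussian measure and exchanges y and y'. *)
Lemma acceptE y z : ((1 - reject U k s y z) * expR (- U y)
  = Num.min (expR (- U y)) (expR (- U (proposal k s y z))))%R.
Proof.
rewrite /reject /rejection; set y' := proposal _ _ _ _.
have -> : expR (- U y') = (expR (- (U y' - U y)) * expR (- U y))%R.
  by rewrite -expRD; congr expR; ring.
have e0 := expR_gt0 (- U y); move: (expR (- U y)) (expR (- (U y' - U y))) e0 => a b a0.
have [b1|b1] := orP (le_total b 1%R).
  rewrite (@max_r _ _ 0%R) ?subr_ge0// min_r; first by ring.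
  by apply: ler_piMl => //; exact: ltW.
rewrite (@max_l _ _ 0%R) ?subr_le0// min_l; first by ring.
by apply: ler_peMl => //; exact: ltW.
Qed.

Lemma pcn_invariant (f : V -> \bar R) : measurable_fun setT f -> (forall x, 0 <= f x) ->
  \int[pi]_y \int[gam]_z ((1 - reject U k s y z)%:E * f (proposal k s y z)
     + (reject U k s y z)%:E * f y) = \int[pi]_y f y.
Proof.
move=> mf f0.
have r0 y z : (0 <= reject U k s y z)%R := rejection_ge0 _.
have r1 y z : (0 <= 1 - reject U k s y z)%R by rewrite subr_ge0 rejection_le1.
have mr1 d (T : measurableType d) (y z : T -> V) :
    measurable_fun setT y -> measurable_fun setT z ->
    measurable_fun setT (fun t => (1 - reject U k s (y t) (z t))%:E : \bar R).
  move=> my mz; apply/measurable_EFinP; apply: measurable_funB => //.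
  exact: measurable_reject.
have mr d (T : measurableType d) (y z : T -> V) :
    measurable_fun setT y -> measurable_fun setT z ->
    measurable_fun setT (fun t => (reject U k s (y t) (z t))%:E : \bar R).
  by move=> my mz; apply/measurable_EFinP; exact: measurable_reject.
pose F1 y z := (1 - reject U k s y z)%:E * f (proposal k s y z).
pose F2 y z := (reject U k s y z)%:E * f y.
pose F3 y z := (1 - reject U k s y z)%:E * f y.
have F10 y z : 0 <= F1 y z by rewrite mule_ge0 ?lee_fin.
have F20 y z : 0 <= F2 y z by rewrite mule_ge0 ?lee_fin.
have F30 y z : 0 <= F3 y z by rewrite mule_ge0 ?lee_fin.
have mF1 d (T : measurableType d) (y z : T -> V) : measurable_fun setT y ->
    measurable_fun setT z -> measurable_fun setT (fun t => F1 (y t) (z t)).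
  move=> my mz; apply: emeasurable_funM; first exact: mr1.
  by apply: measurableT_comp => //; exact: measurable_proposal.
have mF2 d (T : measurableType d) (y z : T -> V) : measurable_fun setT y ->
    measurable_fun setT z -> measurable_fun setT (fun t => F2 (y t) (z t)).
  by move=> my mz; apply: emeasurable_funM; [exact: mr|exact: measurableT_comp].
have mF3 d (T : measurableType d) (y z : T -> V) : measurable_fun setT y ->
    measurable_fun setT z -> measurable_fun setT (fun t => F3 (y t) (z t)).
  by move=> my mz; apply: emeasurable_funM; [exact: mr1|exact: measurableT_comp].
have mI (F : V -> V -> \bar R) : (forall y z, 0 <= F y z) ->
    measurable_fun setT (fun w : V * V => F w.1 w.2) ->
    measurable_fun setT (fun y => \int[gam]_z F y z).
  by move=> F0 mF; exact: (measurable_integral_prod gam).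
pose e y := (C * expR (- U y))%R.
have e0 y : (0 <= e y)%R by rewrite mulr_ge0 ?expR_ge0.
have eZ (F : V -> \bar R) y : measurable_fun setT F -> (forall z, 0 <= F z) ->
    (\int[gam]_z F z) * (C * expR (- U y))%:E = \int[gam]_z ((e y)%:E * F z).
  by move=> mF F0; rewrite muleC -/(e y) ge0_integralZT.
(* Accepted moves carry as much of [f] into their arrival points as out of their departure points;
   adding the rejected part [F2] to [F3] then restores [f]. *)
have swap : \int[pi]_y \int[gam]_z F1 y z = \int[pi]_y \int[gam]_z F3 y z.
  rewrite !piE; last 4 first.
  - by apply: mI => //; exact: mF3.
  - by move=> y; exact: integral_ge0.
  - by apply: mI => //; exact: mF1.
  - by move=> y; exact: integral_ge0.
  (* [p] and [q] are the images of [y] and [z] under the reflection; the proposal made from [(p, q)]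
     is [y] again, and the minimum is symmetric in the two points. *)
  pose H p q := (C * Num.min (expR (- U (proposal k s p q))) (expR (- U p)))%:E * f p.
  have mH : measurable_fun setT (fun w : V * V => H w.1 w.2).
    apply: emeasurable_funM; last exact: measurableT_comp.
    apply/measurable_EFinP; apply: measurable_funM => //; apply: measurable_minr.
      apply: measurableT_comp => //; apply: measurableT_comp => //.
      by apply: measurableT_comp => //; exact: measurable_proposal.
    by apply: measurableT_comp => //; apply: measurableT_comp => //; exact: measurableT_comp.
  have H0 p q : 0 <= H p q.
    by rewrite mule_ge0 ?lee_fin ?mulr_ge0// le_min !expR_ge0.
  transitivity (\int[gam]_y \int[gam]_z H ((1 - k) *: y + s *: z)%R (s *: y - (1 - k) *: z)%R).
    apply: eq_integral => y _; rewrite eZ//; last exact: mF1.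
    apply: eq_integral => z _; rewrite /H /F1 muleA -EFinM -/(proposal k s y z).
    congr (_%:E * _); rewrite /e -mulrA; congr (_ * _)%R; rewrite mulrC acceptE.
    congr (Num.min (expR (- U _)) _).
    apply: dotv_ext => v; rewrite /proposal !dotvE.
    transitivity (((1 - k) ^+ 2 + s ^+ 2) * dotv y v)%R; first by rewrite ks mul1r.
    by ring.
  rewrite (gaussian_rotation ks s_neq0 mH H0); apply: eq_integral => y _.
  rewrite eZ//; last exact: mF3.
  apply: eq_integral => z _; rewrite /H /F3 muleA -EFinM.
  by congr (_%:E * _); rewrite /e -mulrA minC -acceptE; congr (_ * _)%R; rewrite mulrC.
have mG1 : measurable_fun setT (fun y => \int[gam]_z F1 y z) by apply: mI => //; exact: mF1.
have mG2 : measurable_fun setT (fun y => \int[gam]_z F2 y z) by apply: mI => //; exact: mF2.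
have mG3 : measurable_fun setT (fun y => \int[gam]_z F3 y z) by apply: mI => //; exact: mF3.
have G10 y : 0 <= \int[gam]_z F1 y z by exact: integral_ge0.
have G20 y : 0 <= \int[gam]_z F2 y z by exact: integral_ge0.
have G30 y : 0 <= \int[gam]_z F3 y z by exact: integral_ge0.
have mF1y y := mF1 _ V (fun=> y) id (measurable_cst y) (@measurable_id _ V setT).
have mF2y y := mF2 _ V (fun=> y) id (measurable_cst y) (@measurable_id _ V setT).
have mF3y y := mF3 _ V (fun=> y) id (measurable_cst y) (@measurable_id _ V setT).
transitivity (\int[pi]_y (\int[gam]_z F1 y z + \int[gam]_z F2 y z)).
  by apply: eq_integral => y _; exact: (ge0_integralDT gam (mF1y y) (F10 y) (mF2y y) (F20 y)).
rewrite (ge0_integralDT pi mG1 G10 mG2 G20) swap -(ge0_integralDT pi mG3 G30 mG2 G20).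
apply: eq_integral => y _.
rewrite -(ge0_integralDT gam (mF3y y) (F30 y) (mF2y y) (F20 y)).
rewrite -[RHS](integral_probability_cst gam); apply: eq_integral => z _.
by rewrite /F3 /F2 -ge0_muleDl ?lee_fin// -EFinD subrK mul1e.
Qed.

End pcn_invariance.

Section step_parameters.
Context {R : realType}.
Implicit Types s : R.

Definition contraction_of s : R := 1 - Num.sqrt (1 - s ^+ 2).

(** From [(1 - k)^2 = 1 - s^2] follows [k - h = k^2 / 2], so [k] agrees with [h] up to second
    order. *)
Lemma step_parametersP s : 0 < s -> s <= 1 -> let h := s ^+ 2 / 2 in
  let k := contraction_of s in
  [/\ 0 < h, s ^+ 2 = 2 * h, (1 - k) ^+ 2 + s ^+ 2 = 1,
      0 <= k /\ k <= 2 * h & `|h - k| <= 2 * h ^+ 2].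
Proof.
move=> s0 s1 h k.
have s21 : s ^+ 2 <= 1 by rewrite expr_le1// ltW.
have s20 : 0 < s ^+ 2 by rewrite exprn_gt0.
have h0 : 0 < h by rewrite divr_gt0.
have sE : s ^+ 2 = 2 * h by rewrite /h; field.
pose t := Num.sqrt (1 - s ^+ 2).
have t0 : 0 <= t by exact: sqrtr_ge0.
have tE : t ^+ 2 = 1 - s ^+ 2 by rewrite sqr_sqrtr// subr_ge0.
have kE : k = 1 - t by [].
have t1 : t <= 1 by rewrite -(@expr_le1 _ 2)// tE; lra.
have k2 : k <= 2 * h.
  have : t ^+ 2 <= t by rewrite expr2; apply: ler_piMl.
  by rewrite tE sE kE; lra.
have k0 : 0 <= k by rewrite kE; lra.
split=> //; first by rewrite kE (_ : 1 - (1 - t) = t) ?tE; ring.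
have khE : k - h = k ^+ 2 / 2.
  rewrite kE /h (_ : s ^+ 2 = 1 - t ^+ 2); last by rewrite tE; ring.
  by field.
rewrite distrC khE ger0_norm ?divr_ge0 ?sqr_ge0//.
have : k ^+ 2 <= (2 * h) ^+ 2 by rewrite ler_sqr// nnegrE mulr_ge0// ltW.
by rewrite exprMn; lra.
Qed.

End step_parameters.

Lemma m4_ge0 {R : realType} n : 0 <= m4 n :> R.
Proof. by rewrite addr_ge0// mulr_ge0// exprn_ge0. Qed.

Lemma Cstep_ge0 {R : realType} (B LU : R) : 0 <= B -> 0 <= LU -> 0 <= Cstep B LU.
Proof. by move=> B0 L0; rewrite !addr_ge0 ?mulr_ge0 ?sqr_ge0. Qed.

(** * Moments of the target distribution *)

Section target_moments.
Context {R : realType} {n : nat} (U : 'rV[R]_n -> R) (gU : 'rV[R]_n -> 'rV[R]_n).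
Variables (B LU C : R) (pi : probability 'rV[R]_n R).
Local Open Scope ereal_scope.
Notation V := ('rV[R]_n).
Notation gam := (gaussian (R := R) (n := n)).
Hypotheses
  (U_taylor : forall x v, (`|U (x + v) - U x - dotv (gU x) v| <= LU / 2 * enorm v ^+ 2)%R)
  (U_lip : forall x v, (`|U (x + v) - U x| <= B * enorm v)%R)
  (gU_le : forall x, (enorm (gU x) <= B)%R) (B_ge0 : (0 <= B)%R) (LU_ge0 : (0 <= LU)%R)
  (mU : measurable_fun setT U) (mgU : measurable_fun setT gU)
  (U_ge0 : forall x, (0 <= U x)%R) (C_ge0 : (0 <= C)%R)
  (piE : forall f : V -> \bar R, measurable_fun setT f -> (forall x, 0 <= f x) ->
     \int[pi]_x f x = \int[gam]_x (f x * (C * expR (- U x))%:E)).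

(** Bound for the mean of [(1 + |y|^2)^2] under [pi]: since [U >= 0], the density with respect to
    the Gaussian is at most [C], and [(1 + |y|^2)^2 <= 2 W y]. *)
Definition kap : R := (2 * C * m4 n)%R.

Let mY2 : measurable_fun setT (fun y : V => (1 + enorm y ^+ 2) ^+ 2)%R.
Proof. by apply: measurable_funX; apply: measurable_funD => //; exact: measurable_enormX. Qed.

Lemma integral_pi_sqr_le : \int[pi]_y ((1 + enorm y ^+ 2) ^+ 2)%:E <= kap%:E.
Proof.
have C20 : (0 <= 2 * C)%R by rewrite mulr_ge0.
have mW := @measurable_W R n.
rewrite piE; [|exact/measurable_EFinP|by move=> y; rewrite lee_fin sqr_ge0].
apply: (@le_trans _ _ (\int[gam]_y (2 * C * W y)%:E)).
  have me : measurable_fun setT (fun x => C * expR (- U x))%R.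
    by apply: measurable_funM => //; apply: measurableT_comp => //; exact: measurableT_comp.
  apply: (@ge0_le_integralR _ _ _ gam (fun y : V => ((1 + enorm y ^+ 2) ^+ 2 * (C * expR (- U y)))%R)).
  - exact: measurable_funM.
  - by move=> y; rewrite mulr_ge0 ?sqr_ge0// mulr_ge0 ?expR_ge0.
  - exact: measurable_funM.
  - move=> y; rewrite (_ : 2 * C * W y = (2 * W y) * (C * 1))%R; last by ring.
    apply: ler_pM; [exact: sqr_ge0|by rewrite mulr_ge0 ?expR_ge0| |].
      rewrite /W (_ : enorm y ^+ 4 = (enorm y ^+ 2) ^+ 2)%R -?exprM//.
      by have := sqr_ge0 (enorm y ^+ 2 - 1); rewrite sqrrB sqrrD; lra.
    apply: ler_wpM2l => //.
    by rewrite -[leRHS]expR0 ler_expR oppr_le0.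
rewrite ge0_integralZR//; last by move=> y; rewrite (le_trans ler01)// W_ge1.
by rewrite /kap [leRHS]EFinM lee_wpmul2l ?lee_fin// integral_W.
Qed.

Lemma kap_ge1 : (1 <= kap)%R.
Proof.
rewrite -lee_fin; apply: le_trans integral_pi_sqr_le.
rewrite -[leLHS](integral_probability_cst pi).
apply: (@ge0_le_integralR _ _ _ pi (cst 1%R)) => // y.
by rewrite exprn_ege1// lerDl sqr_ge0.
Qed.

Section gradient.
Variable E : V -> R.
Hypotheses (mE : measurable_fun setT E) (E_ge0 : forall x, (0 <= E x)%R)
  (E_le : forall x v, (E (x + v) <= E x + dotv (gU x + x) v + (LU + 1) / 2 * enorm v ^+ 2)%R).

(** The mean of [E] must be finite before it can be cancelled from the dissipation inequality. The
    descent bound at 0 makes [E] grow at most quadratically. *)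
Let integral_E_fin : \int[pi]_y (E y)%:E < +oo.
Proof.
pose D : R := (E 0 + enorm (gU 0) + (LU + 1))%R.
have D0 : (0 <= D)%R by rewrite !addr_ge0 ?enorm_ge0.
apply: (@le_lt_trans _ _ (D * kap)%:E); last exact: ltry.
apply: le_trans (_ : \int[pi]_y (D * (1 + enorm y ^+ 2) ^+ 2)%:E <= _).
  apply: ge0_le_integralR => //; first exact: measurable_funM.
  move=> y; have := E_le 0%R y; rewrite add0r addr0 => /le_trans; apply.
  have y0 := enorm_ge0 y.
  set Y2 := ((1 + enorm y ^+ 2) ^+ 2)%R.
  have Y1 : (1 <= Y2)%R by rewrite exprn_ege1// lerDl sqr_ge0.
  have Ya : (enorm y <= Y2)%R.
    rewrite /Y2 sqrrD; have := sqr_ge0 (enorm y - 1); rewrite sqrrB.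
    by have := sqr_ge0 (enorm y); have := sqr_ge0 (enorm y ^+ 2); lra.
  have Yb : (enorm y ^+ 2 <= Y2)%R.
    by rewrite /Y2 sqrrD; have := sqr_ge0 (enorm y); have := sqr_ge0 (enorm y ^+ 2); lra.
  have H1 := ler_wpM2l (E_ge0 0) Y1.
  have H2 := ler_wpM2l (enorm_ge0 (gU 0)) Ya.
  have L1 : (0 <= LU + 1)%R by rewrite addr_ge0.
  have H3 := ler_wpM2l L1 Yb.
  have H4 := mulr_ge0 L1 (sqr_ge0 (enorm y)).
  by have := dotv_le (gU 0) y; rewrite /D; move: H1 H2 H3 H4; lra.
rewrite ge0_integralZR//; last by move=> y; exact: sqr_ge0.
by rewrite [leRHS]EFinM lee_wpmul2l ?lee_fin// integral_pi_sqr_le.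
Qed.

(** [potential_bound] is integrated against [pi]; by invariance the left side is the mean of [E],
    and after cancellation the inequality is divided by [h]. *)
Let gradient_sqr_le_step s : (0 < s)%R -> (s <= 1)%R ->
  \int[pi]_y (enorm (gU y + y) ^+ 2)%:E <=
  ((LU + 1) * n%:R + s * ((2 * (LU + 1) + Cstep B LU * m4 n * (B + 1)) * kap))%:E.
Proof.
move=> s0 s1; have [] := step_parametersP s0 s1.
set h := (s ^+ 2 / 2)%R; set k := contraction_of s => h0 sE ks [k0 k2] kh.
set C3 := (2 * (LU + 1) + _)%R.
have C30 : (0 <= C3)%R.
  apply: addr_ge0; first by rewrite mulr_ge0 ?addr_ge0.
  by rewrite !mulr_ge0 ?Cstep_ge0 ?m4_ge0 ?addr_ge0.
have mg : measurable_fun setT (fun y : V => enorm (gU y + y) ^+ 2)%R.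
  by apply: measurable_funX; apply: measurable_enorm; exact: measurable_addrV.
pose J (y : V) := \int[gam]_z ((1 - reject U k s y z) * E (proposal k s y z)
  + reject U k s y z * E y)%:E.
have r0 y z : (0 <= reject U k s y z)%R := rejection_ge0 _.
have r1 y z : (0 <= 1 - reject U k s y z)%R by rewrite subr_ge0 rejection_le1.
have J0 y : 0 <= J y.
  by apply: integral_ge0 => z _; rewrite lee_fin addr_ge0// mulr_ge0.
have mJ : measurable_fun setT J.
  apply: (measurable_integral_prod gam); last first.
    by move=> y z; rewrite lee_fin addr_ge0// mulr_ge0.
  apply/measurable_EFinP; apply: measurable_funD; apply: measurable_funM.
  - by apply: measurable_funB => //; exact: measurable_reject.
  - by apply: measurableT_comp => //; exact: measurable_proposal.
  - exact: measurable_reject.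
  - exact: measurableT_comp.
have sn0 : (s != 0)%R by rewrite gt_eqF.
have inv : \int[pi]_y J y = \int[pi]_y (E y)%:E.
  have mEE : measurable_fun setT (EFin \o E) by exact/measurable_EFinP.
  exact: (pcn_invariant mU C_ge0 piE ks sn0 mEE (fun x => E_ge0 x)).
have Jle y : J y + (h * enorm (gU y + y) ^+ 2)%:E <=
    (E y + ((LU + 1) * h * n%:R + h * s * C3 * (1 + enorm y ^+ 2) ^+ 2))%:E.
  have := potential_bound U_taylor U_lip gU_le B_ge0 LU_ge0 mU h0 s0 s1 sE k0 k2 kh
    y mE E_ge0 E_le.
  rewrite -/(J y) -/C3 => Jy; rewrite -leeBrDr// -EFinB.
  by apply: le_trans Jy _; rewrite lee_fin; lra.
have hg0 y : (0 <= h * enorm (gU y + y) ^+ 2)%R by rewrite mulr_ge0 ?sqr_ge0 ?ltW.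
have hsC0 : (0 <= h * s * C3)%R.
  by apply: mulr_ge0 => //; apply: mulr_ge0; exact: ltW.
have cY0 (y : V) : (0 <= h * s * C3 * (1 + enorm y ^+ 2) ^+ 2)%R.
  exact: mulr_ge0 hsC0 (sqr_ge0 _).
have c0 : (0 <= (LU + 1) * h * n%:R)%R by rewrite !mulr_ge0 ?addr_ge0// ltW.
have mcY : measurable_fun setT (fun y : V => h * s * C3 * (1 + enorm y ^+ 2) ^+ 2)%R.
  exact: measurable_funM.
have mhg : measurable_fun setT (fun y : V => (h * enorm (gU y + y) ^+ 2)%:E : \bar R).
  by apply/measurable_EFinP; exact: measurable_funM.
have : \int[pi]_y (J y + (h * enorm (gU y + y) ^+ 2)%:E) <= \int[pi]_y
   (E y + ((LU + 1) * h * n%:R + h * s * C3 * (1 + enorm y ^+ 2) ^+ 2))%:E.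
  apply: ge0_le_integralT => //.
  - exact: emeasurable_funD.
  - by move=> y; rewrite adde_ge0// lee_fin.
  - apply/measurable_EFinP; apply: measurable_funD => //.
    exact: measurable_funD.
rewrite (ge0_integralDT pi mJ J0 mhg) ?inv; last by move=> y; rewrite lee_fin.
have mcc : measurable_fun setT (fun y : V =>
    (LU + 1) * h * n%:R + h * s * C3 * (1 + enorm y ^+ 2) ^+ 2)%R.
  exact: measurable_funD.
have cc0 (y : V) : (0 <= (LU + 1) * h * n%:R + h * s * C3 * (1 + enorm y ^+ 2) ^+ 2)%R.
  by rewrite addr_ge0.
rewrite (ge0_integralDR pi mE E_ge0 mcc cc0).
have -> : \int[pi]_y ((LU + 1) * h * n%:R + h * s * C3 * (1 + enorm y ^+ 2) ^+ 2)%:E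
    = ((LU + 1) * h * n%:R)%:E + (h * s * C3)%:E * \int[pi]_y ((1 + enorm y ^+ 2) ^+ 2)%:E.
  rewrite (ge0_integralDR pi (a := cst ((LU + 1) * h * n%:R)%R) (measurable_cst _) (fun=> c0) mcY cY0).
  rewrite (ge0_integralZR pi hsC0 mY2 (fun y => sqr_ge0 _)); congr (_ + _).
  rewrite -[RHS](integral_probability_cst pi); exact: eq_integral.
rewrite (ge0_integralZR pi (ltW h0) mg (fun y => sqr_ge0 _)).
have fin : \int[pi]_y (E y)%:E \is a fin_num.
  by rewrite ge0_fin_numE// integral_ge0// => y _; rewrite lee_fin.
rewrite leeD2lE// => H.
have H2 : h%:E * \int[pi]_y (enorm (gU y + y) ^+ 2)%:E <=
    h%:E * ((LU + 1) * n%:R + s * (C3 * kap))%:E.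
  apply: le_trans H _.
  rewrite (_ : (h%:E * _)%E = ((LU + 1) * h * n%:R)%:E + (h * s * C3)%:E * kap%:E).
    by rewrite leeD2l// lee_wpmul2l ?lee_fin// integral_pi_sqr_le.
  by rewrite -!EFinM -EFinD; congr EFin; ring.
by move: H2; rewrite lee_pmul2l// lte_fin.
Qed.

(** The integral does not involve the chain, so [s] may tend to 0 and the remainder disappears. *)
Lemma integral_gradient_sqr_le :
  \int[pi]_y (enorm (gU y + y) ^+ 2)%:E <= ((LU + 1) * n%:R)%:E.
Proof.
set C4 := ((2 * (LU + 1) + Cstep B LU * m4 n * (B + 1)) * kap)%R.
have C40 : (0 <= C4)%R.
  rewrite /C4 mulr_ge0//; last exact: le_trans kap_ge1.
  apply: addr_ge0; first by rewrite mulr_ge0 ?addr_ge0.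
  by rewrite !mulr_ge0 ?Cstep_ge0 ?m4_ge0 ?addr_ge0.
apply/lee_addgt0Pr => e e0.
pose s : R := Num.min 1%R (e / (C4 + 1))%R.
have C41 : (0 < C4 + 1)%R by rewrite ltr_wpDl.
have s0 : (0 < s)%R by rewrite lt_min ltr01 divr_gt0.
have s1 : (s <= 1)%R by rewrite ge_min lexx.
apply: le_trans (gradient_sqr_le_step s0 s1) _; rewrite -EFinD lee_fin lerD2l -/C4.
have : (s <= e / (C4 + 1))%R by rewrite ge_min lexx orbT.
rewrite ler_pdivlMr// => se; apply: le_trans se.
by apply: ler_wpM2l; [exact: ltW|rewrite lerDl].
Qed.

End gradient.

End target_moments.

(** * Coupled chains *)

Section image_probability.
Context {d d'} {T : measurableType d} {T' : measurableType d'} {R : realType}.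
Local Open Scope ereal_scope.

Lemma image_probability (P : probability T R) (f : T -> T') : measurable_fun setT f ->
  exists Q : probability T' R, forall h : T' -> \bar R,
    measurable_fun setT h -> (forall x, 0 <= h x) ->
    \int[Q]_x h x = \int[P]_x h (f x).
Proof.
move=> mf; pose X : {mfun T >-> T'} := HB.pack f (isMeasurableFun.Build _ _ _ _ f mf).
by exists (distribution P X) => h mh h0; rewrite ge0_integral_distribution.
Qed.

End image_probability.

Section mixture.
Context {R : realType}.
Local Open Scope ereal_scope.
Notation RR := (measurableTypeR R).

Let unif : probability RR R := uniform_prob (@ltr01 R).

Let uniform_lt (r : R) : (0 <= r <= 1)%R -> unif [set u | (u < r)%R] = r%:E.
Proof.
move=> /andP[r0 r1].
rewrite /unif/= /uniform_prob integral_uniform_pdf.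
rewrite (_ : _ `&` _ = `[0%R, r[%classic :> set RR); last first.
  apply/seteqP; split=> u /=; rewrite !in_itv/=.
    by move=> [ur /andP[-> _]].
  by move=> /andP[u0 ur]; rewrite ur u0 (ltW (lt_le_trans ur r1)).
transitivity (\int[@lebesgue_measure R]_(x in (`[0%R, r[%classic : set RR)) 1%:E).
  apply: eq_integral => x; rewrite inE/= in_itv/= => /andP[x0 xr].
  by rewrite /uniform_pdf x0 (ltW (lt_le_trans xr r1)) subr0 invr1.
rewrite integral_cst; last exact: measurable_itv.
rewrite mul1e [LHS](lebesgue_measure_itv `[0%R, r[)/= lte_fin.
by case: ltP => [_|r0']; rewrite ?oppr0 ?adde0//; congr EFin; apply/le_anti; rewrite r0 r0'.
Qed.

Let integral_uniform_if (r : R) (x y : \bar R) : (0 <= r <= 1)%R -> 0 <= x -> 0 <= y ->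
  \int[unif]_u (if (u < r)%R then y else x) = (1 - r)%:E * x + r%:E * y.
Proof.
move=> r01 x0 y0; have mr : measurable [set u : RR | (u < r)%R].
  rewrite (_ : mkset _ = `]-oo, r[%classic); first exact: measurable_itv.
  by apply/seteqP; split=> u /=; rewrite in_itv.
rewrite -(setUv [set u : RR | (u < r)%R]) ge0_integral_setU//=.
- rewrite addeC; congr (_ + _).
    rewrite (eq_integral (cst x)); last first.
      by move=> u; rewrite inE/= => /negP/negbTE ->.
    rewrite integral_cst//; last exact: measurableC.
    rewrite [X in x * X](probability_setC unif mr) [X in 1 - X](uniform_lt r01).
    by rewrite muleC -EFinB.
  rewrite (eq_integral (cst y)); last by move=> u; rewrite inE/= => ->.
  by rewrite integral_cst// [X in y * X](uniform_lt r01) muleC.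
- exact: measurableC.
- rewrite setUv; apply: measurable_fun_ifT => //.
  exact: measurable_fun_ltr.
- by move=> u _; case: ifP.
- by apply/disj_setPS => u [].
Qed.

(** A uniform variable, independent of the rest, is the coin that decides between [a] and [b]; [Q]
    is the image law. *)
Lemma mixture_step d d1 d2 (S : measurableType d) (V : measurableType d1)
    (S' : measurableType d2) (M : probability S R) (P : probability V R)
    (a b : S -> V -> S') (r : S -> V -> R) :
  measurable_fun setT (fun w : S * V => a w.1 w.2) ->
  measurable_fun setT (fun w : S * V => b w.1 w.2) ->
  measurable_fun setT (fun w : S * V => r w.1 w.2) ->
  (forall s z, 0 <= r s z <= 1)%R ->
  exists Q : probability S' R, forall h : S' -> \bar R,
    measurable_fun setT h -> (forall x, 0 <= h x) ->
    \int[Q]_x h x =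
    \int[M]_s \int[P]_z ((1 - r s z)%:E * h (a s z) + (r s z)%:E * h (b s z)).
Proof.
move=> ma mb mr r01.
pose f (w : S * V * RR) := if (w.2 < r w.1.1 w.1.2)%R then b w.1.1 w.1.2 else a w.1.1 w.1.2.
have m1 : measurable_fun setT (fun w : S * V * RR => w.1) by exact: measurable_fst.
have mf : measurable_fun setT f.
  apply: measurable_fun_ifT.
  - by apply: measurable_fun_ltr => //; exact: (measurableT_comp mr m1).
  - exact: (measurableT_comp mb m1).
  - exact: (measurableT_comp ma m1).
have [Q QE] := image_probability ((M \x P) \x unif) mf.
exists Q => h mh h0; rewrite QE//.
have mhf : measurable_fun setT (h \o f) by exact: measurableT_comp.
have hf0 x : 0 <= (h \o f) x by exact: h0.
transitivity (\int[M \x P]_w \int[unif]_u h (f (w, u))).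
  exact: (fubini_tonelli1 (h \o f) mhf hf0).
transitivity (\int[M \x P]_w ((1 - r w.1 w.2)%:E * h (a w.1 w.2)
    + (r w.1 w.2)%:E * h (b w.1 w.2))).
  apply: eq_integral => w _; rewrite -integral_uniform_if//.
  by apply: eq_integral => u _; rewrite /f/=; case: ifP.
apply: (fubini_tonelli1 (fun w => (1 - r w.1 w.2)%:E * h (a w.1 w.2)
    + (r w.1 w.2)%:E * h (b w.1 w.2))).
  apply: emeasurable_funD; apply: emeasurable_funM.
  - by apply/measurable_EFinP; exact: measurable_funB.
  - exact: measurableT_comp.
  - exact/measurable_EFinP.
  - exact: measurableT_comp.
move=> w; have /andP[r0 r1] := r01 w.1 w.2.
by rewrite adde_ge0// mule_ge0// lee_fin// subr_ge0.
Qed.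

End mixture.

(** * Minkowski's inequality for second moments *)

Section minkowski.
Context {d} {T : measurableType d} {R : realType} (M : probability T R).
Local Open Scope ereal_scope.
Implicit Types (u v : T -> R) (a b : R).

(** Stated on squares with a real radius, so that finiteness is included and no root of an extended
    real is taken. *)
Definition L2_le u a := \int[M]_x (u x ^+ 2)%:E <= (a ^+ 2)%:E.

(** The optimal parameter is [t = b / a]; when [a] or [b] is 0 the optimum is only approached, as
    [t] tends to infinity or to 0, and a margin [e] is allowed. *)
Let young_limit (I : \bar R) a b : (0 <= a)%R -> (0 <= b)%R ->
  (forall t, (0 < t)%R -> I <= ((1 + t) * a ^+ 2 + (1 + t^-1) * b ^+ 2)%:E) ->
  I <= ((a + b) ^+ 2)%:E.
Proof.
move=> a0 b0 It.
have [a_0|an0] := eqVneq a 0%R.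
  rewrite a_0 add0r; apply/lee_addgt0Pr => e e0.
  pose t := ((b ^+ 2 + 1) / e)%R.
  have b21 : (0 < b ^+ 2 + 1)%R by rewrite ltr_wpDl ?sqr_ge0.
  have t0 : (0 < t)%R by rewrite divr_gt0.
  apply: le_trans (It t t0) _; rewrite -EFinD lee_fin a_0 expr0n/= mulr0 add0r.
  rewrite mulrDl mul1r lerD2l /t invf_div mulrAC ler_pdivrMr//.
  by apply: ler_wpM2l; [exact: ltW|rewrite lerDl].
have [b_0|bn0] := eqVneq b 0%R.
  rewrite b_0 addr0; apply/lee_addgt0Pr => e e0.
  pose t := (e / (a ^+ 2 + 1))%R.
  have a21 : (0 < a ^+ 2 + 1)%R by rewrite ltr_wpDl ?sqr_ge0.
  have t0 : (0 < t)%R by rewrite divr_gt0.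
  apply: le_trans (It t t0) _; rewrite -EFinD lee_fin b_0 expr0n/= mulr0 addr0.
  rewrite mulrDl mul1r lerD2l /t mulrAC ler_pdivrMr//.
  by apply: ler_wpM2l; [exact: ltW|rewrite lerDl].
have a_gt0 : (0 < a)%R by rewrite lt_neqAle eq_sym an0.
have b_gt0 : (0 < b)%R by rewrite lt_neqAle eq_sym bn0.
apply: le_trans (It (b / a)%R _) _; first by rewrite divr_gt0.
by rewrite lee_fin le_eqVlt; apply/orP; left; apply/eqP; field; rewrite an0 bn0.
Qed.

Lemma L2_leD u v a b : measurable_fun setT u -> measurable_fun setT v ->
  (0 <= a)%R -> (0 <= b)%R -> L2_le u a -> L2_le v b ->
  L2_le (fun x => u x + v x)%R (a + b)%R.
Proof.
move=> mu mv a0 b0 ua vb; apply: young_limit => // t t0.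
have t10 : (0 <= 1 + t)%R by rewrite addr_ge0// ltW.
have ti10 : (0 <= 1 + t^-1)%R by rewrite addr_ge0// invr_ge0 ltW.
have mu2 : measurable_fun setT (fun x => u x ^+ 2)%R by exact: measurable_funX.
have mv2 : measurable_fun setT (fun x => v x ^+ 2)%R by exact: measurable_funX.
apply: (@le_trans _ _ (\int[M]_x ((1 + t) * u x ^+ 2 + (1 + t^-1) * v x ^+ 2)%:E)).
  apply: ge0_le_integralR.
  - by apply: measurable_funX; exact: measurable_funD.
  - by move=> x; exact: sqr_ge0.
  - by apply: measurable_funD; exact: measurable_funM.
  - move=> x; rewrite -subr_ge0.
    rewrite (_ : _ - _ = t^-1 * (t * u x - v x) ^+ 2)%R; last by field; rewrite gt_eqF.
    by rewrite mulr_ge0 ?sqr_ge0// invr_ge0 ltW.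
rewrite ge0_integralDR; last 4 first.
- exact: measurable_funM.
- by move=> x; rewrite mulr_ge0 ?sqr_ge0.
- exact: measurable_funM.
- by move=> x; rewrite mulr_ge0 ?sqr_ge0.
rewrite (ge0_integralZR M t10 mu2 (fun x => sqr_ge0 _)).
rewrite (ge0_integralZR M ti10 mv2 (fun x => sqr_ge0 _)).
by rewrite [leRHS]EFinD; apply: leeD; rewrite [leRHS]EFinM lee_wpmul2l// lee_fin.
Qed.

Lemma L2_le_mono u v a : measurable_fun setT u -> measurable_fun setT v ->
  (forall x, 0 <= u x <= v x)%R -> L2_le v a -> L2_le u a.
Proof.
move=> mu mv uv; apply: le_trans; apply: ge0_le_integralR.
- exact: measurable_funX.
- by move=> x; exact: sqr_ge0.
- exact: measurable_funX.
- move=> x; have /andP[u0 uvx] := uv x.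
  by rewrite ler_sqr// nnegrE// (le_trans u0).
Qed.

Lemma L2_leZ u a c : measurable_fun setT u -> L2_le u a ->
  L2_le (fun x => c * u x)%R (c * a)%R.
Proof.
move=> mu ua; rewrite /L2_le; under eq_integral do rewrite exprMn.
have mu2 : measurable_fun setT (fun x => u x ^+ 2)%R by exact: measurable_funX.
rewrite (ge0_integralZR M (sqr_ge0 c) mu2 (fun x => sqr_ge0 _)).
by rewrite exprMn [leRHS]EFinM; apply: lee_wpmul2l => //; rewrite lee_fin sqr_ge0.
Qed.

End minkowski.

Section recursions.
Context {R : realType}.
Implicit Types (X v : R).

(** Bookkeeping for bias and variance: [v], added to the square at each move, is absorbed under the
    root, while the bias [X] stays outside it. *)
Lemma sqrt_recursion X v i : 0 <= X -> 0 <= v ->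
  (X + Num.sqrt (i%:R * v)) ^+ 2 + v <= (X + Num.sqrt (i.+1%:R * v)) ^+ 2.
Proof.
move=> X0 v0; have p2 : Num.sqrt (i%:R * v) ^+ 2 = i%:R * v by rewrite sqr_sqrtr ?mulr_ge0.
have q2 : Num.sqrt (i.+1%:R * v) ^+ 2 = i.+1%:R * v by rewrite sqr_sqrtr ?mulr_ge0.
have pq : Num.sqrt (i%:R * v) <= Num.sqrt (i.+1%:R * v).
  by rewrite ler_wsqrtr// ler_wpM2r// ler_nat.
move: p2 q2 pq; move: (Num.sqrt (i%:R * v)) (Num.sqrt (i.+1%:R * v)) => p q.
rewrite -natr1 mulrDl mul1r => p2 q2 pq; rewrite !sqrrD p2 q2.
by have := ler_wpM2l X0 pq; lra.
Qed.

End recursions.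

Section coupled_chain.
Context {R : realType} {n : nat} (U : 'rV[R]_n -> R) (gU : 'rV[R]_n -> 'rV[R]_n).
Variables (B LU C G : R) (pi : probability 'rV[R]_n R).
Variable xi : probability ('rV[R]_n * 'rV[R]_n)%type R.
Local Open Scope ereal_scope.
Notation V := ('rV[R]_n).
Notation gam := (gaussian (R := R) (n := n)).
Hypotheses
  (U_taylor : forall x v, (`|U (x + v) - U x - dotv (gU x) v| <= LU / 2 * enorm v ^+ 2)%R)
  (U_lip : forall x v, (`|U (x + v) - U x| <= B * enorm v)%R)
  (gU_le : forall x, (enorm (gU x) <= B)%R) (B_ge0 : (0 <= B)%R) (LU_ge0 : (0 <= LU)%R)
  (gU_lip : forall x y, (enorm (gU x - gU y) <= LU * enorm (x - y))%R)
  (mU : measurable_fun setT U) (mgU : measurable_fun setT gU)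
  (U_ge0 : forall x, (0 <= U x)%R) (C_ge0 : (0 <= C)%R)
  (piE : forall f : V -> \bar R, measurable_fun setT f -> (forall x, 0 <= f x) ->
     \int[pi]_x f x = \int[gam]_x (f x * (C * expR (- U x))%:E))
  (G_ge0 : (0 <= G)%R)
  (G_le : \int[pi]_y (enorm (gU y + y) ^+ 2)%:E <= (G ^+ 2)%:E)
  (xiE : forall f : V -> \bar R, measurable_fun setT f -> (forall x, 0 <= f x) ->
     \int[xi]_p f p.2 = \int[pi]_x f x).
Variable s : R.
Hypotheses (s_gt0 : (0 < s)%R) (s_le1 : (s <= 1)%R).

Let h : R := (s ^+ 2 / 2)%R.
Let k : R := contraction_of s.
Let gV y := (gU y + y)%R.
Let b := bstep B LU h s (n := n).

(** Bounds under [pi] both the mean and the root mean square of [bstep]; [kap >= 1] lets one number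
    serve for both. *)
Definition step_error : R := (h * s * (Cstep B LU * m4 n) * kap C (n := n))%R.
Let eta := step_error.

Let h_gt0 : (0 < h)%R. Proof. by have [] := step_parametersP s_gt0 s_le1. Qed.
Let sE : (s ^+ 2 = 2 * h)%R. Proof. by have [] := step_parametersP s_gt0 s_le1. Qed.
Let ksE : ((1 - k) ^+ 2 + s ^+ 2 = 1)%R.
Proof. by have [] := step_parametersP s_gt0 s_le1. Qed.
Let k_ge0 : (0 <= k)%R. Proof. by have [_ _ _ []] := step_parametersP s_gt0 s_le1. Qed.
Let k_le : (k <= 2 * h)%R. Proof. by have [_ _ _ []] := step_parametersP s_gt0 s_le1. Qed.
Let kh : (`|h - k| <= 2 * h ^+ 2)%R.
Proof. by have [] := step_parametersP s_gt0 s_le1. Qed.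
Let s_neq0 : (s != 0)%R. Proof. exact: lt0r_neq0. Qed.

Let kap1 : (1 <= kap C (n := n))%R. Proof. exact: (kap_ge1 mU U_ge0 C_ge0 piE). Qed.

Let c0 : (0 <= h * s * (Cstep B LU * m4 n))%R.
Proof.
apply: mulr_ge0; apply: mulr_ge0; [exact: ltW|exact: ltW| |exact: m4_ge0].
exact: Cstep_ge0.
Qed.

Lemma step_error_ge0 : (0 <= step_error)%R.
Proof. by apply: mulr_ge0 => //; exact: le_trans kap1. Qed.
Let eta_ge0 := step_error_ge0.

Let mY : measurable_fun setT (fun y : V => 1 + enorm y ^+ 2)%R.
Proof. by apply: measurable_funD => //; exact: measurable_enormX. Qed.

Let mb : measurable_fun setT b. Proof. exact: measurable_funM. Qed.
Let b_ge0 y : (0 <= b y)%R.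
Proof. by apply: mulr_ge0 => //; rewrite addr_ge0 ?sqr_ge0. Qed.

Let mgV : measurable_fun setT gV. Proof. exact: measurable_addrV. Qed.

Let pi_b : \int[pi]_y (b y)%:E <= eta%:E.
Proof.
rewrite (ge0_integralZR pi c0 mY); last by move=> y; rewrite addr_ge0 ?sqr_ge0.
rewrite /eta /step_error [leRHS]EFinM; apply: lee_wpmul2l; first by rewrite lee_fin.
apply: le_trans (integral_pi_sqr_le mU U_ge0 C_ge0 piE).
apply: ge0_le_integralR => //; first by move=> y; rewrite addr_ge0 ?sqr_ge0.
  exact: measurable_funX.
by move=> y; rewrite expr2 ler_peMr ?lerDl ?sqr_ge0// addr_ge0 ?sqr_ge0.
Qed.

Let pi_b2 : \int[pi]_y (b y ^+ 2)%:E <= (eta ^+ 2)%:E.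
Proof.
under eq_integral do rewrite exprMn.
have mY2 : measurable_fun setT (fun y : V => (1 + enorm y ^+ 2) ^+ 2)%R by exact: measurable_funX.
rewrite (ge0_integralZR pi (sqr_ge0 _) mY2 (fun y => sqr_ge0 _)).
rewrite (_ : eta ^+ 2 = (h * s * (Cstep B LU * m4 n)) ^+ 2 * kap C (n := n) ^+ 2)%R; last exact: exprMn.
rewrite [leRHS]EFinM; apply: lee_wpmul2l; first by rewrite lee_fin sqr_ge0.
apply: le_trans (integral_pi_sqr_le mU U_ge0 C_ge0 piE) _.
by rewrite lee_fin expr2 ler_peMr// (le_trans ler01).
Qed.

Section one_step.
Context {d} {S : measurableType d} (M : probability S R) (y : S -> V).
Hypotheses (my : measurable_fun setT y)
  (yE : forall f : V -> \bar R, measurable_fun setT f -> (forall x, 0 <= f x) ->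
     \int[M]_x f (y x) = \int[pi]_x f x).

Let mby : measurable_fun setT (fun x => b (y x)). Proof. exact: measurableT_comp. Qed.

Lemma integral_step_le (u : S -> R) (a v : R) : measurable_fun setT u ->
  (forall x, 0 <= u x)%R -> (0 <= a)%R -> (0 <= v)%R -> L2_le M u a ->
  \int[M]_x ((u x + b (y x)) ^+ 2 + b (y x) + v)%:E <= ((a + eta) ^+ 2 + (eta + v))%:E.
Proof.
move=> mu u0 a0 v0 ua.
have m1 : measurable_fun setT (fun x => (u x + b (y x)) ^+ 2)%R.
  by apply: measurable_funX; exact: measurable_funD.
have bv0 x : (0 <= b (y x) + v)%R by rewrite addr_ge0.
have m2 : measurable_fun setT (fun x => b (y x) + v)%R by exact: measurable_funD.
under eq_integral do rewrite -addrA.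
rewrite (ge0_integralDR M m1 (fun x => sqr_ge0 _) m2 bv0) [leRHS]EFinD; apply: leeD.
  apply: L2_leD => //; rewrite /L2_le (yE (f := fun y => (b y ^+ 2)%:E))//.
    by apply/measurable_EFinP; exact: measurable_funX.
  by move=> x; rewrite lee_fin sqr_ge0.
rewrite (ge0_integralDR M mby (fun x => b_ge0 _) (measurable_cst v) (fun=> v0)) [leRHS]EFinD.
apply: leeD; last by rewrite -[leRHS](integral_probability_cst M); exact: lexx.
rewrite (yE (f := fun y => (b y)%:E))//; first exact/measurable_EFinP.
Qed.

Lemma L2_gradient : L2_le M (fun x => enorm (gV (y x))) G.
Proof.
rewrite /L2_le (yE (f := fun y => (enorm (gV y) ^+ 2)%:E))//.
  apply/measurable_EFinP; apply: measurable_funX; exact: measurable_enorm.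
by move=> x; rewrite lee_fin sqr_ge0.
Qed.

End one_step.

Let be : R := (h * G + eta)%R.
Let vv : R := (eta + 2 * h * n%:R)%R.
Let L : R := (LU + 1)%R.

(** The drift part grows linearly in the number of moves, the diffusive part like its square root;
    [vv] is the variance [2 h n] of one noise up to [eta]. *)
Definition displacement_radius i : R := (i%:R * be + Num.sqrt (i%:R * vv))%R.
Let rr := displacement_radius.

(** Each move costs [h L] times the current displacement, because the gradient at the start replaces
    the one at the current point; [eta] enters once linearly and once under the root. *)
Definition error_radius i : R :=
  (\sum_(j < i) (h * L * rr j + eta) + Num.sqrt (i%:R * eta))%R.
Let ee := error_radius.

Let h_ge0 : (0 <= h)%R. Proof. exact: ltW. Qed.
Let be_ge0 : (0 <= be)%R. Proof. by apply: addr_ge0 => //; exact: mulr_ge0. Qed.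
Let vv_ge0 : (0 <= vv)%R.
Proof. by apply: addr_ge0 => //; apply: mulr_ge0 => //; exact: mulr_ge0. Qed.
Let L_ge0 : (0 <= L)%R. Proof. exact: addr_ge0. Qed.
Let rr_ge0 i : (0 <= rr i)%R. Proof. by apply: addr_ge0; [exact: mulr_ge0|exact: sqrtr_ge0]. Qed.
Let hLr_ge0 i : (0 <= h * L * rr i + eta)%R.
Proof. by apply: addr_ge0 => //; apply: mulr_ge0 => //; exact: mulr_ge0. Qed.
Let ee_ge0 i : (0 <= ee i)%R.
Proof. by apply: addr_ge0; [exact: sumr_ge0|exact: sqrtr_ge0]. Qed.

Let gV_lip x y : (enorm (gV x - gV y) <= L * enorm (x - y))%R.
Proof.
rewrite /gV /L opprD addrACA mulrDl mul1r.
by apply: le_trans (ler_enormD _ _) _; rewrite lerD2r.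
Qed.

(** State of the chain: [x.1] is the initial pair (Langevin point, point of law [pi]), kept
    unchanged, [x.2.1] the current position of the Metropolis chain and [x.2.2] the sum of its
    scaled noises. *)
Let S := ((V * V) * (V * V))%type.

(** What remains of the displacement after removing the noise and the drift with the gradient frozen
    at the start. *)
Let deviation (i : nat) (x : S) : V :=
  (x.2.1 - x.1.2 - x.2.2 + (i%:R * h) *: gV x.1.2)%R.

(** The second property makes the accumulated noise Gaussian and independent of the initial pair,
    which is all that the first marginal of the next coupling requires. The displacement bound is
    carried along because each step of the deviation bound uses it. *)
Lemma coupled_chain (i : nat) : exists M : probability S R,
  [/\ forall f : V -> \bar R, measurable_fun setT f -> (forall x, 0 <= f x) ->
        \int[M]_x f x.2.1 = \int[pi]_x f x,
      forall f : V * V -> V -> \bar R, measurable_fun setT (fun w => f w.1 w.2) ->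
        (forall p w, 0 <= f p w) ->
        \int[M]_x f x.1 x.2.2 = \int[xi]_p \int[gam]_z f p ((Num.sqrt i%:R * s) *: z)%R,
      L2_le M (fun x => enorm (x.2.1 - x.1.2)) (displacement_radius i) &
      L2_le M (fun x => enorm (x.2.1 - x.1.2 - x.2.2 + (i%:R * (s ^+ 2 / 2)) *: (gU x.1.2 + x.1.2)))
        (error_radius i)].
Proof.
have m11 : measurable_fun setT (fun x : S => x.1.1) by exact: (measurableT_comp measurable_fst measurable_fst).
have m12 : measurable_fun setT (fun x : S => x.1.2) by exact: (measurableT_comp measurable_snd measurable_fst).
have m21 : measurable_fun setT (fun x : S => x.2.1) by exact: (measurableT_comp measurable_fst measurable_snd).
have m22 : measurable_fun setT (fun x : S => x.2.2) by exact: (measurableT_comp measurable_snd measurable_snd).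
elim: i => [|i [M [Ma Mb Mc Md]]].
  have mf : measurable_fun setT (fun p : V * V => (p, (p.2, 0%R : V)) : S).
    by apply/measurable_fun_pair => //=; apply/measurable_fun_pair.
  have [Q QE] := image_probability xi mf; exists Q; split.
  - by move=> f mF f0; rewrite QE//=; [exact: xiE|exact: measurableT_comp].
  - move=> f mF f0; rewrite QE//=; last first.
      by apply: measurable_fun_comp2 => //; exact: measurable_fst.
    apply: eq_integral => p _; under eq_integral do rewrite sqrtr0 mul0r scale0r.
    by rewrite (integral_probability_cst gam).
  - rewrite /L2_le QE /=; last by move=> x; rewrite lee_fin sqr_ge0.
      under eq_integral do rewrite subrr enorm0 expr0n.
      by rewrite (integral_probability_cst xi) lee_fin sqr_ge0.
    apply/measurable_EFinP; apply: measurable_funX; apply: measurable_enorm.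
    by apply: measurable_addrV => //; exact: measurable_opprV.
  - rewrite /L2_le QE /=; last by move=> x; rewrite lee_fin sqr_ge0.
      under eq_integral do rewrite mul0r scale0r subrr subr0 addr0 enorm0 expr0n.
      by rewrite (integral_probability_cst xi) lee_fin sqr_ge0.
    apply/measurable_EFinP; apply: measurable_funX; apply: measurable_enorm.
    apply: measurable_addrV; last by apply: measurable_scalerV => //; exact: measurable_addrV (measurableT_comp mgU m12) m12.
    apply: measurable_addrV; last exact: measurable_opprV.
    by apply: measurable_addrV => //; exact: measurable_opprV.
(* The noise is recorded whether or not the move is accepted; this keeps [x.2.2] Gaussian and
   independent of [x.1]. *)
pose acc (x : S) (z : V) : S := (x.1, (proposal k s x.2.1 z, x.2.2 + s *: z)%R).
pose rej (x : S) (z : V) : S := (x.1, (x.2.1, x.2.2 + s *: z)%R).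
pose r (x : S) (z : V) := reject U k s x.2.1 z.
have r0 x z : (0 <= r x z)%R := rejection_ge0 _.
have r1 x z : (0 <= 1 - r x z)%R by rewrite subr_ge0 rejection_le1.
have my1 : measurable_fun setT (fun w : S * V => w.1.2.1) by exact: (measurableT_comp m21 measurable_fst).
have mw1 : measurable_fun setT (fun w : S * V => (w.1.2.2 + s *: w.2)%R).
  apply: measurable_addrV; first exact: (measurableT_comp m22 measurable_fst).
  exact: measurable_scalerV.
have macc : measurable_fun setT (fun w : S * V => acc w.1 w.2).
  apply/measurable_fun_pair; first exact: (measurableT_comp measurable_fst measurable_fst).
  by apply/measurable_fun_pair => //; exact: measurable_proposal.
have mrej : measurable_fun setT (fun w : S * V => rej w.1 w.2).
  apply/measurable_fun_pair; first exact: (measurableT_comp measurable_fst measurable_fst).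
  exact/measurable_fun_pair.
have mr : measurable_fun setT (fun w : S * V => r w.1 w.2) by exact: measurable_reject.
have r01 x z : (0 <= r x z <= 1)%R by rewrite r0 -subr_ge0 r1.
have [Q QE] := mixture_step M gam macc mrej mr r01; exists Q.
have stepM (F : S -> R) : measurable_fun setT F -> (forall x, 0 <= F x)%R ->
    measurable_fun setT (fun x => \int[gam]_z ((1 - r x z) * F (acc x z) + r x z * F (rej x z))%:E).
  move=> mF F0; apply: (measurable_integral_prod gam); last first.
    by move=> x z; rewrite lee_fin addr_ge0// mulr_ge0.
  apply/measurable_EFinP; apply: measurable_funD; apply: measurable_funM => //.
  - exact: measurable_funB.
  - exact: measurableT_comp.
  - exact: measurableT_comp.
have stepE (F : S -> R) : measurable_fun setT F -> (forall x, 0 <= F x)%R ->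
    \int[Q]_x (F x)%:E =
    \int[M]_x \int[gam]_z ((1 - r x z) * F (acc x z) + r x z * F (rej x z))%:E.
  move=> mF F0; apply: (QE (EFin \o F)); first exact/measurable_EFinP.
  by move=> x; rewrite lee_fin.
have proposalE y z : proposal k s y z = (y - k *: y + s *: z)%R.
  by rewrite /proposal scalerBl scale1r.
split.
- move=> f mf f0; rewrite QE//=; last exact: measurableT_comp.
  pose f' y := \int[gam]_z ((1 - reject U k s y z)%:E * f (proposal k s y z)
     + (reject U k s y z)%:E * f y).
  have f'0 y : 0 <= f' y.
    by apply: integral_ge0 => z _; rewrite adde_ge0// mule_ge0// lee_fin ?subr_ge0 ?rejection_le1 ?rejection_ge0.
  have mf' : measurable_fun setT f'.
    apply: (measurable_integral_prod gam); last first.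
      by move=> y z; rewrite adde_ge0// mule_ge0// lee_fin ?subr_ge0 ?rejection_le1 ?rejection_ge0.
    have mrr : measurable_fun setT (fun w : V * V => reject U k s w.1 w.2) by exact: measurable_reject.
    apply: emeasurable_funD; apply: emeasurable_funM.
    + by apply/measurable_EFinP; exact: measurable_funB.
    + by apply: measurableT_comp => //; exact: measurable_proposal.
    + exact/measurable_EFinP.
    + exact: measurableT_comp.
  rewrite (Ma f' mf' f'0); exact: (pcn_invariant mU C_ge0 piE ksE s_neq0 mf f0).
- move=> f mf f0; rewrite QE//=; last first.
    by apply: measurable_fun_comp2 => //; exact: measurable_fst.
  pose f' p w := \int[gam]_z f p (w + s *: z)%R.
  have f'0 p w : 0 <= f' p w by exact: integral_ge0.
  have mf' : measurable_fun setT (fun w : V * V * V => f' w.1 w.2).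
    apply: (measurable_integral_prod gam) => //.
    apply: measurable_fun_comp2 => //; first exact: (measurableT_comp measurable_fst measurable_fst).
    apply: measurable_addrV; first exact: (measurableT_comp measurable_snd measurable_fst).
    exact: measurable_scalerV.
  transitivity (\int[M]_x f' x.1 x.2.2).
    apply: eq_integral => x _; apply: eq_integral => z _.
    by rewrite -ge0_muleDl ?lee_fin// -EFinD subrK mul1e.
  rewrite (Mb f' mf' f'0); apply: eq_integral => p _.
  pose rho : R := Num.sqrt i.+1%:R.
  have rho0 : (0 < rho)%R by rewrite sqrtr_gt0.
  have rhon0 : (rho != 0)%R by rewrite gt_eqF.
  (* A rotation merges the sum of [i] noises with the next one: its cosine is [sqrt (i / (i + 1))],
     its sine [1 / sqrt (i + 1)]. *)
  have cs : ((Num.sqrt i%:R / rho) ^+ 2 + (rho^-1) ^+ 2 = 1)%R.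
    rewrite expr_div_n exprVn !sqr_sqrtr// -[X in (_ + X)%R]mul1r -mulrDl natr1.
    by rewrite mulfV.
  have ri0 : (rho^-1 != 0)%R by rewrite invr_eq0.
  pose F (x z : V) := f p ((rho * s) *: x)%R.
  have mF : measurable_fun setT (fun w : V * V => F w.1 w.2).
    apply: (measurable_fun_comp2 (F := f) (u := fun=> p) (v := fun w : V * V => ((rho * s) *: w.1)%R)) => //.
    by apply: measurable_scalerV => //; exact: measurable_fst.
  have F0 x z : 0 <= F x z by exact: f0.
  transitivity (\int[gam]_x \int[gam]_z F ((Num.sqrt i%:R / rho) *: x + rho^-1 *: z)%R
      (rho^-1 *: x - (Num.sqrt i%:R / rho) *: z)%R).
    apply: eq_integral => x _; apply: eq_integral => z _; rewrite /F.
    by congr f; apply: dotv_ext => v; rewrite !dotvE; field.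
  rewrite (gaussian_rotation cs ri0 mF F0); apply: eq_integral => x _.
  by rewrite (integral_probability_cst gam).
- have mv : measurable_fun setT (fun x : S => x.2.1 - x.1.2)%R.
    by apply: measurable_addrV => //; exact: measurable_opprV.
  have mF : measurable_fun setT (fun x : S => (enorm (x.2.1 - x.1.2) ^+ 2)%R).
    by apply: measurable_funX; exact: measurable_enorm.
  have mg1 : measurable_fun setT (fun x : S => gV x.2.1) by exact: measurableT_comp.
  (* Displacement after a deterministic gradient step; noise and rejections are left to
     [displacement_bound]. *)
  pose A (x : S) := (x.2.1 - x.1.2 - h *: gV x.2.1)%R.
  have mA : measurable_fun setT (fun x => enorm (A x)).
    apply: measurable_enorm; apply: measurable_addrV => //; apply: measurable_opprV.
    exact: measurable_scalerV.
  have mgn : measurable_fun setT (fun x : S => h * enorm (gV x.2.1))%R.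
    by apply: measurable_funM => //; exact: measurable_enorm.
  have AL : L2_le M (fun x => enorm (A x)) (rr i + h * G)%R.
    apply: (@L2_le_mono _ _ _ _ _ (fun x : S => enorm (x.2.1 - x.1.2) + h * enorm (gV x.2.1))%R) => //.
    - by apply: measurable_funD => //; exact: measurable_enorm.
    - move=> x; rewrite enorm_ge0/=; apply: le_trans (ler_enormB _ _) _.
      by rewrite enormZ ger0_norm.
    - apply: L2_leD => //; [exact: measurable_enorm|exact: mulr_ge0|].
      by apply: L2_leZ; [exact: measurable_enorm|exact: L2_gradient].
  rewrite /L2_le (stepE _ mF (fun x => sqr_ge0 _)) /acc /rej/=.
  apply: (@le_trans _ _ (\int[M]_x ((enorm (A x) + b x.2.1) ^+ 2 + b x.2.1 + 2 * h * n%:R)%:E)).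
    apply: ge0_le_integralT.
    - exact: (stepM _ mF (fun x => sqr_ge0 _)).
    - by move=> x; apply: integral_ge0 => z _; rewrite lee_fin addr_ge0// mulr_ge0 ?sqr_ge0.
    - apply/measurable_EFinP; apply: measurable_funD => //; apply: measurable_funD.
        by apply: measurable_funX; apply: measurable_funD => //; exact: measurableT_comp.
      exact: measurableT_comp.
    - move=> x; have := displacement_bound U_taylor U_lip gU_le B_ge0 LU_ge0 mU h_gt0 s_gt0
        s_le1 sE k_ge0 k_le kh x.2.1 (x.2.1 - x.1.2)%R.
      apply: le_trans; rewrite le_eqVlt; apply/orP; left; apply/eqP.
      apply: eq_integral => z _; rewrite /r proposalE.
      congr (_ * enorm _ ^+ 2 + _)%:E.
      by apply: dotv_ext => v; rewrite !dotvE; ring.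
  apply: le_trans (integral_step_le m21 Ma mA (fun x => enorm_ge0 _) _ _ AL) _.
  + by apply: addr_ge0 => //; exact: mulr_ge0.
  + by apply: mulr_ge0 => //; exact: mulr_ge0.
  rewrite lee_fin -/vv -addrA -/be /rr /displacement_radius.
  rewrite addrAC -{2}(mul1r be) -mulrDl natr1.
  by apply: sqrt_recursion => //; exact: mulr_ge0.
- pose dv (x : S) := deviation i x.
  have mg1 : measurable_fun setT (fun x : S => gV x.2.1) by exact: measurableT_comp.
  have mg0 : measurable_fun setT (fun x : S => gV x.1.2) by exact: measurableT_comp.
  have mdev j : measurable_fun setT (deviation j).
    apply: measurable_addrV; last by exact: measurable_scalerV.
    apply: measurable_addrV; last exact: measurable_opprV.
    by apply: measurable_addrV => //; exact: measurable_opprV.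
  have mF : measurable_fun setT (fun x : S => (enorm (deviation i.+1 x) ^+ 2)%R).
    by apply: measurable_funX; exact: measurable_enorm.
  have mv : measurable_fun setT (fun x : S => enorm (x.2.1 - x.1.2))%R.
    by apply: measurable_enorm; apply: measurable_addrV => //; exact: measurable_opprV.
  (* One more frozen drift is added and the drift at the current position removed: [increment_bound]
     restores the latter. *)
  pose A (x : S) := (deviation i x + h *: gV x.1.2 - h *: gV x.2.1)%R.
  have mA : measurable_fun setT (fun x => enorm (A x)).
    apply: measurable_enorm; apply: measurable_addrV.
      by apply: measurable_addrV => //; exact: measurable_scalerV.
    by apply: measurable_opprV; exact: measurable_scalerV.
  have hL0 : (0 <= h * L)%R by exact: mulr_ge0.
  have mhL : measurable_fun setT (fun x : S => h * L * enorm (x.2.1 - x.1.2))%R.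
    exact: measurable_funM.
  have AL : L2_le M (fun x => enorm (A x)) (ee i + h * L * rr i)%R.
    apply: (@L2_le_mono _ _ _ _ _ (fun x : S => enorm (deviation i x) + h * L * enorm (x.2.1 - x.1.2))%R) => //.
    - by apply: measurable_funD => //; exact: measurable_enorm.
    - move=> x; rewrite enorm_ge0/= /A -addrA -scalerBr; apply: le_trans (ler_enormD _ _) _.
      rewrite lerD2l enormZ ger0_norm// -mulrA; apply: ler_wpM2l => //.
      by rewrite enormBC; exact: gV_lip.
    - apply: L2_leD => //; [exact: measurable_enorm|exact: mulr_ge0|].
      exact: L2_leZ.
  rewrite /L2_le (stepE _ mF (fun x => sqr_ge0 _)) /acc /rej/=.
  apply: (@le_trans _ _ (\int[M]_x ((enorm (A x) + b x.2.1) ^+ 2 + b x.2.1 + 0)%:E)).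
    apply: ge0_le_integralT.
    - exact: (stepM _ mF (fun x => sqr_ge0 _)).
    - by move=> x; apply: integral_ge0 => z _; rewrite lee_fin addr_ge0// mulr_ge0 ?sqr_ge0.
    - apply/measurable_EFinP; apply: measurable_funD => //; apply: measurable_funD.
        by apply: measurable_funX; apply: measurable_funD => //; exact: measurableT_comp.
      exact: measurableT_comp.
    - move=> x; rewrite addr0; have := increment_bound U_taylor U_lip gU_le B_ge0 LU_ge0 mU h_gt0 s_gt0
        s_le1 sE k_ge0 k_le kh x.2.1 (A x).
      apply: le_trans; rewrite le_eqVlt; apply/orP; left; apply/eqP.
      apply: eq_integral => z _; rewrite /r proposalE; congr EFin.
      congr (_ * _ ^+ 2 + _ * _ ^+ 2)%R; congr enorm.
        apply: dotv_ext => v; rewrite /A /deviation/= -natr1 /gV !dotvE; ring.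
      apply: dotv_ext => v; rewrite /A /deviation/= -natr1 /gV !dotvE; ring.
  apply: le_trans (integral_step_le m21 Ma mA (fun x => enorm_ge0 _) _ _ AL) _ => //.
    by apply: addr_ge0 => //; exact: mulr_ge0.
  rewrite lee_fin addr0 (_ : ee i + h * L * rr i + eta =
    \sum_(j < i) (h * L * rr j + eta) + (h * L * rr i + eta) + Num.sqrt (i%:R * eta))%R.
    rewrite /error_radius big_ord_recr/=; apply: sqrt_recursion => //.
    by apply: addr_ge0 => //; exact: sumr_ge0.
  by rewrite /ee /error_radius; ring.
Qed.

End coupled_chain.

(** * Numerical estimate of the error radius and choice of the fine step *)

Section radius_estimate.
Context {R : realType}.

Lemma sum_natr_le N : \sum_(j < N) (j%:R : R) <= N%:R ^+ 2 / 2.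
Proof.
elim: N => [|N IHN]; first by rewrite big_ord0 expr0n mul0r.
rewrite big_ord_recr/= -natr1 sqrrD; lra.
Qed.

(* sqrt (j v) = sqrt (j / N) sqrt (N v), and sqrt x <= (x + 1 / 2) / sqrt 2 is the
   tangent of the square root at 1 / 2, the mean of the j / N. *)
Lemma sqrt_natr_le N j (v : R) : (0 < N)%N -> 0 <= v ->
  Num.sqrt (j%:R * v) <= Num.sqrt (N%:R * v) *
    (Num.sqrt 2 / 2 * (j%:R / N%:R) + Num.sqrt 2 / 4).
Proof.
move=> N0 v0; have N_gt0 : 0 < N%:R :> R by rewrite ltr0n.
have q2 : Num.sqrt 2 ^+ 2 = 2 :> R by rewrite sqr_sqrtr.
have q0 : 0 <= Num.sqrt 2 :> R by exact: sqrtr_ge0.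
move: (Num.sqrt 2) q2 q0 => q q2 q0.
set x := j%:R / N%:R; have x0 : 0 <= x by rewrite divr_ge0.
have c0 : 0 <= q / 2 * x + q / 4 by rewrite addr_ge0 ?mulr_ge0.
rewrite -(@ler_sqr R) ?nnegrE ?mulr_ge0 ?sqrtr_ge0//.
rewrite exprMn !sqr_sqrtr ?mulr_ge0//.
rewrite (_ : j%:R * v = N%:R * v * x); last by rewrite /x; field; rewrite gt_eqF.
apply: ler_wpM2l; first by rewrite mulr_ge0.
rewrite (_ : (q / 2 * x + q / 4) ^+ 2 = q ^+ 2 / 4 * (x + 2^-1) ^+ 2); last by field.
by rewrite q2; have := sqr_ge0 (x - 2^-1); rewrite sqrrB sqrrD; lra.
Qed.

(** Both parts become sums of [j], bounded by [N^2 / 2]; the tangent gives the factor [sqrt 2 / 2]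
    for the root term where the integral of the square root would give [2 / 3]. *)
Lemma radius_sum_le N (c be v eta : R) : (0 < N)%N -> 0 <= c -> 0 <= be -> 0 <= v ->
  \sum_(j < N) (c * (j%:R * be + Num.sqrt (j%:R * v)) + eta) <=
  c * (N%:R ^+ 2 / 2 * be + N%:R * Num.sqrt (N%:R * v) * (Num.sqrt 2 / 2)) + N%:R * eta.
Proof.
move=> N0 c0 be0 v0; have N_gt0 : 0 < N%:R :> R by rewrite ltr0n.
set q := Num.sqrt 2; set P := Num.sqrt (N%:R * v).
apply: (@le_trans _ _ (\sum_(j < N)
   (c * (be + P * (q / 2) / N%:R) * j%:R + (c * (P * (q / 4)) + eta)))).
  apply: ler_sum => j _; rewrite addrA lerD2r.
  have := ler_wpM2l c0 (sqrt_natr_le j N0 v0); rewrite -/P -/q; lra.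
rewrite big_split/= -mulr_sumr sumr_const card_ord -[X in _ + X <= _]mulr_natl.
have c1 : 0 <= c * (be + P * (q / 2) / N%:R).
  rewrite mulr_ge0// addr_ge0// divr_ge0// mulr_ge0 ?sqrtr_ge0// divr_ge0//.
  exact: sqrtr_ge0.
apply: le_trans (lerD (ler_wpM2l c1 (sum_natr_le N)) (lexx _)) _.
rewrite le_eqVlt; apply/orP; left; apply/eqP; field.
by rewrite gt_eqF.
Qed.

(** [w] collects what vanishes with [s]. In units of [L e sqrt (e n)] the diffusive part contributes
    1, the drift at most [sqrt 2 / 2 <= 0.71] because [e (LU + 1) <= 2], and the terms in [w] at
    most [1 / 10]; the total 1.81 is below 1.82. *)
Lemma error_radius_le n N (B LU C G L s e w : R) : (0 < n)%N -> (0 < N)%N ->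
  0 < s -> 0 <= B -> 0 <= LU -> 0 <= C -> LU + 1 <= L ->
  0 < e -> e * L <= 2 -> e = N%:R * (s ^+ 2 / 2) -> G = Num.sqrt ((LU + 1) * n%:R) ->
  0 <= w -> w <= 1 -> w ^+ 2 = N%:R * step_error B LU C s (n := n) ->
  w * (2 * (L * e) + 2) <= 10^-1 * (L * e * Num.sqrt (e * n%:R)) ->
  error_radius B LU C G s N (n := n) <= 182 / 100 * (L * e * Num.sqrt (e * n%:R)).
Proof.
move=> n0 N0 s0 B0 LU0 C0 LUL e0 eL eE GE w0 w1 wE wle.
have N_gt0 : 0 < N%:R :> R by rewrite ltr0n.
rewrite /error_radius -wE (_ : Num.sqrt (w ^+ 2) = w); last by rewrite sqrtr_sqr ger0_norm.
set h := s ^+ 2 / 2 in eE *; set eta := step_error _ _ _ _ in wE *.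
have h0 : 0 < h by rewrite divr_gt0 ?exprn_gt0.
have eta0 : 0 <= eta.
  by rewrite -(pmulr_rge0 _ N_gt0) -wE sqr_ge0.
set l := LU + 1 in LUL GE *; have l0 : 0 < l by rewrite ltr_wpDl.
have G0 : 0 <= G by rewrite GE sqrtr_ge0.
have hl0 : 0 <= h * l by rewrite mulr_ge0 ?(ltW h0) ?(ltW l0).
have be0 : 0 <= h * G + eta by rewrite addr_ge0// mulr_ge0// ltW.
have v0 : 0 <= eta + 2 * h * n%:R by rewrite addr_ge0// !mulr_ge0// ltW.
apply: le_trans (lerD (radius_sum_le eta N0 hl0 be0 v0) (lexx _)) _.
set S := Num.sqrt (e * n%:R); set q := Num.sqrt 2.
have q2 : q ^+ 2 = 2 :> R by rewrite sqr_sqrtr.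
have q0 : 0 <= q by exact: sqrtr_ge0.
have q_le : q <= 142 / 100.
  by rewrite -(@ler_sqr R) ?nnegrE// q2; lra.
have S0 : 0 <= S by exact: sqrtr_ge0.
have S2 : S ^+ 2 = e * n%:R by rewrite sqr_sqrtr// mulr_ge0// ltW.
have NvE : N%:R * (eta + 2 * h * n%:R) = w ^+ 2 + 2 * (e * n%:R).
  by rewrite wE eE; ring.
have sqrtNv : Num.sqrt (N%:R * (eta + 2 * h * n%:R)) <= w + q * S.
  rewrite NvE -(@ler_sqr R) ?nnegrE ?sqrtr_ge0 ?addr_ge0 ?mulr_ge0//.
  rewrite sqr_sqrtr; last by rewrite addr_ge0 ?sqr_ge0// !mulr_ge0// ltW.
  by rewrite sqrrD exprMn q2 S2 lerD2r lerDl mulrn_wge0// !mulr_ge0.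
have eG : e * G <= q * S.
  rewrite -(@ler_sqr R) ?nnegrE ?mulr_ge0 ?(ltW e0)//.
  rewrite !exprMn q2 S2 GE sqr_sqrtr ?mulr_ge0 ?(ltW l0)//.
  have : e * l <= 2 by apply: le_trans eL; rewrite ler_pM2l.
  move=> el; rewrite (_ : e ^+ 2 * (l * n%:R) = (e * l) * (e * n%:R)); last by ring.
  by apply: ler_wpM2r => //; rewrite mulr_ge0// ltW.
have le0 : 0 <= l * e by rewrite mulr_ge0 ?(ltW l0) ?(ltW e0).
rewrite (_ : h * l * _ + _ + w = l * e * ((e * G + w ^+ 2) / 2
   + Num.sqrt (N%:R * (eta + 2 * h * n%:R)) * (q / 2)) + w ^+ 2 + w); last first.
  by rewrite wE eE; ring.
have w2 : w ^+ 2 <= w by rewrite expr2; apply: ler_piMr.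
have key : (e * G + w ^+ 2) / 2 + Num.sqrt (N%:R * (eta + 2 * h * n%:R)) * (q / 2)
    <= 171 / 100 * S + 2 * w.
  have H1 := ler_wpM2r (divr_ge0 q0 (ler0n R 2)) sqrtNv.
  have H2 : q * S <= 142 / 100 * S by exact: ler_wpM2r.
  have H3 : q * w <= 142 / 100 * w by exact: ler_wpM2r.
  have H4 : (w + q * S) * (q / 2) = q * w / 2 + S.
    transitivity (q * w / 2 + q ^+ 2 / 2 * S); first by ring.
    by rewrite q2; field.
  by move: H1; rewrite H4; lra.
have H5 := ler_wpM2l le0 key.
have lL : l * e * (171 / 100 * S + 2 * w) <= L * e * (171 / 100 * S + 2 * w).
  apply: ler_wpM2r; first by rewrite addr_ge0 ?mulr_ge0.
  by apply: ler_wpM2r => //; exact: ltW.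
have LeS : 0 <= L * e * S.
  by rewrite !mulr_ge0 ?(ltW e0)// (le_trans (ltW l0)).
by move: H5 lL w2 wle LeS; rewrite -/S; lra.
Qed.

(** The [N] one-move errors add up to [e D s] with [D] fixed, so a small [s] makes them negligible;
    [s] is tuned so that [N] moves last exactly [e]. *)
Lemma fine_step_exists n (B LU C L e : R) : (0 < n)%N -> 0 <= B -> 0 <= LU -> 0 <= C ->
  0 <= kap C (n := n) -> LU + 1 <= L -> 0 < e -> e * L <= 2 ->
  exists N s, [/\ (0 < N)%N, 0 < s <= 1, e = N%:R * (s ^+ 2 / 2) &
    error_radius B LU C (Num.sqrt ((LU + 1) * n%:R)) s N (n := n)
      <= 182 / 100 * (L * e * Num.sqrt (e * n%:R))].
Proof.
move=> n0 B0 LU0 C0 kap0 LUL e0 eL.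
have L0 : 0 < L by apply: lt_le_trans LUL; rewrite ltr_wpDl.
have n_gt0 : 0 < n%:R :> R by rewrite ltr0n.
have Le0 : 0 < L * e by rewrite mulr_gt0.
set T := 10^-1 * (L * e * Num.sqrt (e * n%:R)).
have T0 : 0 < T by rewrite !mulr_gt0 ?invr_gt0 ?sqrtr_gt0 ?mulr_gt0.
have d0 : 0 < 2 * (L * e) + 2 by rewrite ltr_wpDl// mulr_ge0// ltW.
pose w0 := Num.min 1 (T / (2 * (L * e) + 2)).
have w00 : 0 < w0 by rewrite lt_min ltr01 divr_gt0.
have w01 : w0 <= 1 by rewrite ge_min lexx.
have w0T : w0 * (2 * (L * e) + 2) <= T.
  by rewrite -ler_pdivlMr// ge_min lexx orbT.
pose D := (Cstep B LU * m4 n) * kap C (n := n).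
have D0 : 0 <= D by rewrite !mulr_ge0 ?Cstep_ge0 ?m4_ge0.
(* [s <= s0] gives [e D s <= w0^2]; the added 1 keeps the denominator positive. *)
pose s0 := Num.min 1 (w0 ^+ 2 / (e * D + 1)).
have eD1 : 0 < e * D + 1 by rewrite ltr_wpDl// mulr_ge0// ltW.
have s00 : 0 < s0 by rewrite lt_min ltr01 divr_gt0// exprn_gt0.
(* [N] exceeds [2 e / s0^2], the condition for [s = sqrt (2 e / N)] to be at most [s0]. *)
pose N := (Num.truncn (2 * e / s0 ^+ 2)).+1.
have N_gt0 : 0 < N%:R :> R by rewrite ltr0n.
have NE : 2 * e / s0 ^+ 2 < N%:R by exact: truncnS_gt.
pose s := Num.sqrt (2 * e / N%:R).
have s2 : s ^+ 2 = 2 * e / N%:R by rewrite sqr_sqrtr// divr_ge0// mulr_ge0// ltW.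
have s_gt0 : 0 < s by rewrite sqrtr_gt0 divr_gt0// mulr_gt0.
have ss0 : s <= s0.
  rewrite -(@ler_sqr R) ?nnegrE ?(ltW s_gt0) ?(ltW s00)// s2.
  rewrite ler_pdivrMr// (mulrC (s0 ^+ 2)).
  by move: NE; rewrite ltr_pdivrMr ?exprn_gt0// => /ltW.
have s1 : s <= 1 by apply: le_trans ss0 _; rewrite ge_min lexx.
have eE : e = N%:R * (s ^+ 2 / 2) by rewrite s2; field; rewrite gt_eqF.
have errE : N%:R * step_error B LU C s (n := n) = e * D * s.
  by rewrite /step_error /D {1}eE; ring.
have err_le : e * D * s <= w0 ^+ 2.
  have : s <= w0 ^+ 2 / (e * D + 1) by apply: le_trans ss0 _; rewrite ge_min lexx orbT.
  rewrite ler_pdivlMr// => H; apply: le_trans H; rewrite mulrC.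
  by apply: ler_wpM2l; [exact: ltW|rewrite lerDl].
have err0 : 0 <= e * D * s by exact: mulr_ge0 (mulr_ge0 (ltW e0) D0) (ltW s_gt0).
exists N, s; split => //; first by rewrite s_gt0.
have w_le : Num.sqrt (e * D * s) <= w0.
  by rewrite -(@ler_sqr R) ?nnegrE ?sqrtr_ge0 ?(ltW w00)// sqr_sqrtr.
apply: (@error_radius_le n N B LU C _ L s e (Num.sqrt (e * D * s))) => //.
- exact: le_trans w01.
- by rewrite sqr_sqrtr// errE.
- apply: le_trans w0T; apply: ler_wpM2r => //; exact: ltW.
Qed.

End radius_estimate.

(** * One step of the algorithm *)

Section ula_step.
Context {R : realType} {n : nat} (U : 'rV[R]_n -> R) (gU : 'rV[R]_n -> 'rV[R]_n).
Variables (B LU C L e q : R) (pi : probability 'rV[R]_n R) (E : 'rV[R]_n -> R).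
Local Open Scope ereal_scope.
Notation V := ('rV[R]_n).
Notation gam := (gaussian (R := R) (n := n)).
Hypotheses
  (n_gt0 : (0 < n)%N)
  (U_taylor : forall x v, (`|U (x + v) - U x - dotv (gU x) v| <= LU / 2 * enorm v ^+ 2)%R)
  (U_lip : forall x v, (`|U (x + v) - U x| <= B * enorm v)%R)
  (gU_le : forall x, (enorm (gU x) <= B)%R) (B_ge0 : (0 <= B)%R) (LU_ge0 : (0 <= LU)%R)
  (gU_lip : forall x y, (enorm (gU x - gU y) <= LU * enorm (x - y))%R)
  (mU : measurable_fun setT U) (mgU : measurable_fun setT gU)
  (U_ge0 : forall x, (0 <= U x)%R) (C_ge0 : (0 <= C)%R)
  (piE : forall f : V -> \bar R, measurable_fun setT f -> (forall x, 0 <= f x) ->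
     \int[pi]_x f x = \int[gam]_x (f x * (C * expR (- U x))%:E))
  (mE : measurable_fun setT E) (E_ge0 : forall x, (0 <= E x)%R)
  (E_le : forall x v, (E (x + v) <= E x + dotv (gU x + x) v + (LU + 1) / 2 * enorm v ^+ 2)%R)
  (LUL : (LU + 1 <= L)%R) (e_gt0 : (0 < e)%R) (eL : (e * L <= 2)%R) (q_ge0 : (0 <= q)%R)
  (contract : forall x y, (enorm (x - e *: (gU x + x) - (y - e *: (gU y + y)))
     <= q * enorm (x - y))%R).

Definition ula_bias : R := (182 / 100 * (L * e * Num.sqrt (e * n%:R)))%R.

Lemma ula_bias_ge0 : (0 <= ula_bias)%R.
Proof.
have L0 : (0 <= L)%R by apply: le_trans LUL; exact: addr_ge0.
by apply: mulr_ge0 => //; apply: mulr_ge0; [exact: mulr_ge0 L0 (ltW e_gt0)|exact: sqrtr_ge0].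
Qed.

(** [zeta] is the law of the pair made of the Langevin step driven by the accumulated noise, of
    variance [2 e] per coordinate, and of the Metropolis chain after [N] moves. *)
Lemma ula_step_coupling (xi : probability (V * V)%type R) (a : R) : (0 <= a)%R ->
  (forall f : V -> \bar R, measurable_fun setT f -> (forall x, 0 <= f x) ->
     \int[xi]_p f p.2 = \int[pi]_x f x) ->
  \int[xi]_p (enorm (p.1 - p.2) ^+ 2)%:E <= (a ^+ 2)%:E ->
  exists zeta : probability (V * V)%type R,
  [/\ forall f : V -> \bar R, measurable_fun setT f -> (forall x, 0 <= f x) ->
        \int[zeta]_p f p.1 = \int[xi]_p \int[gam]_z
          f (p.1 - e *: (gU p.1 + p.1) + Num.sqrt (2 * e) *: z)%R,
      forall f : V -> \bar R, measurable_fun setT f -> (forall x, 0 <= f x) ->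
        \int[zeta]_p f p.2 = \int[pi]_x f x &
      \int[zeta]_p (enorm (p.1 - p.2) ^+ 2)%:E <= ((q * a + ula_bias) ^+ 2)%:E].
Proof.
move=> a0 xi2 cost.
have kap0 : (0 <= kap C (n := n))%R.
  exact: le_trans ler01 (kap_ge1 mU U_ge0 C_ge0 piE).
have [N [s [N0 /andP[s0 s1] eE err]]] :=
  fine_step_exists n_gt0 B_ge0 LU_ge0 C_ge0 kap0 LUL e_gt0 eL.
have G0 : (0 <= Num.sqrt ((LU + 1) * n%:R))%R by exact: sqrtr_ge0.
have GE : (Num.sqrt ((LU + 1) * n%:R) ^+ 2 = (LU + 1) * n%:R)%R.
  by rewrite sqr_sqrtr// mulr_ge0// addr_ge0.
have G_le := integral_gradient_sqr_le U_taylor U_lip gU_le B_ge0 LU_ge0 mU mgU U_ge0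
  C_ge0 piE mE E_ge0 E_le.
rewrite -GE in G_le.
have [M [Ma Mb _ Md]] := coupled_chain U_taylor U_lip gU_le B_ge0 LU_ge0 gU_lip
  mU mgU U_ge0 C_ge0 piE G0 G_le xi2 s0 s1 N.
rewrite -eE in Md.
have sE : (Num.sqrt N%:R * s = Num.sqrt (2 * e))%R.
  rewrite {1}eE (_ : 2 * (N%:R * (s ^+ 2 / 2)) = N%:R * s ^+ 2)%R; last by field.
  by rewrite sqrtrM// sqrtr_sqr gtr0_norm.
rewrite sE in Mb.
pose S := ((V * V) * (V * V))%type.
have m11 : measurable_fun setT (fun x : S => x.1.1) by exact: (measurableT_comp measurable_fst measurable_fst).
have m12 : measurable_fun setT (fun x : S => x.1.2) by exact: (measurableT_comp measurable_snd measurable_fst).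
have m21 : measurable_fun setT (fun x : S => x.2.1) by exact: (measurableT_comp measurable_fst measurable_snd).
have m22 : measurable_fun setT (fun x : S => x.2.2) by exact: (measurableT_comp measurable_snd measurable_snd).
pose T (x : V) := (x - e *: (gU x + x))%R.
have mT d (X : measurableType d) (u : X -> V) : measurable_fun setT u ->
    measurable_fun setT (fun x => T (u x)).
  move=> mu; apply: measurable_addrV => //; apply: measurable_opprV.
  apply: measurable_scalerV => //; apply: measurable_addrV => //.
  exact: measurableT_comp.
have mTw : measurable_fun setT (fun x : S => T x.1.1 + x.2.2)%R.
  by apply: measurable_addrV => //; exact: mT.
have mphi : measurable_fun setT (fun x : S => (T x.1.1 + x.2.2, x.2.1)%R).
  exact/measurable_fun_pair.
have [Q QE] := image_probability M mphi; exists Q; split.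
- move=> f mf f0; rewrite QE//=; last first.
    by apply: measurableT_comp => //; exact: measurable_fst.
  rewrite (Mb (fun p w => f (T p.1 + w)%R))//.
  apply: measurableT_comp => //; apply: measurable_addrV => //.
  by apply: mT; exact: (measurableT_comp measurable_fst measurable_fst).
- move=> f mf f0; rewrite QE//=; first exact: Ma.
  by apply: measurableT_comp => //; exact: measurable_snd.
- have mcost : measurable_fun setT (fun p : V * V => (enorm (p.1 - p.2) ^+ 2)%R).
    apply: measurable_funX; apply: measurable_enorm; apply: measurable_addrV => //.
    by apply: measurable_opprV.
  rewrite (QE (fun p => (enorm (p.1 - p.2) ^+ 2)%:E)) /=; last 2 first.
  + exact/measurable_EFinP.
  + by move=> p; rewrite lee_fin sqr_ge0.
  have md1 : measurable_fun setT (fun x : S => enorm (x.1.1 - x.1.2)).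
    by apply: measurable_enorm; apply: measurable_addrV => //; exact: measurable_opprV.
  have md2 : measurable_fun setT (fun x : S =>
      enorm (x.2.1 - x.1.2 - x.2.2 + e *: (gU x.1.2 + x.1.2))).
    apply: measurable_enorm; apply: measurable_addrV; last first.
      by apply: measurable_scalerV => //; apply: measurable_addrV => //; exact: measurableT_comp.
    apply: measurable_addrV; last exact: measurable_opprV.
    by apply: measurable_addrV => //; exact: measurable_opprV.
  have mq : measurable_fun setT (fun x : S => q * enorm (x.1.1 - x.1.2))%R by exact: measurable_funM.
  apply: (@L2_le_mono _ _ _ M (fun x : S => enorm (T x.1.1 + x.2.2 - x.2.1)) (fun x : S =>
    q * enorm (x.1.1 - x.1.2) + enorm (x.2.1 - x.1.2 - x.2.2 + e *: (gU x.1.2 + x.1.2)))%R).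
  + by apply: measurable_enorm; apply: measurable_addrV => //; exact: measurable_opprV.
  + exact: measurable_funD.
  + move=> x; rewrite enorm_ge0/=.
    (* Inserting [T x.1.2]: the first difference is contracted, the second is the deviation after
       [N] moves. *)
    rewrite (_ : T x.1.1 + x.2.2 - x.2.1 = (T x.1.1 - T x.1.2)
       - (x.2.1 - x.1.2 - x.2.2 + e *: (gU x.1.2 + x.1.2)))%R; last first.
      by apply: dotv_ext => v; rewrite /T !dotvE; ring.
    apply: le_trans (ler_enormB _ _) _; rewrite lerD2r; exact: contract.
  + apply: L2_leD => //; [exact: mulr_ge0|exact: ula_bias_ge0| |].
      apply: L2_leZ => //; rewrite /L2_le.
      rewrite (Mb (fun p _ => (enorm (p.1 - p.2) ^+ 2)%:E)).
      * apply: le_trans cost; rewrite le_eqVlt; apply/orP; left; apply/eqP.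
        by apply: eq_integral => p _; exact: (integral_probability_cst gam).
      * by apply/measurable_EFinP; exact: (measurableT_comp mcost measurable_fst).
      * by move=> p _; rewrite lee_fin sqr_ge0.
    apply: le_trans Md _; rewrite lee_fin ler_sqr ?nnegrE ?ula_bias_ge0//.
    rewrite /error_radius addr_ge0 ?sqrtr_ge0//; apply: sumr_ge0 => j _.
    have eta0 := step_error_ge0 B_ge0 LU_ge0 mU U_ge0 C_ge0 piE s0 s1.
    apply: addr_ge0 => //; apply: mulr_ge0.
      by rewrite mulr_ge0 ?addr_ge0// divr_ge0 ?sqr_ge0.
    rewrite /displacement_radius addr_ge0 ?sqrtr_ge0// mulr_ge0// addr_ge0//.
    by rewrite mulr_ge0// divr_ge0 ?sqr_ge0.
Qed.

End ula_step.

(** * Wasserstein distance *)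

Section marginals.
Context {R : realType}.
Local Open Scope ereal_scope.

(** Converts laws on sets into integrals of nonnegative functions, the form in which couplings are
    handled above. *)
Lemma marginalP d d' (S : measurableType d) (T : measurableType d') (xi : probability S R)
    (rho : probability T R) (h : S -> T) : measurable_fun setT h ->
  (forall A, measurable A -> xi (h @^-1` A) = rho A) <->
  (forall f : T -> \bar R, measurable_fun setT f -> (forall x, 0 <= f x) ->
    \int[xi]_p f (h p) = \int[rho]_x f x).
Proof.
move=> mh; split=> [xiE f mf f0|xiE A mA].
  pose X : {mfun S >-> T} := HB.pack h (isMeasurableFun.Build _ _ _ _ h mh).
  rewrite -(ge0_integral_distribution X mf f0).
  by apply: eq_measure_integral => A mA _; exact: xiE.
have mA1 : measurable_fun setT (EFin \o \1_A : T -> \bar R).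
  by apply/measurable_EFinP; exact: measurable_indic.
have mhA : measurable (h @^-1` A) by rewrite -[X in measurable X]setTI; exact: mh.
transitivity (\int[rho]_x (\1_A x)%:E); last by rewrite integral_indic// setIT.
rewrite -(xiE (EFin \o \1_A) mA1 (fun x => ltac:(by rewrite lee_fin))).
transitivity (\int[xi]_x (\1_(h @^-1` A) x)%:E); first by rewrite integral_indic// setIT.
by apply: eq_integral => x _; rewrite !indicE.
Qed.

Lemma couplingP n (rho1 rho2 : probability 'rV[R]_n R) xi :
  coupling rho1 rho2 xi <->
  (forall f : 'rV[R]_n -> \bar R, measurable_fun setT f -> (forall x, 0 <= f x) ->
    \int[xi]_p f p.1 = \int[rho1]_x f x) /\
  (forall f : 'rV[R]_n -> \bar R, measurable_fun setT f -> (forall x, 0 <= f x) ->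
    \int[xi]_p f p.2 = \int[rho2]_x f x).
Proof.
have E1 (A : set 'rV[R]_n) : A `*` setT = fst @^-1` A :> set ('rV[R]_n * 'rV[R]_n).
  by apply/seteqP; split=> // p /= [].
have E2 (A : set 'rV[R]_n) : setT `*` A = snd @^-1` A :> set ('rV[R]_n * 'rV[R]_n).
  by apply/seteqP; split=> // p /= [].
split=> [[xi1 xi2]|[xi1 xi2]].
  split; [apply/(marginalP xi rho1 measurable_fst)|apply/(marginalP xi rho2 measurable_snd)].
    by move=> A mA; rewrite -xi1// E1.
  by move=> A mA; rewrite -xi2// E2.
split=> A mA; [rewrite E1|rewrite E2].
  exact: ((marginalP xi rho1 measurable_fst).2 xi1).
exact: ((marginalP xi rho2 measurable_snd).2 xi2).
Qed.

(** Independence identifies the joint law with a product measure, by uniqueness on rectangles;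
    Tonelli's theorem does the rest. *)
Lemma integral_independent d (Omega : measurableType d) (P : probability Omega R) n
    (X Z : {RV P >-> 'rV[R]_n}) (h : 'rV[R]_n * 'rV[R]_n -> \bar R) :
  has_law Z (std_normal n) -> independent Z X ->
  measurable_fun setT h -> (forall x, 0 <= h x) ->
  \int[P]_w h (X w, Z w) =
  \int[distribution P X]_x \int[gaussian (n := n)]_z h (x, z).
Proof.
move=> ZE ZX mh h0.
have mY : measurable_fun setT (fun w => (X w, Z w)).
  by apply/measurable_fun_pair; exact: measurable_funP.
pose Y : {mfun Omega >-> ('rV[R]_n * 'rV[R]_n)%type} :=
  HB.pack (fun w => (X w, Z w)) (isMeasurableFun.Build _ _ _ _ _ mY).
transitivity (\int[distribution P Y]_p h p).
  by rewrite (ge0_integral_distribution Y mh h0).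
transitivity (\int[distribution P X \x gaussian (n := n)]_p h p); last first.
  exact: (fubini_tonelli1 h mh h0).
apply: eq_measure_integral => A mA _; apply/esym.
apply: (@product_measure_unique _ _ _ _ _ (distribution P X) (gaussian (n := n))
  (distribution P Y)) => // A1 A2 mA1 mA2.
transitivity (P (Z @^-1` A2 `&` X @^-1` A1)); first by rewrite setIC.
by rewrite ZX// muleC; congr (_ * _); exact: ZE.
Qed.

(** Dividing by the Gaussian density removes the quadratic part of the potential and leaves
    [exp (- U)] up to a constant. *)
Lemma gibbs_gaussianP n (U : 'rV[R]_n -> R) (pi : probability 'rV[R]_n R) :
  measurable_fun setT U ->
  density_proportional_to (fun x => expR (- (U x + 2^-1 * enorm x ^+ 2))) pi ->
  exists2 C : R, (0 <= C)%R &
    forall f : 'rV[R]_n -> \bar R, measurable_fun setT f -> (forall x, 0 <= f x) ->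
      \int[pi]_x f x = \int[gaussian (n := n)]_x (f x * (C * expR (- U x))%:E).
Proof.
move=> mU [c piE].
(* [density_proportional_to] allows any real [c]; a negative one would make the total mass
   nonpositive. *)
have c0 : (0 <= c)%R.
  rewrite leNgt; apply/negP => c0.
  have : pi setT <= 0.
    rewrite piE// integralE [X in X - _](_ : _ = 0); last first.
      rewrite (eq_integral (cst 0)) ?integral0// => x _.
      by apply: (@le0_funeposE _ _ setT); rewrite ?inE// => y _; rewrite lee_fin nmulr_rle0 ?expR_ge0.
    by rewrite sub0e oppe_le0; exact: integral_ge0.
  by rewrite probability_setT lee_fin leNgt ltr01.
have k0 : (0 < normal_peak 1 ^+ n :> R)%R by rewrite exprn_gt0// normal_peak_gt0.
have C0 : (0 <= c / normal_peak 1 ^+ n)%R by rewrite divr_ge0// ltW.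
exists (c / normal_peak 1 ^+ n)%R => // f mf f0.
have mE : measurable_fun setT (fun x => expR (- U x)).
  by apply: measurableT_comp => //; exact: measurableT_comp.
pose G x := (c / normal_peak 1 ^+ n * expR (- U x))%R.
have mG : measurable_fun setT G by exact: measurable_funM.
have G0 x : (0 <= G x)%R by rewrite mulr_ge0// expR_ge0.
rewrite (ge0_integral_gaussian_density (f := fun x => f x * (G x)%:E)); last 2 first.
- by apply: emeasurable_funM => //; exact/measurable_EFinP.
- by move=> x; rewrite mule_ge0// lee_fin.
have mGg : measurable_fun setT (fun x => G x * gaussian_density x)%R.
  by apply: measurable_funM => //; exact: measurable_gaussian_density.
have Gg0 x : (0 <= G x * gaussian_density x)%R.
  by rewrite mulr_ge0// gaussian_density_ge0.
have piG A : measurable A ->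
    pi A = \int[lebesgue_rV n]_(x in A) (G x * gaussian_density x)%:E.
  move=> mA; rewrite piE//; apply: eq_integral => x _; congr EFin.
  rewrite /G /gaussian_density opprD expRD.
  rewrite (_ : - (2^-1 * _) = - enorm x ^+ 2 / 2)%R; last by ring.
  by field; rewrite gt_eqF.
rewrite (ge0_integral_density mGg Gg0 piG mf f0).
by apply: eq_integral => x _; rewrite EFinM muleA.
Qed.

End marginals.

Section wasserstein_bound.
Context {R : realType} {n : nat}.
Local Open Scope ereal_scope.
Notation cost xi := (\int[xi]_p (enorm (p.1 - p.2)%R ^+ 2)%:E).

(** No optimal coupling is used: any cost above the infimum is undercut by some coupling, to which
    [step] applies. If the distance on the right is infinite, so is the right side, because
    [q > 0]. *)
Lemma W2_le_affine (rho rho' pi : probability 'rV[R]_n R) (q c : R) :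
  (0 < q)%R -> (0 <= c)%R ->
  (forall xi a, (0 <= a)%R -> coupling rho pi xi -> cost xi <= (a ^+ 2)%:E ->
    exists2 zeta, coupling rho' pi zeta & cost zeta <= ((q * a + c) ^+ 2)%:E) ->
  W2 rho' pi <= q%:E * W2 rho pi + c%:E.
Proof.
move=> q0 c0 step; rewrite /W2.
set A := [set _ | _ in coupling rho pi]; set A' := [set _ | _ in coupling rho' pi].
have A_ge0 : 0 <= ereal_inf A.
  by apply: le_ereal_inf_tmp => _ [xi _ <-]; apply: integral_ge0 => p _; rewrite lee_fin sqr_ge0.
have A'_ge0 : 0 <= ereal_inf A'.
  by apply: le_ereal_inf_tmp => _ [xi _ <-]; apply: integral_ge0 => p _; rewrite lee_fin sqr_ge0.
have le_A' a : (0 <= a)%R -> ereal_inf A < (a ^+ 2)%:E ->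
    ereal_inf A' `^ 2^-1 <= (q * a + c)%:E.
  move=> a0 /ereal_inf_lt[_ [xi xiC <-] xia].
  have [zeta zetaC zeta_le] := step xi a a0 xiC (ltW xia).
  have b0 : (0 <= q * a + c)%R by rewrite addr_ge0// mulr_ge0// ltW.
  rewrite (_ : (q * a + c)%:E = ((q * a + c) ^+ 2)%:E `^ 2^-1); last first.
    by rewrite poweR_EFin powR12_sqrt ?sqr_ge0// sqrtr_sqr ger0_norm.
  apply: gt0_ler_poweR => //.
  - by rewrite in_itv/= andbC leey.
  - by rewrite in_itv/= andbC leey lee_fin sqr_ge0.
  - by apply: le_trans zeta_le; apply: ereal_inf_lbound; exists zeta.
case: (ereal_inf A) A_ge0 le_A' => [s||]//.
  rewrite lee_fin => s0 le_A'; rewrite poweR_EFin powR12_sqrt// -EFinM -EFinD.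
  apply/lee_addgt0Pr => e e0; rewrite -EFinD.
  (* The margin [e / q] in the input becomes [e] after multiplication by [q]. *)
  have a0 : (0 < Num.sqrt s + e / q)%R by rewrite ltr_wpDl ?sqrtr_ge0// divr_gt0.
  rewrite (_ : _ + e = q * (Num.sqrt s + e / q) + c)%R; last by field; rewrite gt_eqF.
  apply: le_A'; first exact: ltW.
  rewrite lte_fin -[X in (X < _)%R]sqr_sqrtr// ltr_sqr ?nnegrE ?sqrtr_ge0//; last exact: ltW.
  by rewrite ltrDl divr_gt0.
by move=> _ _; rewrite poweRE/= invr_eq0 pnatr_eq0/= gt0_muley ?lte_fin// addye ?leey.
Qed.

End wasserstein_bound.

Theorem corollary3p7 (R : realType) (d : nat) (d_gt0 : (0 < d)%N)
  (mu : R -> R)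
  (mu_gt0 : forall s, 0 < s -> 0 < mu s)
  (mu_cvg0 : mu s @[s --> 0^'+] --> 0)
  (mu_exp_cvg0 : expR (- mu s / s) / s @[s --> 0^'+] --> 0)
  (g : 'rV[R]_d -> R) (r K G : R)
  (g_C2 : C2 g)
  (r_gt0 : 0 < r) (g_bounded : forall x, `|g x| <= r)
  (K_gt0 : 0 < K) (G_gt0 : 0 < G)
  (hess_lb : (-oo < ereal_inf
    [set (lambda_min (hessian g x))%:E | x in [set: 'rV[R]_d]])%E)
  (g_lip : forall x y, `|g x - g y| <= K * enorm (x - y))
  (grad_lip : forall x y,
    enorm (gradient g x - gradient g y) <= G * enorm (x - y))
  (sigma : R) (sigma_gt0 : 0 < sigma)
  (sigma_gtH : Num.max (- H_ mu g sigma) 0 < sigma)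
  (eps : R) (eps_gt0 : 0 < eps)
  (eps_le : eps <= 2 / (alpha_ mu g sigma + L_ mu r K G sigma))
  (pi_star : probability 'rV[R]_d R)
  (pi_starE : density_proportional_to (fun x => expR (- V_ mu g sigma x)) pi_star)
  (pi0 : probability 'rV[R]_d R)
  (disp : measure_display) (Omega : measurableType disp)
  (P : probability Omega R) (X Z : nat -> {RV P >-> 'rV[R]_d})
  (ula : unadjusted_langevin (V_ mu g sigma) eps pi0 X Z)
  (k : nat) :
  (W2 (distribution P (X k)) pi_star <=
     ((1 - alpha_ mu g sigma * eps) ^+ k)%:E * W2 pi0 pi_star
     + (182 / 100 * (L_ mu r K G sigma / alpha_ mu g sigma)
        * Num.sqrt (eps * d%:R))%:E)%E.
Proof.
set al := alpha_ mu g sigma in eps_le *; set L := L_ mu r K G sigma in eps_le *.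
set V := V_ mu g sigma in pi_starE ula.
pose U x := - ln (F_ mu g sigma x).
pose gU := gradU mu g sigma.
pose M := LU mu r K G sigma.
have M_ge0 : 0 <= M := LU_ge0 mu r K_gt0 G_gt0 sigma_gt0.
have gradV x : gradient V x = gU x + x := gradient_V mu g_C2 sigma_gt0 x.
have V_lower := V_strongly_convex mu d_gt0 g_C2 hess_lb sigma_gt0.
have V_upper := V_descent mu g_C2 g_bounded K_gt0 G_gt0 g_lip grad_lip sigma_gt0.
rewrite -/gU -/V -/al in V_lower; rewrite -/gU -/V -/M in V_upper.
have al_gt0 : 0 < al.
  rewrite /al /alpha_ -ltrBlDr sub0r ltr_pdivlMr// mulN1r ltrNl.
  by apply: le_lt_trans sigma_gtH; rewrite le_max lexx.
(* [2 G / sigma] in [L_] against [G / sigma] in [LU] makes this strict; cocoercivity divides by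
   [L - al]. *)
have ML : M + 1 < L.
  rewrite /M /L /L_ /LU ltrD2r ltrD2l ltr_pM2r ?invr_gt0//.
  by rewrite mulr_natl mulr2n ltrDl.
(* Comparing the lower and upper quadratic bounds at 0 in a unit direction, which exists since
   [d_gt0]. *)
have alM : al <= M + 1.
  pose v : 'rV[R]_d := delta_mx 0 (Ordinal d_gt0).
  have v1 : enorm v ^+ 2 = 1 by rewrite enorm_sqr dotv_delta mxE !eqxx.
  have := le_trans (V_lower 0 v) (V_upper 0 v).
  by rewrite v1 !mulr1 lerD2l ler_pM2r ?invr_gt0.
have alL : al < L by exact: le_lt_trans ML.
have L_gt0 : 0 < L by exact: lt_trans alL.
have eps_alL : eps * (al + L) <= 2 by rewrite -ler_pdivlMr// addr_gt0.
have eL : eps * L <= 2.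
  by apply: le_trans eps_alL; rewrite ler_pM2l// lerDr ltW.
pose q := 1 - al * eps.
(* Since [al < L], one has [2 al eps < eps (al + L) <= 2]. *)
have q_gt0 : 0 < q.
  rewrite subr_gt0 mulrC -(ltr_pM2l (ltr0n R 2)) mulr1.
  apply: lt_le_trans eps_alL; rewrite mulrCA ltr_pM2l//.
  by rewrite mulr_natl mulr2n ltrD2l.
have contract x y : enorm (x - eps *: (gU x + x) - (y - eps *: (gU y + y)))
    <= q * enorm (x - y).
  apply: (gradient_step_contraction (p := fun x => gU x + x) V_lower _ al_gt0 alL eps_gt0 eps_le).
  move=> a v; apply: le_trans (V_upper a v) _; rewrite lerD2l.
  by rewrite ler_wpM2r ?sqr_ge0// ler_pM2r ?invr_gt0// ltW.
have mU : measurable_fun setT U := measurable_U mu sigma g_C2.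
have mgU : measurable_fun setT gU := measurable_gradU mu sigma g_C2.
have mV : measurable_fun setT V.
  apply: measurable_funD => //; apply: measurable_funM => //.
  by apply: measurable_funX; exact: measurable_enorm.
have V_ge0 x : 0 <= V x.
  by rewrite addr_ge0 ?U_ge0// mulr_ge0 ?sqr_ge0.
have B_ge0 : 0 <= K / sigma by rewrite divr_ge0// ltW.
have [C C_ge0 piE] := gibbs_gaussianP mU pi_starE.
have step := ula_step_coupling d_gt0
  (U_taylor mu g_C2 g_bounded K_gt0 G_gt0 g_lip grad_lip sigma_gt0)
  (U_lip mu g_C2 K_gt0 G_gt0 g_lip grad_lip sigma_gt0)
  (enorm_gradU_le mu g_C2 K_gt0 G_gt0 g_lip grad_lip sigma_gt0) B_ge0 M_ge0
  (gradU_lip mu g_C2 g_bounded K_gt0 G_gt0 g_lip grad_lip sigma_gt0) mU mgU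
  (U_ge0 mu g sigma) C_ge0 piE mV V_ge0 V_upper (ltW ML) eps_gt0 eL (ltW q_gt0) contract.
have [X0 XS ZE ZX] := ula.
pose b := ula_bias (n := d) L eps.
pose c := 182 / 100 * (L / al) * Num.sqrt (eps * d%:R).
(* [c] is the fixed point of [a |-> q a + b], so the induction carries exactly [q^k a + c]. *)
have bE : q * c + b = c.
  by rewrite /b /ula_bias /q /c; field; rewrite gt_eqF.
have c_ge0 : 0 <= c.
  by apply: mulr_ge0; [apply: mulr_ge0 => //; exact: divr_ge0 (ltW _) (ltW _)|exact: sqrtr_ge0].
(* The induction on [k] runs on couplings, inside the infimum, so that the passage to distances
   occurs once, with factor [q^k]. *)
apply: W2_le_affine; [exact: exprn_gt0|exact: c_ge0|].
move=> xi a a0 xiC xi_le; elim: k => [|k [zeta zetaC zeta_le]].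
  exists xi.
    by case: xiC => xi1 xi2; split=> // A mA; rewrite xi1// -X0.
  apply: le_trans xi_le _; rewrite lee_fin expr0 mul1r ler_sqr ?nnegrE ?addr_ge0//.
  by rewrite lerDl.
have ak_ge0 : 0 <= q ^+ k * a + c.
  by rewrite addr_ge0// mulr_ge0// exprn_ge0// ltW.
have /couplingP[zeta1 zeta2] := zetaC.
have [zeta' [zeta'1 zeta'2 zeta'_le]] := step zeta _ ak_ge0 zeta2 zeta_le.
exists zeta'; last first.
  rewrite (_ : q ^+ k.+1 * a + c = q * (q ^+ k * a + c) + b)//.
  by rewrite -[in LHS]bE exprS; ring.
apply/couplingP; split=> // f mf f0; rewrite zeta'1//.
pose h (p : 'rV[R]_d * 'rV[R]_d) :=
  f (p.1 - eps *: (gU p.1 + p.1) + Num.sqrt (2 * eps) *: p.2).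
have mh : measurable_fun setT h.
  apply: measurableT_comp => //; apply: measurable_addrV.
    apply: measurable_addrV => //; apply: measurable_opprV.
    apply: measurable_scalerV => //; apply: measurable_addrV => //.
    by apply: measurableT_comp.
  exact: measurable_scalerV.
have h0 p : (0 <= h p)%E by exact: f0.
pose H x := (\int[gaussian (n := d)]_z h (x, z))%E.
have H0 x : (0 <= H x)%E by exact: integral_ge0.
have mH : measurable_fun setT H.
  by apply: (@measurable_integral_prod _ _ _ _ _ (gaussian (n := d)) (fun x z => h (x, z))) => //.
transitivity (\int[zeta]_p H p.1)%E => //; rewrite zeta1//.
rewrite -(integral_independent (ZE k) (ZX k) mh h0).
rewrite (ge0_integral_distribution (X k.+1) mf f0).
by apply: eq_integral => w _; rewrite /h/= XS gradV.
Qed.
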